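(* Let $\rho_1>0$, $\rho_2>1$ and let $s>0$, $t>\rho_2$ and $\tau>0$. Then the bilinear mappings a) $\mathcal{M}:(\mathcal{S}^{\rho_1}_{\rho_2})_0(\mathbb{R}^n)\times\mathcal{S}^{\tau}_{t,\,t-\rho_2,\,s-\rho_1}(\mathbb{H}^{n+1})\to(\mathcal{S}^{s}_{t})_0(\mathbb{R}^n)$, when $s>\rho_1$; b) $\mathcal{M}:(\mathcal{S}^{\rho_1}_{\rho_2})_0(\mathbb{R}^n)\times\mathcal{S}^{s}_{t,\,t-\rho_2,\,\tau}(\mathbb{H}^{n+1})\to(\mathcal{S}^{s}_{t})_0(\mathbb{R}^n)$, given by $\mathcal{M}:(\phi,\Phi)\mapsto\mathcal{M}_\phi\Phi$, are continuous.
   Context: Notation: $\mathbb{N}=\{0,1,2,\dots\}$, $\mathbb{R}_+=(0,\infty)$, $\mathbb{H}^{n+1}=\mathbb{R}^n\times\mathbb{R}_+$ with points $(b,a)$, $\langle x\rangle=(1+|x|^2)^{1/2}$, and for a multi-index $\beta\in\mathbb{N}^n$, $|\beta|=\beta_1+\dots+\beta_n$, $\beta!=\beta_1!\cdots\beta_n!$; $\beta!^{s}$ means $(\beta!)^s$. Gelfand-Shilov spaces: for $\rho_1,\rho_2>0$, $\mathcal{S}^{\rho_1}_{\rho_2}(\mathbb{R}^n)$ consists of all $\varphi$ in the Schwartz space $\mathcal{S}(\mathbb{R}^n)$ such that for some $h>0$ $$p_h^{\rho_1,\rho_2}(\varphi)=\sup_{x\in\mathbb{R}^n,\ \alpha,\beta\in\mathbb{N}^n}\frac{h^{|\alpha+\beta|}}{\alpha!^{\rho_2}\beta!^{\rho_1}}|x^\alpha\varphi^{(\beta)}(x)|<\infty,$$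 with the inductive limit topology (in $h>0$) defined by these norms. Its closed subspace, with the relative topology, is $$(\mathcal{S}^{\rho_1}_{\rho_2})_0(\mathbb{R}^n)=\left\{\varphi\in\mathcal{S}^{\rho_1}_{\rho_2}(\mathbb{R}^n):\int_{\mathbb{R}^n}x^m\varphi(x)\,dx=0\ \ \forall m\in\mathbb{N}^n\right\}.$$ Spaces on the upper half-space: for $s,t,\tau_1,\tau_2>0$, $\mathcal{S}^{s}_{t,\tau_1,\tau_2}(\mathbb{H}^{n+1})$ consists of all smooth functions $\Phi$ on $\mathbb{H}^{n+1}$ such that for every $\alpha\in\mathbb{N}$ there exists $h>0$ with $$p_{\alpha,h}^{s,t,\tau_1,\tau_2}(\Phi)=\sup\frac{h^{|\beta|+k+l_1+l_2}}{\beta!^{s}k!^{t}l_1!^{\tau_1}l_2!^{\tau_2}}\left(a^{l_1}+\frac{1}{a^{l_2}}\right)\langle b\rangle^k\left|\partial_a^\alpha\partial_b^\beta\Phi(b,a)\right|<\infty,$$ the supremum being over $(b,a)\in\mathbb{H}^{n+1}$, $(k,l_1,l_2)\in\mathbb{N}^3$, $\beta\in\mathbb{N}^n$. Its topology is defined by these seminorms as inductive limit with respect to $h$ and projective limit with respect to $\alpha$. Wavelet synthesis transform: $$\mathcal{M}_\phi\Phi(x)=\int_0^\infty\left(\int_{\mathbb{R}^n}\Phi(b,a)\frac{1}{a^n}\phi\left(\frac{x-b}{a}\right)db\right)\frac{da}{a},\qquad x\in\mathbb{R}^n.$$ *)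

(* Defs.v *)
From HB Require Import structures.
From mathcomp Require Import all_boot all_order all_algebra.
From mathcomp Require Import all_classical all_reals all_analysis.
From mathcomp.real_closed Require Import complex.

Set Implicit Arguments.
Unset Strict Implicit.
Unset Printing Implicit Defensive.

Import Order.TTheory GRing.Theory Num.Theory.
Import numFieldNormedType.Exports.
Import Normc.

Local Open Scope classical_set_scope.
Local Open Scope ring_scope.
Local Open Scope complex_scope.

(* Lebesgue measure on R^n, carried by n.-tuple R, as the n-fold product of the
   one-dimensional Lebesgue measure *)
Section lebesgue_tuple.
Context {R : realType}.
Local Notation mR := (measurableTypeR R).

Definition tuple_cons n (z : mR * n.-tuple mR) : n.+1.-tuple mR :=
  [tuple of z.1 :: z.2].

Lemma measurable_tuple_cons n : measurable_fun setT (@tuple_cons n).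
Proof. exact: measurable_cons. Qed.

Section step.
Context n (mu : {sigma_finite_measure set (n.-tuple mR) -> \bar R}).

Definition lebesgue_tuple_succ : set (n.+1.-tuple mR) -> \bar R :=
  pushforward (@lebesgue_measure R \x mu)%E (@tuple_cons n).

Let mu0 : lebesgue_tuple_succ set0 = 0%E.
Proof. by rewrite /lebesgue_tuple_succ /pushforward preimage_set0 measure0. Qed.

Let mu_ge0 A : (0 <= lebesgue_tuple_succ A)%E.
Proof. by rewrite /lebesgue_tuple_succ /pushforward measure_ge0. Qed.

Let mu_sigma_additive : semi_sigma_additive lebesgue_tuple_succ.
Proof.
have := @measure_semi_sigma_additive _ _ _
  (measure_function_pushforward__canonical__measure_function_Measure
    (@lebesgue_measure R \x mu)%E (@measurable_tuple_cons n)).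
exact.
Qed.

Let mu_sigma_finite : sigma_finite setT lebesgue_tuple_succ.
Proof.
have /sigma_finiteP[F [TF ndF Foo]] := sigma_finiteT (@lebesgue_measure R).
have /sigma_finiteP[G [TG ndG Goo]] := sigma_finiteT mu.
pose uncons (t : n.+1.-tuple mR) : mR * n.-tuple mR :=
  (thead t, [tuple of behead t]).
have consK : cancel (@tuple_cons n) uncons.
  by move=> [x t]; rewrite /uncons/=; congr (_, _); apply/val_inj.
have muncons : measurable_fun setT uncons.
  apply/measurable_fun_pair => /=; first exact: measurable_tnth.
  exact: measurable_behead.
exists (fun k => uncons @^-1` (F k `*` G k)) => [|k].
  apply/esym; rewrite -subTset => t _.
  have [i _ Fi] : (\bigcup_k F k) (uncons t).1 by rewrite -TF.
  have [j _ Gj] : (\bigcup_k G k) (uncons t).2 by rewrite -TG.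
  exists (maxn i j) => //; split.
    by move: Fi; apply/subsetPset/ndF/leq_maxl.
  by move: Gj; apply/subsetPset/ndG/leq_maxr.
have [[mF Fk] [mG Gk]] := (Foo k, Goo k); split.
  rewrite -[X in measurable X]setTI; apply: muncons => //.
  exact: measurableX.
rewrite /lebesgue_tuple_succ /pushforward -comp_preimage.
rewrite (_ : uncons \o _ = id) ?preimage_id; last first.
  by apply/funext => z /=; rewrite consK.
by rewrite product_measure1E// lte_mul_pinfty// ge0_fin_numE.
Qed.

HB.instance Definition _ := isMeasure.Build _ _ _
  lebesgue_tuple_succ mu0 mu_ge0 mu_sigma_additive.
HB.instance Definition _ := Measure_isSigmaFinite.Build _ _ _
  lebesgue_tuple_succ mu_sigma_finite.

End step.

Fixpoint lebesgue_tuple n :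
    {sigma_finite_measure set (n.-tuple mR) -> \bar R} :=
  if n is m.+1 then lebesgue_tuple_succ (lebesgue_tuple m)
  else \d_([tuple] : 0.-tuple mR).

End lebesgue_tuple.

Section complex_integral.
Context d (T : measurableType d) (R : realType).
Variables (mu : {measure set T -> \bar R}) (D : set T).

Definition Cintegrable (f : T -> R[i]) : Prop :=
  mu.-integrable D (fun x => (complex.Re (f x))%:E) /\
  mu.-integrable D (fun x => (complex.Im (f x))%:E).

Definition Cintegral (f : T -> R[i]) : R[i] :=
  (\int[mu]_(x in D) complex.Re (f x)) +i* (\int[mu]_(x in D) complex.Im (f x)).

Hypothesis mD : measurable D.

Lemma Cintegrable0 : Cintegrable (fun=> 0).
Proof. by split; exact: integrable0. Qed.

Lemma Cintegral0 : Cintegral (fun=> 0) = 0.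
Proof. by rewrite /Cintegral /Rintegral !integral0. Qed.

Let integrable_lin (f g : T -> R) (a b : R) :
  mu.-integrable D (EFin \o f) -> mu.-integrable D (EFin \o g) ->
  mu.-integrable D (fun x => (a * f x + b * g x)%:E).
Proof.
move=> fi gi.
have := integrableD mD (integrableZl mD a fi) (integrableZl mD b gi).
exact: eq_integrable.
Qed.

Let Rintegral_lin (f g : T -> R) (a b : R) :
  mu.-integrable D (EFin \o f) -> mu.-integrable D (EFin \o g) ->
  \int[mu]_(x in D) (a * f x + b * g x) =
  a * \int[mu]_(x in D) f x + b * \int[mu]_(x in D) g x.
Proof.
move=> fi gi; rewrite RintegralD//.
- by rewrite !RintegralZl.
- exact: eq_integrable (integrableZl mD a fi).
- exact: eq_integrable (integrableZl mD b gi).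
Qed.

Let Re_linE (f g : T -> R[i]) a b x : complex.Re ((a +i* b) * f x + g x) =
  1 * (a * complex.Re (f x) + - b * complex.Im (f x)) + 1 * complex.Re (g x).
Proof. by rewrite !mul1r mulNr; case: (f x) (g x) => ? ? []. Qed.

Let Im_linE (f g : T -> R[i]) a b x : complex.Im ((a +i* b) * f x + g x) =
  1 * (a * complex.Im (f x) + b * complex.Re (f x)) + 1 * complex.Im (g x).
Proof. by rewrite !mul1r; case: (f x) (g x) => ? ? []. Qed.

Lemma Cintegrable_lin (f g : T -> R[i]) c :
  Cintegrable f -> Cintegrable g -> Cintegrable (fun x => c * f x + g x).
Proof.
move=> [f1 f2] [g1 g2]; case: c => a b; split.
  under eq_fun do rewrite Re_linE.
  exact: (integrable_lin 1 1 (integrable_lin a (- b) f1 f2) g1).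
under eq_fun do rewrite Im_linE.
exact: (integrable_lin 1 1 (integrable_lin a b f2 f1) g2).
Qed.

Lemma Cintegral_lin (f g : T -> R[i]) c :
  Cintegrable f -> Cintegrable g ->
  Cintegral (fun x => c * f x + g x) = c * Cintegral f + Cintegral g.
Proof.
move=> [f1 f2] [g1 g2]; case: c => a b; rewrite /Cintegral.
rewrite (funext (fun x => Re_linE f g a b x)).
rewrite (funext (fun x => Im_linE f g a b x)).
rewrite (Rintegral_lin 1 1 (integrable_lin a (- b) f1 f2) g1).
rewrite (Rintegral_lin 1 1 (integrable_lin a b f2 f1) g2).
rewrite (Rintegral_lin a (- b) f1 f2) (Rintegral_lin a b f2 f1).
by rewrite !mul1r mulNr.
Qed.

End complex_integral.

Section integral_Rn.
Context {R : realType} {n : nat}.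
Implicit Type f : 'rV[R]_n -> R[i].

Definition rV_of_tuple (u : n.-tuple (measurableTypeR R)) : 'rV[R]_n :=
  \row_i tnth u i.

Definition Rn_integrable f : Prop :=
  Cintegrable (lebesgue_tuple n) setT (f \o rV_of_tuple).

Definition Rn_integral f : R[i] :=
  Cintegral (lebesgue_tuple n) setT (f \o rV_of_tuple).

End integral_Rn.

(* e is a frame of coordinate directions of V and a word w = [:: i1; ...; ik]
   stands for the iterated partial derivative d_(e i1) ... d_(e ik). Complex
   functions are differentiated through their real and imaginary parts, since
   R[i] is not a normed module over R in the library. *)
Section partial_derivatives.
Context {R : realType} {V : normedModType R} {I : Type} (e : I -> V).

Definition pderiv (w : seq I) (f : V -> R) : V -> R :=
  foldr (fun i g => 'D_(e i) g) f w.

(* C^oo on D, which is meant to be open: the iterated partial derivatives of all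
   orders exist and are continuous at every point of D *)
Definition smooth_on (D : set V) (f : V -> R) : Prop :=
  forall w x, D x ->
    {for x, continuous (pderiv w f)} /\ forall i, derivable (pderiv w f) x (e i).

Definition Cpderiv (w : seq I) (f : V -> R[i]) (x : V) : R[i] :=
  pderiv w (fun y => complex.Re (f y)) x
    +i* pderiv w (fun y => complex.Im (f y)) x.

Definition Csmooth_on (D : set V) (f : V -> R[i]) : Prop :=
  smooth_on D (fun y => complex.Re (f y)) /\
  smooth_on D (fun y => complex.Im (f y)).

Lemma pderiv_lin (D : set V) (oD : open D) (f g : V -> R) (a b : R) w x :
  smooth_on D f -> smooth_on D g -> D x ->
  pderiv w (fun y => a * f y + b * g y) x = a * pderiv w f x + b * pderiv w g x.
Proof.
move=> sf sg; elim: w x => [//|i w IH] x Dx /=.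
have /near_eq_derive -> : \forall y \near x,
    pderiv w (fun y => a * f y + b * g y) y =
    (a \*: pderiv w f + b \*: pderiv w g) y.
  have : \forall y \near x, D y by exact: open_nbhs_nbhs.
  by apply: filterS => y Dy; rewrite IH.
have [_ /(_ i) df] := sf w x Dx; have [_ /(_ i) dg] := sg w x Dx.
have dfa := derivableZ (k := a) df; have dgb := derivableZ (k := b) dg.
by rewrite (deriveD dfa dgb) (deriveZ _ df) (deriveZ _ dg).
Qed.

Lemma smooth_on_lin (D : set V) (oD : open D) (f g : V -> R) (a b : R) :
  smooth_on D f -> smooth_on D g -> smooth_on D (fun y => a * f y + b * g y).
Proof.
move=> sf sg w x Dx.
have E : \forall y \near x,
    (a \*: pderiv w f + b \*: pderiv w g) y =
    pderiv w (fun y => a * f y + b * g y) y.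
  have : \forall y \near x, D y by exact: open_nbhs_nbhs.
  by apply: filterS => y Dy; rewrite (pderiv_lin oD).
have [cf df] := sf w x Dx; have [cg dg] := sg w x Dx; split; last first.
  move=> i; apply: (near_eq_derivable E).
  by apply: derivableD; apply: derivableZ.
rewrite /prop_for /continuous_at -(nbhs_singleton E).
apply: cvg_trans (near_eq_cvg _) _; last first.
  by apply: continuousD; apply: continuousZr.
by apply: filterS E => y ->.
Qed.

Lemma Re_lin (f g : V -> R[i]) (a b : R) :
  (fun y => complex.Re (((a +i* b) *: f + g) y)) =
  (fun y => 1 * (a * complex.Re (f y) + - b * complex.Im (f y)) +
            1 * complex.Re (g y)).
Proof.
apply/funext => y; rewrite !mul1r mulNr.
have -> : ((a +i* b) *: f + g) y = (a +i* b) * f y + g y by [].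
by case: (f y) (g y) => ? ? [].
Qed.

Lemma Im_lin (f g : V -> R[i]) (a b : R) :
  (fun y => complex.Im (((a +i* b) *: f + g) y)) =
  (fun y => 1 * (a * complex.Im (f y) + b * complex.Re (f y)) +
            1 * complex.Im (g y)).
Proof.
apply/funext => y; rewrite !mul1r.
have -> : ((a +i* b) *: f + g) y = (a +i* b) * f y + g y by [].
by case: (f y) (g y) => ? ? [].
Qed.

Lemma Csmooth_on_lin (D : set V) (oD : open D) (f g : V -> R[i]) (c : R[i]) :
  Csmooth_on D f -> Csmooth_on D g -> Csmooth_on D (c *: f + g).
Proof.
move=> [f1 f2] [g1 g2]; case: c => a b; split.
  rewrite Re_lin.
  exact: (smooth_on_lin oD 1 1 (smooth_on_lin oD a (- b) f1 f2) g1).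
rewrite Im_lin.
exact: (smooth_on_lin oD 1 1 (smooth_on_lin oD a b f2 f1) g2).
Qed.

Lemma Cpderiv_lin (D : set V) (oD : open D) (f g : V -> R[i]) (c : R[i]) w x :
  Csmooth_on D f -> Csmooth_on D g -> D x ->
  Cpderiv w (c *: f + g) x = c * Cpderiv w f x + Cpderiv w g x.
Proof.
move=> [f1 f2] [g1 g2] Dx; case: c => a b.
rewrite /Cpderiv Re_lin Im_lin.
have sl := smooth_on_lin oD.
rewrite (pderiv_lin oD 1 1 w (sl _ _ a (- b) f1 f2) g1 Dx).
rewrite (pderiv_lin oD 1 1 w (sl _ _ a b f2 f1) g2 Dx).
rewrite (pderiv_lin oD a (- b) w f1 f2 Dx) (pderiv_lin oD a b w f2 f1 Dx).
by rewrite !mul1r mulNr.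
Qed.

Lemma smooth_on_cst (D : set V) (c : R) : smooth_on D (fun=> c).
Proof.
have P w : exists c', pderiv w (fun=> c : R) = (fun=> c').
  elim: w => [|i w [c' IH]]; first by exists c.
  by exists 0; rewrite /= IH; apply/funext => x; rewrite derive_cst.
move=> w x Dx; have [c' ->] := P w; split; first exact: cst_continuous.
by move=> i; exact: derivable_cst.
Qed.

Lemma Csmooth_on0 (D : set V) : Csmooth_on D (0 : V -> R[i]).
Proof. by split; exact: smooth_on_cst. Qed.

Lemma Cpderiv0 w x : Cpderiv w (0 : V -> R[i]) x = 0.
Proof.
have P : pderiv w (fun=> 0 : R) = (fun=> 0).
  by elim: w => [//|i w IH]; rewrite /= IH; apply/funext => y; rewrite derive_cst.
by rewrite /Cpderiv P.
Qed.

End partial_derivatives.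

Section locally_convex.
Context {R : realType} {E : lmodType R[i]}.
Implicit Types (V U : set E).

Definition absconvex V := forall x y (a b : R[i]),
  V x -> V y -> `|a| + `|b| <= 1 -> V (a *: x + b *: y).

(* For h |-> p h the extended norms of an inductive spectrum of spaces
   X_h = {x | p h x < +oo}: the neighbourhoods of 0 of the locally convex
   inductive limit of the X_h, i.e. of the finest locally convex topology that
   makes every inclusion of X_h continuous. They are given here by their supersets
   in the ambient space E; only their traces on the union of the X_h matter. *)
Definition ind_nbhs0 (p : R -> E -> \bar R) : set_system E :=
  [set U | exists V, [/\ V `<=` U, absconvex V &
    forall h, 0 < h -> exists2 r, 0 < r & [set x | (p h x <= r%:E)%E] `<=` V]].

(* neighbourhoods of 0 of the projective limit (initial topology) of countably
   many topologies, the k-th one having B k as neighbourhoods of 0 *)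
Definition proj_nbhs0 (B : nat -> set_system E) : set_system E :=
  [set U | exists N (V : nat -> set E),
    (forall k, B k (V k)) /\ \bigcap_(k in `I_N) V k `<=` U].

Lemma absconvexI V U : absconvex V -> absconvex U -> absconvex (V `&` U).
Proof. by move=> cV cU x y a b [? ?] [? ?] ?; split; [exact: cV|exact: cU]. Qed.

Lemma ind_nbhs0T p : ind_nbhs0 p setT.
Proof. by exists setT; split=> // h h0; exists 1. Qed.

Lemma ind_nbhs0I p : setI_closed (ind_nbhs0 p).
Proof.
move=> U1 U2 [V1 [VU1 cV1 V1r]] [V2 [VU2 cV2 V2r]].
exists (V1 `&` V2); split; [exact: setISS|exact: absconvexI|].
move=> h h0; have [r1 r10 sV1] := V1r h h0; have [r2 r20 sV2] := V2r h h0.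
exists (Num.min r1 r2); first by rewrite lt_min r10 r20.
move=> x /= px; split; [apply: sV1|apply: sV2] => /=;
  by apply: (le_trans px); rewrite lee_fin ge_min lexx ?orbT.
Qed.

Lemma proj_nbhs0T B : (forall k, B k setT) -> proj_nbhs0 B setT.
Proof. by move=> BT; exists 0%N, (fun=> setT). Qed.

Lemma proj_nbhs0I B : (forall k, setI_closed (B k)) ->
  setI_closed (proj_nbhs0 B).
Proof.
move=> BI U1 U2 [N1 [V1 [BV1 sV1]]] [N2 [V2 [BV2 sV2]]].
exists (maxn N1 N2), (fun k => V1 k `&` V2 k); split=> [k|x Vx]; first exact: BI.
split.
  by apply: sV1 => k /= kN; have [|] := Vx k _; rewrite /= ?leq_max ?kN.
by apply: sV2 => k /= kN; have [|] := Vx k _; rewrite /= ?leq_max ?kN ?orbT.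
Qed.

End locally_convex.

Section translation_topology.
Context {R : realType} {E F : lmodType R[i]} (v : F -> E).

(* open sets of the translation invariant topology on F whose neighbourhoods of 0
   are the preimages under the inclusion v of the sets of B *)
Definition translation_open (B : set_system E) : set_system F :=
  [set O | forall x, O x ->
    exists2 U, B U & forall y, U (v y) -> O (x + y)].

Variable B : set_system E.

Lemma translation_openT : B setT -> translation_open B setT.
Proof. by move=> BT x _; exists setT. Qed.

Lemma translation_openI : setI_closed B -> setI_closed (translation_open B).
Proof.
move=> BI O1 O2 o1 o2 x [/o1[U1 BU1 s1] /o2[U2 BU2 s2]].
by exists (U1 `&` U2); [exact: BI|move=> y [? ?]; split; [exact: s1|exact: s2]].
Qed.

Lemma translation_open_bigU (I : Type) (f : I -> set F) :
  (forall i, translation_open B (f i)) -> translation_open B (\bigcup_i f i).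
Proof.
move=> of_ x [i _ /of_[U BU s]]; exists U => // y /s; by exists i.
Qed.

End translation_topology.

Section multi_index.
Context {R : realType} {n : nat}.
Implicit Type b : {ffun 'I_n -> nat}.

(* |b|, b!, x^b, and the word of d^b *)
Definition mabs b : nat := \sum_i b i.
Definition mfact b : nat := \prod_i (b i)`!.
Definition mpow (x : 'rV[R]_n) b : R := \prod_i x 0 i ^+ b i.
Definition mword b : seq 'I_n := flatten [seq nseq (b i) i | i <- enum 'I_n].

End multi_index.

Section Schwartz.
Context (R : realType) (n : nat).

Definition coord_dir (i : 'I_n) : 'rV[R]_n := delta_mx 0 i.

Definition schwartz_set : set ('rV[R]_n -> R[i]) :=
  [set f | Csmooth_on coord_dir setT f /\
    forall a b : {ffun 'I_n -> nat}, exists C : R, forall x,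
      normc ((mpow x a)%:C * Cpderiv coord_dir (mword b) f x) <= C].

Definition schwartz : Type := set_type schwartz_set.

HB.instance Definition _ := SubChoice.on schwartz.

Lemma schwartz_closed : GRing.subsemimod_closed (mem schwartz_set).
Proof.
apply: GRing.submod_closed_semi; split=> [|c f g]; rewrite !inE.
  split; first exact: Csmooth_on0.
  by move=> a b; exists 0 => x; rewrite Cpderiv0 mulr0 normc0.
move=> [sf bf] [sg bg]; split; first exact: (Csmooth_on_lin openT c sf sg).
move=> a b; have [C Cf] := bf a b; have [C' Cg] := bg a b.
exists (normc c * C + C') => x.
rewrite (Cpderiv_lin openT c (mword b) sf sg I) mulrDr mulrCA.
rewrite (le_trans (le_normcD _ _))// lerD// normcM ler_wpM2l//.
by case: (c) => ? ?; exact: sqrtr_ge0.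
Qed.

HB.instance Definition _ := GRing.SubChoice_isSubLmodule.Build R[i]
  ('rV[R]_n -> R[i]) (mem schwartz_set) schwartz schwartz_closed.

End Schwartz.

Section real_sup.
Context {R : realType}.

Lemma ereal_sup_EFin_ltyP (S : set R) :
  (ereal_sup (EFin @` S) < +oo)%E <-> exists C, forall r, S r -> r <= C.
Proof.
split=> [Soo|[C SC]]; last first.
  apply: (@le_lt_trans _ _ C%:E); last exact: ltry.
  by apply: ge_ereal_sup => _ [r Sr <-]; rewrite lee_fin SC.
case E : (ereal_sup (EFin @` S)) Soo => [C| |]// _.
  exists C => r Sr; rewrite -lee_fin -E.
  by apply: ereal_sup_ubound; exists r.
exists 0 => r Sr; have : (r%:E <= -oo)%E.
  by rewrite -E; apply: ereal_sup_ubound; exists r.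
by rewrite leeNy_eq.
Qed.

End real_sup.

Section Gelfand_Shilov.
Context (R : realType) (n : nat) (rho1 rho2 : R).
Local Notation midx := {ffun 'I_n -> nat}.

(* In GS_weight and GS_seminorm, a is the exponent of x and b the order of the
   derivative; rho2 goes with the former, rho1 with the latter. *)
Definition GS_weight (h : R) (a b : midx) : R :=
  h ^+ (mabs a + mabs b) / ((mfact a)%:R `^ rho2 * (mfact b)%:R `^ rho1).

Definition GS_seminorm (h : R) (f : schwartz R n) : \bar R :=
  ereal_sup (EFin @` [set r | exists (x : 'rV[R]_n) (a b : midx),
    r = GS_weight h a b *
        normc ((mpow x a)%:C * Cpderiv (@coord_dir R n) (mword b) (val f) x)]).

(* The space S^rho1_rho2 *)
Definition GS_set : set (schwartz R n) :=
  [set f | exists2 h, 0 < h & (GS_seminorm h f < +oo)%E].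

Definition GS : Type := set_type GS_set.

HB.instance Definition _ := SubChoice.on GS.

Lemma GS_weight_ge0 h a b : 0 <= h -> 0 <= GS_weight h a b.
Proof.
by move=> h0; rewrite divr_ge0 ?exprn_ge0// mulr_ge0 ?powR_ge0.
Qed.

Lemma le_GS_weight h h' a b : 0 <= h -> h <= h' ->
  GS_weight h a b <= GS_weight h' a b.
Proof.
move=> h0 hh'; rewrite ler_wpM2r ?invr_ge0 ?mulr_ge0 ?powR_ge0//.
by rewrite lerXn2r ?nnegrE// (le_trans h0).
Qed.

Lemma GS_closed : GRing.subsemimod_closed (mem GS_set).
Proof.
apply: GRing.submod_closed_semi; split=> [|c f g]; rewrite !inE.
  exists 1 => //; apply/ereal_sup_EFin_ltyP; exists 0 => _ [x [a [b ->]]].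
  by rewrite Cpderiv0 mulr0 normc0 mulr0.
move=> [h h0 /ereal_sup_EFin_ltyP[C Cf]] [k k0 /ereal_sup_EFin_ltyP[C' Cg]].
exists (Num.min h k); first by rewrite lt_min h0.
have m0 : 0 <= Num.min h k by rewrite le_min !ltW.
apply/ereal_sup_EFin_ltyP; exists (normc c * C + C') => _ [x [a [b ->]]].
have [sf _] := set_valP f; have [sg _] := set_valP g.
have -> : val (c *: f + g) = c *: val f + val g :> ('rV[R]_n -> R[i]) by [].
rewrite (Cpderiv_lin openT c (mword b) sf sg I) mulrDr mulrCA.
apply: (@le_trans _ _ (GS_weight (Num.min h k) a b *
   (normc c * normc ((mpow x a)%:C * Cpderiv (@coord_dir R n) (mword b) (val f) x)
   + normc ((mpow x a)%:C * Cpderiv (@coord_dir R n) (mword b) (val g) x)))).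
  by rewrite ler_wpM2l ?GS_weight_ge0// -normcM le_normcD.
have n0 (z : R[i]) : 0 <= normc z by case: z => ? ?; exact: sqrtr_ge0.
rewrite mulrDr mulrCA lerD//.
  rewrite ler_wpM2l//; apply: le_trans (Cf _ _); last by exists x, a, b.
  by rewrite ler_wpM2r// le_GS_weight// ge_min lexx.
apply: le_trans (Cg _ _); last by exists x, a, b.
by rewrite ler_wpM2r// le_GS_weight// ge_min lexx orbT.
Qed.

HB.instance Definition _ := GRing.SubChoice_isSubLmodule.Build R[i]
  (schwartz R n) (mem GS_set) GS GS_closed.

Definition GS_open : set_system GS :=
  translation_open (val : GS -> schwartz R n) (ind_nbhs0 GS_seminorm).

HB.instance Definition _ := @isOpenTopological.Build GS GS_open
  (translation_openT _ (ind_nbhs0T _))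
  (translation_openI (@ind_nbhs0I _ _ _))
  (@translation_open_bigU _ _ _ _ _).

(* Integrability is automatic on S^rho1_rho2; it is recorded because the integral
   is a total function. *)
Definition zero_moments (f : 'rV[R]_n -> R[i]) : Prop :=
  forall a : midx, Rn_integrable (fun x => (mpow x a)%:C * f x) /\
    Rn_integral (fun x => (mpow x a)%:C * f x) = 0.

Lemma zero_moments0 : zero_moments 0.
Proof.
move=> a.
have -> : (fun x => (mpow x a)%:C * (0 : 'rV[R]_n -> R[i]) x) = (fun=> 0).
  by apply/funext => x; rewrite mulr0.
by split; [exact: Cintegrable0|exact: Cintegral0].
Qed.

Lemma zero_moments_lin c f g :
  zero_moments f -> zero_moments g -> zero_moments (c *: f + g).
Proof.
move=> mf mg a; have [fi f0] := mf a; have [gi g0] := mg a.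
have -> : (fun x => (mpow x a)%:C * (c *: f + g) x) =
    (fun x => c * ((mpow x a)%:C * f x) + (mpow x a)%:C * g x).
  apply/funext => x; have -> : (c *: f + g) x = c * f x + g x by [].
  by rewrite mulrDr mulrCA.
split; first exact: (Cintegrable_lin measurableT c fi gi).
apply: (etrans (Cintegral_lin measurableT c fi gi)).
by apply: (etrans (f_equal2 (fun u v => c * u + v) f0 g0)); rewrite mulr0 addr0.
Qed.

(* The subspace (S^rho1_rho2)_0; its topology below is the relative one. *)
Definition GS0_set : set GS := [set f | zero_moments (val (val f))].

Definition GS0 : Type := set_type GS0_set.

HB.instance Definition _ := SubChoice.on GS0.

Lemma GS0_closed : GRing.subsemimod_closed (mem GS0_set).
Proof.
apply: GRing.submod_closed_semi; split=> [|c f g]; rewrite !inE.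
  exact: zero_moments0.
move=> mf mg; have := zero_moments_lin c mf mg.
have E1 : val (c *: f + g) = c *: val f + val g :> schwartz R n by [].
have E2 : val (c *: val f + val g) =
  c *: val (val f) + val (val g) :> ('rV[R]_n -> R[i]) by [].
suff : zero_moments (c *: val (val f) + val (val g)) ->
       zero_moments (val (val (c *: f + g))) by exact.
by rewrite E1 E2.
Qed.

HB.instance Definition _ := GRing.SubChoice_isSubLmodule.Build R[i]
  GS (mem GS0_set) GS0 GS0_closed.

HB.instance Definition _ := Topological.copy GS0 (set_type GS0_set).

Definition GS0_fun (f : GS0) : 'rV[R]_n -> R[i] := val (val (val f)).

End Gelfand_Shilov.

(* The points (b, a) of the half-space are the z : 'rV[R]_n * R with 0 < z.2. *)
Section half_space.
Context (R : realType) (n : nat).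
Local Notation midx := {ffun 'I_n -> nat}.

Definition half_space : set ('rV[R]_n * R) := [set z | 0 < z.2].

(* Some i is the direction of the coordinate b_i, None that of a *)
Definition half_dir (o : option 'I_n) : 'rV[R]_n * R :=
  if o is Some i then (delta_mx 0 i, 0) else (0, 1).

(* the word of d_a^k d_b^b *)
Definition half_word (k : nat) (b : midx) : seq (option 'I_n) :=
  nseq k None ++ map Some (mword b).

(* A smooth function on the half-space is represented by its extension by 0 to
   R^n x R; nothing is required of that extension off the half-space. *)
Definition half_smooth_set : set ('rV[R]_n * R -> R[i]) :=
  [set f | Csmooth_on half_dir half_space f /\
    forall z, z \notin half_space -> f z = 0].

Definition half_smooth : Type := set_type half_smooth_set.

HB.instance Definition _ := SubChoice.on half_smooth.

Lemma open_half_space : open half_space.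
Proof.
have -> : half_space = snd @^-1` [set x : R | 0 < x] by [].
by apply: open_comp; [move=> z _; exact: cvg_snd|exact: open_gt].
Qed.

Lemma half_smooth_closed : GRing.subsemimod_closed (mem half_smooth_set).
Proof.
apply: GRing.submod_closed_semi; split=> [|c f g]; rewrite !inE.
  by split=> //; exact: Csmooth_on0.
move=> [sf f0] [sg g0]; split.
  exact: (Csmooth_on_lin open_half_space c sf sg).
move=> z zH; have -> : (c *: f + g) z = c * f z + g z by [].
by rewrite f0// g0// mulr0 addr0.
Qed.

HB.instance Definition _ := GRing.SubChoice_isSubLmodule.Build R[i]
  ('rV[R]_n * R -> R[i]) (mem half_smooth_set) half_smooth half_smooth_closed.

Definition japanese (b : 'rV[R]_n) : R := Num.sqrt (1 + \sum_i b 0 i ^+ 2).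

Context (s t tau1 tau2 : R).

Definition HS_weight (h : R) (z : 'rV[R]_n * R) (b : midx) (k l1 l2 : nat)
    : R :=
  h ^+ (mabs b + k + l1 + l2) /
    ((mfact b)%:R `^ s * k`!%:R `^ t * l1`!%:R `^ tau1 * l2`!%:R `^ tau2) *
  (z.2 ^+ l1 + 1 / z.2 ^+ l2) * japanese z.1 ^+ k.

Definition HS_seminorm (a : nat) (h : R) (f : half_smooth) : \bar R :=
  ereal_sup (EFin @` [set r |
    exists (z : 'rV[R]_n * R) (b : midx) (k l1 l2 : nat), half_space z /\
    r = HS_weight h z b k l1 l2 *
        normc (Cpderiv half_dir (half_word a b) (val f) z)]).

(* The space S^s_(t,tau1,tau2)(H^(n+1)) *)
Definition HS_set : set half_smooth :=
  [set f | forall a, exists2 h, 0 < h & (HS_seminorm a h f < +oo)%E].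

Definition HS : Type := set_type HS_set.

HB.instance Definition _ := SubChoice.on HS.

Lemma HS_weight_ge0 h z b k l1 l2 : 0 <= h -> half_space z ->
  0 <= HS_weight h z b k l1 l2.
Proof.
move=> h0 z0; have z20 m : 0 <= z.2 ^+ m by rewrite exprn_ge0// ltW.
apply: mulr_ge0; last by rewrite exprn_ge0// sqrtr_ge0.
apply: mulr_ge0; last by rewrite addr_ge0// divr_ge0.
by rewrite divr_ge0 ?exprn_ge0// !mulr_ge0// powR_ge0.
Qed.

Lemma le_HS_weight h h' z b k l1 l2 : 0 <= h -> h <= h' -> half_space z ->
  HS_weight h z b k l1 l2 <= HS_weight h' z b k l1 l2.
Proof.
move=> h0 hh' z0; have z20 m : 0 <= z.2 ^+ m by rewrite exprn_ge0// ltW.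
apply: ler_wpM2r; first by rewrite exprn_ge0// sqrtr_ge0.
apply: ler_wpM2r; first by rewrite addr_ge0// divr_ge0.
apply: ler_wpM2r; first by rewrite invr_ge0 !mulr_ge0// powR_ge0.
by rewrite lerXn2r ?nnegrE// (le_trans h0).
Qed.

Lemma HS_closed : GRing.subsemimod_closed (mem HS_set).
Proof.
apply: GRing.submod_closed_semi; split=> [|c f g]; rewrite !inE.
  move=> a; exists 1 => //; apply/ereal_sup_EFin_ltyP; exists 0.
  move=> _ [z [b [k [l1 [l2 [_ ->]]]]]].
  by rewrite Cpderiv0 normc0 mulr0.
move=> Hf Hg a; have [h h0 /ereal_sup_EFin_ltyP[C Cf]] := Hf a.
have [h' h'0 /ereal_sup_EFin_ltyP[C' Cg]] := Hg a.
exists (Num.min h h'); first by rewrite lt_min h0.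
have m0 : 0 <= Num.min h h' by rewrite le_min !ltW.
apply/ereal_sup_EFin_ltyP; exists (normc c * C + C').
move=> _ [z [b [k [l1 [l2 [zH ->]]]]]].
have [sf _] := set_valP f; have [sg _] := set_valP g.
have -> : val (c *: f + g) = c *: val f + val g :> ('rV[R]_n * R -> R[i]) by [].
rewrite (Cpderiv_lin open_half_space c (half_word a b) sf sg zH).
have n0 (y : R[i]) : 0 <= normc y by case: y => ? ?; exact: sqrtr_ge0.
set df := Cpderiv _ _ (val f) z; set dg := Cpderiv _ _ (val g) z.
apply: (@le_trans _ _ (HS_weight (Num.min h h') z b k l1 l2 *
   (normc c * normc df + normc dg))).
  by rewrite ler_wpM2l ?HS_weight_ge0// -normcM le_normcD.
rewrite mulrDr mulrCA lerD//.
  rewrite ler_wpM2l//; apply: le_trans (Cf _ _); last by exists z, b, k, l1, l2.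
  by rewrite ler_wpM2r// le_HS_weight// ge_min lexx.
apply: le_trans (Cg _ _); last by exists z, b, k, l1, l2.
by rewrite ler_wpM2r// le_HS_weight// ge_min lexx orbT.
Qed.

HB.instance Definition _ := GRing.SubChoice_isSubLmodule.Build R[i]
  half_smooth (mem HS_set) HS HS_closed.

Definition HS_open : set_system HS :=
  translation_open (val : HS -> half_smooth)
    (proj_nbhs0 (fun a => ind_nbhs0 (HS_seminorm a))).

HB.instance Definition _ := @isOpenTopological.Build HS HS_open
  (translation_openT _ (proj_nbhs0T (fun a => ind_nbhs0T _)))
  (translation_openI (proj_nbhs0I (fun a => @ind_nbhs0I _ _ _)))
  (@translation_open_bigU _ _ _ _ _).

Definition HS_fun (f : HS) : 'rV[R]_n * R -> R[i] := val (val f).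

End half_space.

Section wavelet_synthesis.
Context {R : realType} {n : nat}.
Variables (phi : 'rV[R]_n -> R[i]) (Phi : 'rV[R]_n * R -> R[i]) (x : 'rV[R]_n).

Definition synthesis_kernel (a : R) (b : 'rV[R]_n) : R[i] :=
  Phi (b, a) * (1 / a ^+ n)%:C * phi (a^-1 *: (x - b)).

Definition synthesis_scale (a : R) : R[i] :=
  Rn_integral (synthesis_kernel a) * (a^-1)%:C.

(* absolute convergence of the inner and of the outer integral *)
Definition synthesis_converges : Prop :=
  (forall a, 0 < a -> Rn_integrable (synthesis_kernel a)) /\
  Cintegrable (@lebesgue_measure R) `]0, +oo[ synthesis_scale.

Definition synthesis : R[i] :=
  Cintegral (@lebesgue_measure R) `]0, +oo[ synthesis_scale.

End wavelet_synthesis.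

(* The synthesis transform is a well-defined continuous bilinear map
   (S^rho1_rho2)_0 x S^s_(t,tau1,tau2)(H^(n+1)) -> (S^s'_t')_0. *)
Definition synthesis_continuous_bilinear (R : realType) (n : nat)
    (rho1 rho2 s t tau1 tau2 s' t' : R) : Prop :=
  exists M : {bilinear GS0 n rho1 rho2 -> HS n s t tau1 tau2 -> GS0 n s' t'},
    (forall (phi : GS0 n rho1 rho2) (Phi : HS n s t tau1 tau2) (x : 'rV[R]_n),
      synthesis_converges (GS0_fun phi) (HS_fun Phi) x /\
      GS0_fun (M phi Phi) x = synthesis (GS0_fun phi) (HS_fun Phi) x) /\
    continuous (fun z : GS0 n rho1 rho2 * HS n s t tau1 tau2 => M z.1 z.2).

(* Main.v *)
Require Import Defs.
From HB Require Import structures.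
From mathcomp Require Import all_boot all_order all_algebra.
From mathcomp Require Import all_classical all_reals all_analysis.
From mathcomp.real_closed Require Import complex.
From mathcomp Require Import measurable_realfun.
From mathcomp Require Import ring lra zify.
Set Implicit Arguments.
Unset Strict Implicit.
Unset Printing Implicit Defensive.
Import Order.TTheory GRing.Theory Num.Theory.
Import numFieldNormedType.Exports.
Import Normc.
Local Open Scope classical_set_scope.
Local Open Scope ring_scope.

(** Write F for the synthesis of Phi with the wavelet phi, the integral of
    Phi(b, a) a^-n phi((x - b) / a) against db da / a.

    The whole proof is one pointwise estimate. With y = (x - b) / a one has
    x = b + a y, so coordinate by coordinate a monomial x^al is at most
    2^|al| |b^del| a^|gam| |y^gam|, where gam collects the coordinates in which
    a |y_i| dominates |b_i| and del the others. The decay of Phi in b pays for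
    b^del with del!^t, the decay of phi pays for y^gam with gam!^rho2, the decay
    of Phi for large a pays for a^|gam| with gam!^(t - rho2), and since
    del! gam! = al! the product is al!^t. A negative power a^-p is paid for by
    the decay of Phi as a tends to 0. A fixed number of spare powers of b, y and
    a leaves an integrable factor. This is [pointwise_estimate].

    The two parts of the theorem differ in where an x-derivative falls. In the
    variables (b, a) it falls on phi: it costs b!^rho1 and a factor a^-|b|, which
    the exponent s - rho1 of Phi for small a turns into b!^(s - rho1), so that F
    has Gevrey order s ([wavelet_kernel_bound]). After the substitution
    b = x - a y it falls on Phi and costs b!^s at once ([data_kernel_bound]).

    Differentiation under the integral sign ([Csmooth_on_Cintegral],
    [Cpderiv_Cintegral]) carries these bounds to F. It needs dominated partial
    derivatives along arbitrary words of directions, while the seminorms control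
    sorted words; Clairaut's theorem ([perm_pderiv]) makes up the difference.
    The moments of F vanish by Fubini's theorem: the substitution x = b + a y
    turns the inner x-integral into the integral of a polynomial against phi
    ([synthesis_zero_moments]).

    For continuity, the relative topology of (S^rho1_rho2)_0 consists of traces of
    neighbourhoods in S^rho1_rho2, and the estimate indeed holds for all phi in
    S^rho1_rho2 and all Phi with a finite seminorm of index 0 in the derivatives
    in a. It bounds the transform on the product of any two steps of the inductive
    spectra; as these spectra are countable, the radii of neighbourhoods V and W
    that the transform sends into a given U can be chosen one step at a time
    ([bilinear_inductive_nbhs0]). Joint continuity at 0 and bilinearity give
    continuity everywhere ([synthesis_continuous]). *)

(** * Directional derivatives and Clairaut's theorem *)

Section directional.
Context {R : realType} {V : normedModType R}.
Implicit Types (f : V -> R) (x u v : V).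

(** A derivative along v only sees the line through the point, so the calculus of
    functions of one real variable applies to it. The statement is at an
    arbitrary parameter h0, as the mean value theorem needs all of them. *)
Lemma is_derive_line f x v (h0 d : R) :
  is_derive (h0 *: v + x) v f d <->
  is_derive h0 1 (fun h : R => f (h *: v + x)) d.
Proof.
have E : (fun h : R => h^-1 *: ((f \o shift (h0 *: v + x)) (h *: v) -
                                f (h0 *: v + x))) =
         (fun h : R => h^-1 *: (((fun h : R => f (h *: v + x)) \o shift h0) (h *: 1)
                                - (fun h : R => f (h *: v + x)) h0)).
  apply/funext => h /=.
  rewrite /shift/= (_ : h *: 1 = h); last exact: mulr1.
  by rewrite scalerDl addrA.
split=> -[e1 e2]; apply: DeriveDef.
- by move: e1; rewrite /derivable E.
- by rewrite -e2 /derive E.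
- by move: e1; rewrite /derivable E.
- by rewrite -e2 /derive E.
Qed.

Lemma is_derive_affine f x v (r : R) (c : V) (d : R) :
  is_derive (r *: (x - c)) v f d ->
  is_derive x v (fun z => f (r *: (z - c))) (r * d).
Proof.
move=> fd.
have -> : x = 0 *: v + x by rewrite scale0r add0r.
apply/is_derive_line.
have -> : (fun h : R => f (r *: (h *: v + x - c))) =
    (fun h : R => f (h *: v + r *: (x - c))) \o (fun h => r * h).
  by apply/funext => h /=; rewrite -addrA scalerDr scalerA.
have -> : r * d = d * r by rewrite mulrC.
apply: is_derive1_comp.
  rewrite mulr0; apply/is_derive_line.
  by rewrite scale0r add0r.
have H : is_derive (0 : R) 1 (r *: (@id R)) (r *: (1 : R)) by apply: is_deriveZ.
by rewrite -[X in is_derive _ _ _ X]mulr1; exact: H.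
Qed.

Lemma MVT_line f x v (t : R) : 0 < t ->
  (forall h, 0 <= h <= t -> derivable f (h *: v + x) v) ->
  exists2 h, 0 < h < t & f (t *: v + x) - f x = t * 'D_v f (h *: v + x).
Proof.
move=> t0 df.
pose g (h : R) := f (h *: v + x).
have dg h : 0 <= h <= t -> is_derive h 1 g ('D_v f (h *: v + x)).
  by move=> ht; apply/is_derive_line/derivableP/df.
have [h||h ht E] := @MVT R g (fun h => 'D_v f (h *: v + x)) 0 t t0.
- by rewrite in_itv/= => /andP[h0 ht]; apply: dg; rewrite !ltW.
- apply: derivable_within_continuous => h; rewrite in_itv/= => ht.
  by have [] := dg h ht.
exists h; first by move: ht; rewrite in_itv.
by move: E; rewrite /g scale0r add0r subr0 mulrC.
Qed.

(** The mean value theorem in u and then in v. Exchanging u and v leaves the left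
    hand side unchanged, which is the source of Clairaut's theorem. *)
Lemma MVT_square f x u v (t : R) : 0 < t ->
  (forall h k, 0 <= h <= t -> 0 <= k <= t ->
    derivable f (h *: u + (k *: v + x)) u /\
    derivable ('D_u f) (h *: u + (k *: v + x)) v) ->
  exists h k, [/\ 0 < h < t, 0 < k < t &
    f (t *: u + (t *: v + x)) - f (t *: u + x) - f (t *: v + x) + f x =
    t ^+ 2 * 'D_v ('D_u f) (h *: u + (k *: v + x))].
Proof.
move=> t0 H.
have t0t : 0 <= t <= t by rewrite ltW//=.
have z0t : 0 <= (0 : R) <= t by rewrite lexx ltW.
pose F z := f (z + t *: v) - f z.
have dshift z : derivable f (z + t *: v) u -> derivable f z u ->
    is_derive z u F ('D_u f (z + t *: v) - 'D_u f z).
  move=> d1 d2; apply: is_deriveB; last exact: derivableP.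
  have e1 : 1 *: (z - - (t *: v)) = z + t *: v by rewrite scale1r opprK.
  have := @is_derive_affine f z u 1 (- (t *: v)) ('D_u f (z + t *: v)).
  rewrite e1 mul1r => /(_ (derivableP d1)).
  by under eq_fun do rewrite scale1r opprK.
have swp h k : h *: u + x + k *: v = h *: u + (k *: v + x).
  by rewrite -addrA (addrC x).
have [h ht|h ht E1] := @MVT_line F x u t t0.
  have [||] := dshift (h *: u + x) => //.
    by rewrite swp; exact: (H h t ht t0t).1.
  have [+ _] := H h 0 ht z0t.
  by rewrite scale0r add0r.
have ht' : 0 <= h <= t by case/andP: ht => ? ?; rewrite !ltW.
have [k kt|k kt E2] := @MVT_line ('D_u f) (h *: u + x) v t t0.
  have [_] := H h k ht' kt.
  by rewrite addrCA.
exists h, k; split; [exact: ht|exact: kt|].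
have [_ E3] : is_derive (h *: u + x) u F
    ('D_u f (h *: u + x + t *: v) - 'D_u f (h *: u + x)).
  apply: dshift.
    by rewrite swp; exact: (H h t ht' t0t).1.
  have [+ _] := H h 0 ht' z0t.
  by rewrite scale0r add0r.
move: E1; rewrite E3 swp [in h *: u + (t *: v + x)]addrCA E2 /F swp.
rewrite (addrCA (h *: u) (k *: v)).
rewrite (addrC x (t *: v)) => E1.
rewrite expr2 -mulrA -E1; ring.
Qed.

(** Clairaut's theorem. The second difference of f over a small square equals
    t^2 times either mixed derivative at some point of the square, and both mixed
    derivatives are continuous at the corner. *)
Lemma derive_comm (D : set V) f x u v : open D -> D x ->
  (forall z, D z -> [/\ derivable f z u, derivable f z v,
     derivable ('D_u f) z v & derivable ('D_v f) z u]) ->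
  {for x, continuous ('D_v ('D_u f))} -> {for x, continuous ('D_u ('D_v f))} ->
  'D_v ('D_u f) x = 'D_u ('D_v f) x.
Proof.
move=> oD Dx dD c1 c2; apply/eqP; rewrite -subr_eq0 -normr_le0.
apply/ler_addgt0Pl => e e0; rewrite addr0.
have e20 : 0 < e / 2 by rewrite divr_gt0.
have N1 : \forall z \near x, `|'D_v ('D_u f) x - 'D_v ('D_u f) z| < e / 2.
  by move/cvgrPdist_lt: c1 => /(_ _ e20).
have N2 : \forall z \near x, `|'D_u ('D_v f) x - 'D_u ('D_v f) z| < e / 2.
  by move/cvgrPdist_lt: c2 => /(_ _ e20).
have N0 : \forall z \near x, D z by exact: open_nbhs_nbhs.
have /nbhs_ballP[d /= d0 Bd] : \forall z \near x, D z /\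
    (`|'D_v ('D_u f) x - 'D_v ('D_u f) z| < e / 2 /\
     `|'D_u ('D_v f) x - 'D_u ('D_v f) z| < e / 2).
  by apply: filterS3 N0 N1 N2 => z ? ?.
pose t := d / (2 * (1 + `|u| + `|v|)).
have nu := normr_ge0 u; have nv := normr_ge0 v.
have den0 : 0 < 1 + `|u| + `|v| by lra.
have t0 : 0 < t by rewrite divr_gt0// mulr_gt0.
have tE : t * (1 + `|u| + `|v|) = d / 2.
  by rewrite /t; field; rewrite lt0r_neq0.
have inB h k : 0 <= h <= t -> 0 <= k <= t ->
    ball x d (h *: u + (k *: v + x)).
  move=> /andP[h0 ht] /andP[k0 kt]; rewrite -ball_normE /= distrC.
  rewrite addrA addrK (le_lt_trans (ler_normD _ _))// !normrZ !ger0_norm//.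
  have hu : h * `|u| <= t * `|u| by rewrite ler_wpM2r.
  have kv : k * `|v| <= t * `|v| by rewrite ler_wpM2r.
  have : t * `|u| + t * `|v| <= d / 2 by rewrite -tE !mulrDr mulr1; lra.
  by lra.
have [|h [k [ht kt E1]]] := @MVT_square f x u v t t0.
  move=> h k ht kt; have /Bd[/dD[d1 _ d2 _] _] := inB h k ht kt.
  by split; [exact: d1|exact: d2].
have [|k' [h' [kt' ht' E2]]] := @MVT_square f x v u t t0.
  move=> h' k' ht' kt'; have /Bd[/dD[_ d1 _ d2] _] := inB k' h' kt' ht'.
  by rewrite (addrCA (h' *: v)); split; [exact: d1|exact: d2].
have E : 'D_v ('D_u f) (h *: u + (k *: v + x)) =
         'D_u ('D_v f) (h' *: u + (k' *: v + x)).
  apply: (@mulfI _ (t ^+ 2)); first by rewrite expf_neq0// lt0r_neq0.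
  apply: etrans (esym E1) _; rewrite [in RHS](addrCA (h' *: u)).
  apply: etrans _ E2; rewrite [in RHS](addrCA (t *: v)).
  by apply: (congr1 (+%R^~ (f x))); exact: addrAC.
have ltW2 s : 0 < s < t -> 0 <= s <= t by move=> /andP[? ?]; rewrite !ltW.
have [_ [B1 _]] := Bd _ (inB h k (ltW2 _ ht) (ltW2 _ kt)).
have [_ [_ B2]] := Bd _ (inB h' k' (ltW2 _ ht') (ltW2 _ kt')).
rewrite E in B1.
move: ('D_v ('D_u f) x) ('D_u ('D_v f) x) ('D_u ('D_v f) _) B1 B2 => A B C B1 B2.
apply: le_trans (ler_distD C _ _) _; rewrite (distrC C B) [leRHS]splitr.
by rewrite lerD ?ltW.
Qed.

End directional.

Section words.
Context {R : realType} {V : normedModType R} {I : eqType} (e : I -> V).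
Variable (D : set V).
Hypothesis oD : open D.
Implicit Types (f : V -> R) (w : seq I).

Lemma smooth_on_pderiv f w : smooth_on e D f -> smooth_on e D (pderiv e w f).
Proof.
move=> sf w' x Dx; have := sf (w' ++ w) x Dx.
by rewrite /pderiv foldr_cat.
Qed.

Lemma eq_pderiv f g w : (forall x, D x -> f x = g x) ->
  forall x, D x -> pderiv e w f x = pderiv e w g x.
Proof.
move=> fg; elim: w => [//|i w IH] x Dx /=.
apply: near_eq_derive.
have : \forall y \near x, D y by exact: open_nbhs_nbhs.
by apply: filterS => y; exact: IH.
Qed.

Lemma pderiv_swap f i j : smooth_on e D f -> forall x, D x ->
  pderiv e [:: i; j] f x = pderiv e [:: j; i] f x.
Proof.
move=> sf x Dx /=.
apply: (@derive_comm R V D f x (e j) (e i) oD Dx).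
- move=> z Dz; split.
  + by have [_ /(_ j)] := sf [::] z Dz.
  + by have [_ /(_ i)] := sf [::] z Dz.
  + by have [_ /(_ i)] := sf [:: j] z Dz.
  + by have [_ /(_ j)] := sf [:: i] z Dz.
- by have [] := sf [:: i; j] x Dx.
- by have [] := sf [:: j; i] x Dx.
Qed.

Lemma pderiv_to_front f i w1 w2 : smooth_on e D f -> forall x, D x ->
  pderiv e (w1 ++ i :: w2) f x = pderiv e (i :: w1 ++ w2) f x.
Proof.
move=> sf; elim: w1 => [//|j w1 IH] x Dx.
transitivity (pderiv e [:: j; i] (pderiv e (w1 ++ w2) f) x).
  exact: (@eq_pderiv (pderiv e (w1 ++ i :: w2) f)
    (pderiv e (i :: w1 ++ w2) f) [:: j] IH).
exact: (pderiv_swap j i (smooth_on_pderiv (w1 ++ w2) sf) Dx).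
Qed.

(** The order of differentiation is immaterial, by moving one letter at a time to
    the front. *)
Lemma perm_pderiv f w w' : smooth_on e D f -> perm_eq w w' ->
  forall x, D x -> pderiv e w f x = pderiv e w' f x.
Proof.
move=> sf; elim: w w' => [|i w IH] w' ww'.
  by move: ww'; rewrite perm_sym => /perm_nilP ->.
have iw' : i \in w' by rewrite -(perm_mem ww') mem_head.
move: ww'; case/splitPr: iw' => w1 w2 ww' x Dx.
rewrite pderiv_to_front//.
apply: (@eq_pderiv (pderiv e w f) (pderiv e (w1 ++ w2) f) [:: i]) => // z Dz.
apply: IH => //.
by move: ww'; rewrite perm_sym -(cat1s i w2) perm_catCA /= perm_cons perm_sym.
Qed.

End words.

Section mword.
Context {n : nat}.
(** The multi-index of a word. The word [mword (word_mindex w)] is the sorted form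
    of w, the only form that the seminorms speak of. *)
Definition word_mindex (w : seq 'I_n) : {ffun 'I_n -> nat} :=
  [ffun i => count_mem i w].

Lemma count_mem_mword (b : {ffun 'I_n -> nat}) i : count_mem i (mword b) = b i.
Proof.
rewrite /mword count_flatten -map_comp sumnE big_map big_enum /=.
rewrite (bigD1 i)//= count_nseq /= eqxx mul1n big1 ?addn0// => j ji.
by rewrite count_nseq /= (negbTE ji).
Qed.

Lemma perm_mword (w : seq 'I_n) : perm_eq w (mword (word_mindex w)).
Proof.
by apply/allP => i _ /=; rewrite count_mem_mword ffunE.
Qed.

Lemma size_mword (b : {ffun 'I_n -> nat}) : size (mword b) = mabs b.
Proof.
rewrite /mword size_flatten /shape -map_comp sumnE big_map big_enum /=.
by apply: eq_bigr => i _ /=; rewrite size_nseq.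
Qed.

End mword.

Section bounded_partials.
Context {R : realType} {n : nat}.
Implicit Types f : 'rV[R]_n -> R.

(** Bounded partial derivatives make f Lipschitz along each coordinate direction,
    hence along a path made of n such moves. This spares a separate continuity
    argument for parametric integrals, whose partial derivatives are bounded. *)
Lemma bounded_partials_continuous f (C : R) :
  (forall x i, derivable f x (coord_dir R i)) ->
  (forall x i, `|'D_(coord_dir R i) f x| <= C) ->
  continuous f.
Proof.
move=> df bf x.
have C0 : 0 <= C \/ n = 0%N.
  case: n f x df bf => [|m] f x df bf; first by right.
  by left; apply: le_trans (bf x ord0).
case: C0 => [C0|n0]; last first.
  have -> : f = cst (f x).
    by apply/funext => y; congr f; apply/rowP => i; have := ltn_ord i; rewrite [X in (_ < X)%N]n0.
  exact: cst_continuous.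
have step (y : 'rV[R]_n) i (t : R) :
    `|f (t *: coord_dir R i + y) - f y| <= C * `|t|.
  wlog t0 : y t / 0 < t.
    move=> H; have [t0|t0|->] := ltgtP t 0.
    - have := H (t *: coord_dir R i + y) (- t).
      rewrite oppr_gt0 addrA -scalerDl addNr scale0r add0r normrN distrC.
      exact.
    - exact: H.
    - by rewrite scale0r add0r subrr !normr0 mulr0.
  have [h _ -> //] := MVT_line t0 (fun h _ => df (h *: coord_dir R i + y) i).
  by rewrite normrM mulrC ler_wpM2r.
have path (y : 'rV[R]_n) (v : 'rV[R]_n) (s : seq 'I_n) :
    `|f (\sum_(i <- s) v 0 i *: coord_dir R i + y) - f y| <=
    C * \sum_(i <- s) `|v 0 i|.
  elim: s => [|i s IH]; first by rewrite !big_nil add0r subrr normr0 mulr0.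
  rewrite !big_cons mulrDr -addrA.
  apply: le_trans (ler_distD (f (\sum_(j <- s) v 0 j *: coord_dir R j + y)) _ _) _.
  exact: lerD (step _ i (v 0 i)) IH.
apply/(@cvgrPdist_lt R R^o _ (nbhs x) _ f) => e e0.
have M0 : 0 < 1 + C * n%:R by rewrite ltr_pwDl// mulr_ge0.
near=> z.
rewrite distrC.
have -> : z = \sum_(i <- enum 'I_n) (z - x) 0 i *: coord_dir R i + x.
  by rewrite big_enum /= -(row_sum_delta (z - x)) subrK.
rewrite (le_lt_trans (path _ _ _))//.
apply: (@le_lt_trans _ _ (C * (n%:R * `|z - x|))).
  rewrite ler_wpM2l//; apply: (@le_trans _ _ (\sum_(i <- enum 'I_n) `|z - x|)).
    apply: ler_sum => i _.
    rewrite {2}/Num.Def.normr/= mx_normrE.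
    by apply: le_trans (le_bigmax _ _ (0, i)) => /=.
  by rewrite big_const_seq count_predT size_enum_ord iter_addr_0 mulr_natl.
apply: (@le_lt_trans _ _ ((1 + C * n%:R) * `|z - x|)).
  by rewrite mulrA ler_wpM2r// lerDr.
rewrite -ltr_pdivlMl//.
rewrite distrC; near: z.
apply: (@cvgr_dist_lt R 'rV[R]_n _ (nbhs x) _ id x) => //.
by rewrite mulr_gt0// invr_gt0.
Unshelve. all: by end_near. Qed.

End bounded_partials.

(** * Measurability of continuous functions of coordinates *)

Section measurable_comp_continuous.
Context d (T : measurableType d) (R : realType) (n : nat).
Variables (D : set T) (b : T -> 'rV[R]_n) (a : T -> R).
Hypothesis mD : measurable D.
Hypothesis mb : forall i, measurable_fun D (fun t => b t 0 i).
Hypothesis ma : measurable_fun D a.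

Let code k t : {ffun 'I_n -> int} * int :=
  ([ffun i => Num.floor (k.+1%:R * b t 0 i)], Num.floor (k.+1%:R * a t)).

Let measurable_floor_fiber (g : T -> R) k (m : int) : measurable_fun D g ->
  measurable (D `&` [set t | Num.floor (k.+1%:R * g t) = m]).
Proof.
move=> mg.
have -> : [set t | Num.floor (k.+1%:R * g t) = m] =
    (fun t => k.+1%:R * g t) @^-1` `[m%:~R, (m + 1)%:~R[%classic.
  apply/seteqP; split=> t /=; rewrite in_itv /=.
    by move/eqP; rewrite floor_eq.
  by rewrite -floor_eq => /eqP.
by apply: measurable_funM => //; exact: measurable_cst.
Qed.

Let measurable_code k z : measurable (D `&` [set t | code k t = z]).
Proof.
case: z => z m.
have -> : D `&` [set t | code k t = (z, m)] =
    (D `&` [set t | Num.floor (k.+1%:R * a t) = m]) `&`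
    \bigcap_(i in [set: 'I_n]) (D `&` [set t | Num.floor (k.+1%:R * b t 0 i) = z i]).
  apply/seteqP; split=> t /=.
    by move=> [Dt [<- <-]]; split => // i _; rewrite ffunE.
  move=> [[Dt E1] E2]; split=> //; congr (_, _) => //.
  by apply/ffunP => i; rewrite ffunE; have [] := E2 i I.
apply: measurableI; first exact: measurable_floor_fiber.
apply: fin_bigcap_measurable => [|i _]; first exact: finite_finset.
exact: measurable_floor_fiber.
Qed.

(** Rounding the coordinates down to multiples of 1 / k factors through a countable
    set with measurable fibres, so f composed with the rounding is measurable
    whatever f is; continuity of f makes these compositions converge pointwise.
    The last coordinate a is singled out to fit the half-space, and continuity is
    asked only at the points of the image of D because functions on the
    half-space are arbitrary outside of it. *)
Lemma measurable_comp_continuous (f : 'rV[R]_n * R -> R) :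
  (forall t, D t -> {for (b t, a t), continuous f}) ->
  measurable_fun D (fun t => f (b t, a t)).
Proof.
move=> cf.
pose q k (m : int) : R := m%:~R / k.+1%:R.
pose F k (z : {ffun 'I_n -> int} * int) := f (\row_i q k (z.1 i), q k z.2).
have qcvg (x : R) : q k (Num.floor (k.+1%:R * x)) @[k --> \oo] --> x.
  apply/cvgrPdist_lt => e e0; near=> k.
  rewrite /q; have /andP[h1 h2] := floor_itv (k.+1%:R * x).
  have k0 : 0 < k.+1%:R :> R by rewrite ltr0n.
  have h3 : k.+1%:R^-1 < e.
    near: k; have := @near_infty_natSinv_lt R (PosNum e0); exact.
  set m := (Num.floor _)%:~R in h1 h2 *.
  have E : x - m / k.+1%:R = (k.+1%:R * x - m) / k.+1%:R.
    by rewrite mulrBl mulrAC mulfV ?mul1r// lt0r_neq0.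
  rewrite E ger0_norm; last by rewrite divr_ge0 ?subr_ge0// ltW.
  apply: le_lt_trans h3; rewrite ler_pdivrMr// mulVf ?lt0r_neq0//.
  by move: h2; rewrite intrD -/m => h2; lra.
apply: (@measurable_fun_cvg _ _ R D (fun k t => F k (code k t))) => [k|t Dt].
  move=> _ Y mY.
  have -> : D `&` (fun t => F k (code k t)) @^-1` Y =
     \bigcup_z (if F k z \in Y then D `&` [set t | code k t = z] else set0).
    apply/seteqP; split=> t /=.
      by move=> [Dt Yt]; exists (code k t) => //; rewrite mem_set.
    by move=> [z _]; case: ifPn => // /set_mem Yz [Dt ->].
  apply: countable_bigcupT_measurable; first exact: countableP.
  by move=> z; case: ifPn => // _; exact: measurable_code.
have row_cvg : (\row_i q k ((code k t).1 i)) @[k --> \oo] --> nbhs (b t).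
  move=> A [P nP sP].
  have H : \forall k \near \oo, forall j : 'I_n, P 0 j (q k ((code k t).1 j)).
    apply: (@filter_forall nat 'I_n (fun j k => P 0 j (q k ((code k t).1 j)))) => j.
    have Q : \forall k \near \oo, P 0 j (q k (Num.floor (k.+1%:R * b t 0 j))).
      exact: (qcvg (b t 0 j) (P 0 j) (nP 0 j)).
    by apply: filterS Q => k Q; rewrite ffunE.
  by apply: filterS H => k H; apply: sP => i j; rewrite ord1 mxE; exact: H.
exact: (cvg_comp _ f (cvg_pair row_cvg (qcvg (a t))) (cf t Dt)).
Unshelve. all: by end_near. Qed.

End measurable_comp_continuous.

(** * Affine changes of variables and integrable weights *)

Section lebesgue_affine1.
Context {R : realType}.
Local Notation mR := (measurableTypeR R).
Local Open Scope ereal_scope.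
Variables (c r : R).
Hypothesis r0 : (r != 0)%R.

Let aff (x : mR) : mR := (c + r * x)%R.

Let maff : measurable_fun setT aff.
Proof.
apply: measurable_funD; first exact: measurable_cst.
by apply: measurable_funM => //; exact: measurable_cst.
Qed.

Let pf := pushforward (@lebesgue_measure R) aff.
HB.instance Definition _ := Measure.copy pf
  (measure_function_pushforward__canonical__measure_function_Measure
    (@lebesgue_measure R) maff).

Let k : {nonneg R} := NngNum (normr_ge0 r).

Let lebesgue_affE (X : set mR) : measurable X ->
  lebesgue_measure X = mscale k pf X.
Proof.
move=> mX; apply: lebesgue_measure_unique mX => _ [[p q] _ <-] /=.
rewrite /mscale /= /pf /pushforward lebesgue_measure_itv /= lte_fin.
have [rp|rn] : (0 < r)%R \/ (r < 0)%R by case: (ltgtP r 0%R) r0; auto.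
- have -> : aff @^-1` `]p, q]%classic = `]((p - c) / r)%R, ((q - c) / r)%R]%classic.
    apply/seteqP; split=> x; rewrite /aff /= !in_itv /= => /andP[h1 h2];
      move: h1 h2; rewrite ltr_pdivrMr// ler_pdivlMr//;
      by rewrite ltrBlDl lerBrDl [(x * r)%R]mulrC => -> ->.
  rewrite lebesgue_measure_itv /= lte_fin ltr_pM2r ?invr_gt0// ltrD2r.
  case: ifP => _; last by rewrite mule0.
  rewrite -!EFinB -EFinM gtr0_norm//; congr EFin.
  by field.
- have -> : aff @^-1` `]p, q]%classic = `[((q - c) / r)%R, ((p - c) / r)%R[%classic.
    apply/seteqP; split=> x; rewrite /aff /= !in_itv /= => /andP[h1 h2];
      move: h1 h2; rewrite ltr_ndivlMr// ler_ndivrMr//;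
      by rewrite ltrBlDl lerBrDl [(x * r)%R]mulrC => -> ->.
  rewrite lebesgue_measure_itv /= lte_fin ltr_nM2r ?invr_lt0// ltrD2r.
  case: ifP => _; last by rewrite mule0.
  rewrite -!EFinB -EFinM ltr0_norm//; congr EFin.
  by field.
Qed.

(** The image of the Lebesgue measure under x |-> c + r x, multiplied by |r|, agrees
    with the Lebesgue measure on half-open intervals, hence everywhere. *)
Lemma ge0_integral_affine1 (f : mR -> \bar R) :
  measurable_fun setT f -> (forall x, 0 <= f x) ->
  \int[lebesgue_measure]_x f (c + r * x)%R =
  (`|r|^-1)%:E * \int[lebesgue_measure]_x f x.
Proof.
move=> mf f0.
transitivity (\int[pf]_x f x).
  by rewrite ge0_integral_pushforward// => x _; exact: f0.
have -> : \int[lebesgue_measure]_x f x = \int[mscale k pf]_x f x.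
  by apply: eq_measure_integral => A mA _; exact: lebesgue_affE.
rewrite ge0_integral_mscale//= muleA -EFinM mulVf ?mul1e//.
by rewrite normr_eq0.
Qed.

End lebesgue_affine1.

Section lebesgue_tuple_theory.
Context {R : realType}.
Local Notation mR := (measurableTypeR R).

(** Tonelli's theorem, read through the recursive definition of the measure; all
    inductions on the dimension go through it. *)
Lemma ge0_integral_tuple_cons n (g : n.+1.-tuple mR -> \bar R) :
  measurable_fun setT g -> (forall u, (0 <= g u)%E) ->
  (\int[lebesgue_tuple n.+1]_u g u =
   \int[lebesgue_measure]_z \int[lebesgue_tuple n]_u g (tuple_cons (z, u)))%E.
Proof.
move=> mg g0.
transitivity (\int[pushforward (@lebesgue_measure R \x lebesgue_tuple n)%E
  (@tuple_cons R n)]_u g u)%E; first by [].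
rewrite (ge0_integral_pushforward (@measurable_tuple_cons R n)) => [|//|//|u _];
  last exact: g0.
rewrite preimage_setT (fubini_tonelli1 (g \o @tuple_cons R n))//.
- exact: (measurableT_comp mg (@measurable_tuple_cons R n)).
- by move=> x; exact: g0.
Qed.

Definition affine_tuple n (c : 'rV[R]_n) (r : R) (u : n.-tuple mR) : n.-tuple mR :=
  [tuple c 0 i + r * tnth u i | i < n].

Lemma rV_of_affine_tuple n (c : 'rV[R]_n) r (u : n.-tuple mR) :
  rV_of_tuple (affine_tuple c r u) = c + r *: rV_of_tuple u.
Proof. by apply/rowP => i; rewrite !mxE tnth_mktuple. Qed.

Lemma measurable_affine_tuple n (c : 'rV[R]_n) r :
  measurable_fun setT (affine_tuple c r).
Proof.
apply/measurable_fun_tnthP => i.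
have -> : (fun u : n.-tuple mR => tnth u i) \o affine_tuple c r =
    (fun u => c 0 i + r * tnth u i).
  by apply/funext => u; rewrite /= tnth_mktuple.
apply: measurable_funD; first exact: measurable_cst.
apply: measurable_funM; first exact: measurable_cst.
exact: measurable_tnth.
Qed.

Lemma ge0_integral_affine n (c : 'rV[R]_n) (r : R) (f : n.-tuple mR -> \bar R) :
  r != 0 -> measurable_fun setT f -> (forall u, (0 <= f u)%E) ->
  (\int[lebesgue_tuple n]_u f (affine_tuple c r u) =
   (`|r| ^- n)%:E * \int[lebesgue_tuple n]_u f u)%E.
Proof.
move=> r0; elim: n c f => [|n IH] c f mf f0.
  rewrite expr0 invr1 mul1e; apply: eq_integral => u _.
  by congr f; apply/val_inj; rewrite (tuple0 u) (tuple0 (affine_tuple _ _ _)).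
rewrite ge0_integral_tuple_cons//; last first.
  exact: (measurableT_comp mf (@measurable_affine_tuple n.+1 c r)).
rewrite ge0_integral_tuple_cons//.
pose c' : 'rV[R]_n := \row_i c 0 (lift ord0 i).
have affE z u : affine_tuple c r (tuple_cons (z, u)) =
    tuple_cons (c 0 ord0 + r * z, affine_tuple c' r u).
  apply/eq_from_tnth => i; rewrite tnth_mktuple.
  have [j ->|->] := unliftP ord0 i.
    by rewrite !tnthS tnth_mktuple mxE.
  by rewrite !tnth0.
pose g z := (\int[lebesgue_tuple n]_u f (tuple_cons (z, u)))%E.
have mfc : measurable_fun setT (f \o @tuple_cons R n).
  exact: (measurableT_comp mf (@measurable_tuple_cons R n)).
have mg : measurable_fun setT g.
  exact: (measurable_fun_fubini_tonelli_F (f \o @tuple_cons R n) mfc (fun=> f0 _)).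
have g0 z : (0 <= g z)%E by exact: integral_ge0.
transitivity (\int[lebesgue_measure]_z ((`|r| ^- n)%:E * g (c 0 ord0 + r * z)%R))%E.
  apply: eq_integral => z _.
  transitivity (\int[lebesgue_tuple n]_u
      (fun u => f (tuple_cons ((c 0 ord0 + r * z)%R, u))) (affine_tuple c' r u))%E.
    by apply: eq_integral => u _; rewrite affE.
  apply: IH => //.
  exact: (measurableT_comp mfc (measurable_pair1 (c 0 ord0 + r * z))).
have maff : measurable_fun setT (fun z : mR => c 0 ord0 + r * z : mR).
  apply: measurable_funD; first exact: measurable_cst.
  by apply: measurable_funM => //; exact: measurable_cst.
have r0' : (0 <= (`|r| ^- n)%:E)%E by rewrite lee_fin invr_ge0 exprn_ge0.
have mga : measurable_fun setT (fun z : mR => g (c 0 ord0 + r * z)).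
  exact: measurableT_comp.
rewrite (ge0_integralZl lebesgue_measure measurableT mga (fun z _ => g0 _) r0').
rewrite (ge0_integral_affine1 (c 0 ord0) r0 mg g0) muleA -EFinM; congr (_%:E * _)%E.
by rewrite exprSr invfM mulrC.
Qed.

Section real_affine.
Context n (c : 'rV[R]_n) (r : R) (g : n.-tuple mR -> R).
Hypothesis r0 : r != 0.
Hypothesis ig : (lebesgue_tuple n).-integrable setT (EFin \o g).

Let mg : measurable_fun setT (EFin \o g).
Proof. by have /integrableP[] := ig. Qed.

Let maff := measurable_affine_tuple c r.

Lemma integrable_affine :
  (lebesgue_tuple n).-integrable setT (EFin \o (g \o affine_tuple c r)).
Proof.
have /integrableP[_ ioo] := ig.
apply/integrableP; split; first exact: (measurableT_comp mg maff).
have := @ge0_integral_affine n c r (abse \o (EFin \o g)) r0.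
rewrite /= => ->//; last exact: measurableT_comp.
by rewrite lte_mul_pinfty// lee_fin invr_ge0 exprn_ge0.
Qed.

Lemma Rintegral_affine :
  \int[lebesgue_tuple n]_u g (affine_tuple c r u) =
  `|r| ^- n * \int[lebesgue_tuple n]_u g u.
Proof.
rewrite -RintegralZl//.
have iZ := integrableZl measurableT (`|r| ^- n) ig.
have k0 : 0 <= `|r| ^- n by rewrite invr_ge0 exprn_ge0.
rewrite /Rintegral; congr fine.
have E1 : (\int[lebesgue_tuple n]_u (`|r| ^- n * g u)%:E =
  (`|r| ^- n)%:E * \int[lebesgue_tuple n]_u (g u)%:E)%E.
  rewrite -(integralZl measurableT ig).
  by apply: eq_integral.
rewrite E1 [LHS]integralE [X in (_ * X)%E]integralE.
rewrite muleBr//; last first.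
  by apply: integrable_add_def.
congr (_ - _)%E.
  rewrite -(ge0_integral_affine c r0 (measurable_funepos mg) (funepos_ge0 _)).
  by apply: eq_integral => u _; rewrite !funeposE.
rewrite -(ge0_integral_affine c r0 (measurable_funeneg mg) (funeneg_ge0 _)).
by apply: eq_integral => u _; rewrite !funenegE.
Qed.

End real_affine.

Lemma Rn_integrable_affine n (c : 'rV[R]_n) (r : R) (f : 'rV[R]_n -> R[i]) :
  r != 0 -> Rn_integrable f -> Rn_integrable (fun x => f (c + r *: x)).
Proof.
move=> r0 [f1 f2].
have E : (fun x => f (c + r *: x)) \o @rV_of_tuple R n =
    (f \o @rV_of_tuple R n) \o affine_tuple c r.
  by apply/funext => u /=; rewrite rV_of_affine_tuple.
rewrite /Rn_integrable E; split.
  exact: (integrable_affine c r0 f1).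
exact: (integrable_affine c r0 f2).
Qed.

Lemma Rn_integral_affine n (c : 'rV[R]_n) (r : R) (f : 'rV[R]_n -> R[i]) :
  r != 0 -> Rn_integrable f ->
  Rn_integral (fun x => f (c + r *: x)) = (`|r| ^- n)%:C%C * Rn_integral f.
Proof.
move=> r0 [f1 f2].
have E : (fun x => f (c + r *: x)) \o @rV_of_tuple R n =
    (f \o @rV_of_tuple R n) \o affine_tuple c r.
  by apply/funext => u /=; rewrite rV_of_affine_tuple.
rewrite /Rn_integral E /Cintegral /=.
rewrite (Rintegral_affine c r0 f1) (Rintegral_affine c r0 f2).
by rewrite /GRing.mul /= !mul0r subr0 addr0.
Qed.

Lemma integrable_oneDsqrV :
  (@lebesgue_measure R).-integrable setT (EFin \o (fun x => (oneDsqr x)^-1)).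
Proof.
have co : continuous (fun x : R => (oneDsqr x)^-1) by exact: continuous_oneDsqrV.
apply/integrableP; split.
  by apply/measurable_EFinP; exact: continuous_measurable_fun.
under eq_integral => x _ do rewrite /= ger0_norm ?invr_ge0//.
rewrite ge0_symfun_integralT//.
- rewrite (_ : [set x | _] = `[0, +oo[%classic); last first.
    by apply/seteqP; split => x/=; rewrite in_itv/= andbT.
  by rewrite integral0y_oneDsqr -EFinM ltry.
- by move=> x /=; rewrite /oneDsqr sqrrN.
Qed.

(** The product form is what makes the weight integrable by induction on n; it
    lies between <x>^-2n and <x>^-2. *)
Definition decay n (x : 'rV[R]_n) : R := \prod_i (oneDsqr (x 0 i))^-1.

Lemma decay_gt0 n (x : 'rV[R]_n) : 0 < decay x.
Proof. by apply: prodr_gt0 => i _; rewrite invr_gt0 (lt_le_trans ltr01)// oneDsqr_ge1. Qed.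

Lemma decay_le1 n (x : 'rV[R]_n) : decay x <= 1.
Proof.
apply: prodr_ile1 => i _.
by rewrite invr_ge0 (le_trans ler01 (oneDsqr_ge1 _)) oneDsqrV_le1.
Qed.

Lemma measurable_half_decayay n :
  measurable_fun setT (fun u : n.-tuple mR => decay (rV_of_tuple u)).
Proof.
apply: measurable_prod => i _.
have -> : (fun u : n.-tuple mR => (oneDsqr (rV_of_tuple u 0 i))^-1) =
   (fun x : R => (oneDsqr x)^-1) \o (fun u => tnth u i).
  by apply/funext => u; rewrite /= mxE.
apply: measurableT_comp; last exact: measurable_tnth.
by apply: continuous_measurable_fun; exact: continuous_oneDsqrV.
Qed.

Lemma integrable_decay n :
  (lebesgue_tuple n).-integrable setT (EFin \o (fun u => decay (rV_of_tuple u))).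
Proof.
apply/integrableP; split; first by apply/measurable_EFinP; apply: measurable_half_decayay.
under eq_integral => x _ do rewrite /= ger0_norm ?(ltW (decay_gt0 _))//.
elim: n => [|n IH].
  rewrite integral_dirac//; last by apply/measurable_EFinP; exact: measurable_half_decayay.
  by rewrite /= /dirac indicE mem_set// mul1e ltry.
rewrite ge0_integral_tuple_cons; last 2 first.
  apply/measurable_EFinP; exact: measurable_half_decayay.
  by move=> u; rewrite lee_fin (ltW (decay_gt0 _)).
set J := (\int[lebesgue_tuple n]_u (decay (rV_of_tuple u))%:E)%E.
have J0 : (0 <= J)%E.
  by apply: integral_ge0 => u _; rewrite lee_fin (ltW (decay_gt0 _)).
have Jfin : J \is a fin_num by rewrite ge0_fin_numE.
have -> : (\int[@lebesgue_measure R]_z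
    \int[lebesgue_tuple n]_u (decay (rV_of_tuple (tuple_cons (z, u))))%:E =
    \int[@lebesgue_measure R]_z ((fine J)%:E * ((oneDsqr z)^-1)%:E))%E.
  apply: eq_integral => z _; rewrite fineK// muleC -ge0_integralZl//.
  - apply: eq_integral => u _; rewrite -EFinM /decay big_ord_recl.
    congr (_ * _)%:E; first by rewrite mxE tnth0.
    by apply: eq_bigr => i _; rewrite !mxE tnthS.
  - apply/measurable_EFinP; exact: measurable_half_decayay.
  - by move=> u _; rewrite lee_fin (ltW (decay_gt0 _)).
have := integrableZl measurableT (fine J) integrable_oneDsqrV.
by move=> /(integrable_fin_num measurableT) /fin_numPlt /andP[].
Qed.

End lebesgue_tuple_theory.

(** * Differentiation under the integral sign *)

Section parametric_integral.
Context d (Y : measurableType d) (R : realType) (mu : {measure set Y -> \bar R}).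
Context (n : nat).
Local Notation e := (@coord_dir R n).
Variables (K : 'rV[R]_n -> Y -> R) (g : Y -> R).
Hypothesis sK : forall y, smooth_on e setT (K ^~ y).
Hypothesis mK : forall x, measurable_fun setT (K x).
Hypothesis g0 : forall y, 0 <= g y.
Hypothesis ig : mu.-integrable setT (EFin \o g).
Hypothesis bK : forall w, exists C, forall x y,
  `|pderiv e w (K ^~ y) x| <= C * g y.

Let dK w x y := pderiv e w (K ^~ y) x.

Let is_derive_dK w i x y : is_derive x (e i) (fun z => dK w z y) (dK (i :: w) x y).
Proof. by have [_ /(_ i) H] := sK y w (x := x) I; apply: DeriveDef. Qed.

Let measurable_dK w x : measurable_fun setT (dK w x).
Proof.
elim: w x => [//|i w IH] x.
pose t (k : nat) : R := k.+1%:R^-1.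
apply: (@measurable_fun_cvg _ _ R setT
  (fun k y => (t k)^-1 * (dK w (t k *: e i + x) y - dK w x y))) => [k|y _].
  apply: measurable_funM; first exact: measurable_cst.
  exact: measurable_funB.
have [/cvg_ex[/= l Dl] E] := is_derive_dK w i x y.
have El : l = dK (i :: w) x y.
  by apply/esym; exact: (@cvg_lim _ (@norm_hausdorff _ _) _ _ _ _ l Dl).
have t0 : (forall k, t k != 0) /\ t k @[k --> \oo] --> (0 : R).
  split=> [k|]; first by rewrite invr_eq0 pnatr_eq0.
  exact: cvg_harmonic.
by move: Dl; rewrite El => /cvgr_dnbhsP /(_ t t0).
Qed.

Let bK_ge0 w : exists2 C, 0 <= C & forall x y, `|dK w x y| <= C * g y.
Proof.
have [C HC] := bK w; exists `|C| => // x y.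
by apply: (le_trans (HC x y)); rewrite ler_wpM2r// ler_norm.
Qed.

Let integrable_dK w x : mu.-integrable setT (EFin \o dK w x).
Proof.
have [C C0 HC] := bK_ge0 w.
apply: (@le_integrable _ _ _ mu setT measurableT _ (fun y => (C * g y)%:E)).
- exact/measurable_EFinP.
- move=> y _; rewrite /= lee_fin (le_trans (HC x y))//.
  by rewrite ler_norm.
- by have := integrableZl measurableT C ig; apply: eq_integrable.
Qed.

Let F w x := \int[mu]_y dK w x y.

Let normF w : exists C, forall x, `|F w x| <= C.
Proof.
have [C C0 HC] := bK_ge0 w; exists (C * \int[mu]_y g y) => x.
rewrite -RintegralZl//; apply: le_trans (le_normr_Rintegral _ _) _ => //.
apply: le_Rintegral => //.
- by have := integrable_abse (integrable_dK w x); apply: eq_integrable.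
- by have := integrableZl measurableT C ig; apply: eq_integrable.
Qed.

Let is_derive_F w i x : is_derive x (e i) (F w) (F (i :: w) x).
Proof.
have -> : x = 0 *: e i + x by rewrite scale0r add0r.
apply/is_derive_line.
have [C C0 HC] := bK_ge0 (i :: w).
pose f (h : R) y := dK w (h *: e i + x) y.
have df (h : R) (y : Y) : is_derive h 1 (f ^~ y) (dK (i :: w) (h *: e i + x) y).
  apply/(is_derive_line (fun z => dK w z y) x (e i) h).
  exact: is_derive_dK.
have I0 : `]-1, 1[%classic (0 : R) by rewrite /= in_itv /= ltrN10 ltr01.
have A1 : forall h, `]-1, 1[%classic h -> mu.-integrable setT (EFin \o f h).
  by move=> h _; exact: integrable_dK.
have A2 : forall h y, `]-1, 1[%classic h -> setT y -> derivable (f ^~ y) h 1.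
  by move=> h y _ _; have [] := df h y.
have A3 : forall y, 0 <= C * g y by move=> y; rewrite mulr_ge0.
have A4 : mu.-integrable setT (EFin \o (fun y => C * g y)).
  by have := integrableZl measurableT C ig; apply: eq_integrable.
have A5 : forall h y, `]-1, 1[%classic h -> setT y ->
    `|partial1of2 f h y| <= C * g y.
  by move=> h y _ _; rewrite partial1of2E; have [_ ->] := df h y; exact: HC.
apply: DeriveDef.
  exact: (derivable_under_integral measurableT I0 A1 A2 A3 A4 A5).
rewrite -derive1E (differentiation_under_integral measurableT I0 A1 A2 A3 A4 A5).
apply: eq_Rintegral => y _.
by rewrite partial1of2E; have [_ ->] := df 0 y.
Qed.

Let pderivF w : pderiv e w (fun x => \int[mu]_y K x y) = F w.
Proof.
elim: w => [//|i w IH]; apply/funext => x /=.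
by rewrite IH; have [_ ->] := is_derive_F w i x.
Qed.

(** The hypotheses bound every iterated derivative of K by a multiple of one and the
    same integrable function, uniformly in x; induction on the word then reduces
    everything to the one-dimensional theorem on a line. *)
Lemma pderiv_Rintegral w x :
  pderiv e w (fun x => \int[mu]_y K x y) x = \int[mu]_y pderiv e w (K ^~ y) x.
Proof. by rewrite pderivF. Qed.

Lemma integrable_pderiv w x :
  mu.-integrable setT (EFin \o (fun y => pderiv e w (K ^~ y) x)).
Proof. exact: integrable_dK. Qed.

Lemma smooth_on_Rintegral : smooth_on e setT (fun x => \int[mu]_y K x y).
Proof.
move=> w x _; rewrite pderivF; split; last first.
  by move=> i; have [] := is_derive_F w i x.
have [C HC] : exists C, forall i x, `|F (i :: w) x| <= C.
  pose C i := sval (cid (normF (i :: w))).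
  exists (\sum_i `|C i|) => i z.
  apply: le_trans (svalP (cid (normF (i :: w))) z) _.
  apply: le_trans (ler_norm (C i)) _.
  by rewrite (bigD1 i)//= lerDl sumr_ge0.
apply: (@bounded_partials_continuous R n (F w) C) => z i.
  by have [] := is_derive_F w i z.
by have [_ ->] := is_derive_F w i z; exact: HC.
Qed.

End parametric_integral.

Section complex_parametric_integral.
Context d (Y : measurableType d) (R : realType) (mu : {measure set Y -> \bar R}).
Context (n : nat).
Local Notation e := (@coord_dir R n).
Local Notation Re := complex.Re.
Local Notation Im := complex.Im.

Lemma normc_ge0 (z : R[i]) : 0 <= normc z.
Proof. by case: z => ? ?; exact: sqrtr_ge0. Qed.

Lemma normc_ReIm (z : R[i]) : normc z <= `|Re z| + `|Im z|.
Proof.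
case: z => a b /=; rewrite -[leRHS]ger0_norm ?addr_ge0// -sqrtr_sqr.
apply: ler_wsqrtr; rewrite sqrrD !real_normK ?num_real//.
by rewrite lerD2r lerDl mulrn_wge0// mulr_ge0.
Qed.

Lemma ler_norm_Re (z : R[i]) : `|Re z| <= normc z.
Proof.
by case: z => a b /=; rewrite -sqrtr_sqr ler_wsqrtr// lerDl sqr_ge0.
Qed.

Lemma ler_norm_Im (z : R[i]) : `|Im z| <= normc z.
Proof.
by case: z => a b /=; rewrite -sqrtr_sqr ler_wsqrtr// lerDr sqr_ge0.
Qed.

Lemma normc_real (a : R) : normc a%:C%C = `|a|.
Proof. by rewrite /= expr0n /= addr0 sqrtr_sqr. Qed.

Lemma le_Cintegrable (f : Y -> R[i]) (g : Y -> R) :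
  measurable_fun setT (fun y => Re (f y)) ->
  measurable_fun setT (fun y => Im (f y)) ->
  mu.-integrable setT (EFin \o g) -> (forall y, normc (f y) <= g y) ->
  Cintegrable mu setT f.
Proof.
move=> m1 m2 ig fg; split.
  apply: (@le_integrable _ _ _ mu setT measurableT _ (EFin \o g)) => //.
    exact/measurable_EFinP.
  move=> y _; rewrite /= lee_fin (le_trans (ler_norm_Re _))//.
  by rewrite (le_trans (fg y))// ler_norm.
apply: (@le_integrable _ _ _ mu setT measurableT _ (EFin \o g)) => //.
  exact/measurable_EFinP.
move=> y _; rewrite /= lee_fin (le_trans (ler_norm_Im _))//.
by rewrite (le_trans (fg y))// ler_norm.
Qed.

Lemma normc_Cintegral_le (f : Y -> R[i]) (g : Y -> R) :
  Cintegrable mu setT f ->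
  mu.-integrable setT (EFin \o g) -> (forall y, normc (f y) <= g y) ->
  normc (Cintegral mu setT f) <= 2 * \int[mu]_y g y.
Proof.
move=> [f1 f2] ig fg; apply: le_trans (normc_ReIm _) _.
have B (h : Y -> R) : mu.-integrable setT (EFin \o h) ->
    (forall y, `|h y| <= g y) -> `|\int[mu]_y h y| <= \int[mu]_y g y.
  move=> ih hg; apply: le_trans (le_normr_Rintegral _ _) _ => //.
  apply: le_Rintegral => //.
  by have := integrable_abse ih; apply: eq_integrable.
rewrite mulr2n mulrDl mul1r /=; apply: lerD; apply: B => // y.
  exact: le_trans (ler_norm_Re _) (fg y).
exact: le_trans (ler_norm_Im _) (fg y).
Qed.

Variables (K : 'rV[R]_n -> Y -> R[i]) (g : Y -> R).
Hypothesis sK : forall y, Csmooth_on e setT (K ^~ y).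
Hypothesis mRe : forall x, measurable_fun setT (fun y => Re (K x y)).
Hypothesis mIm : forall x, measurable_fun setT (fun y => Im (K x y)).
Hypothesis g0 : forall y, 0 <= g y.
Hypothesis ig : mu.-integrable setT (EFin \o g).
Hypothesis bK : forall w, exists C, forall x y,
  normc (Cpderiv e w (K ^~ y) x) <= C * g y.

Let sRe y := (sK y).1.
Let sIm y := (sK y).2.

Let bRe w : exists C, forall x y,
  `|pderiv e w (fun z => Re (K z y)) x| <= C * g y.
Proof.
have [C HC] := bK w; exists C => x y.
exact: le_trans (ler_norm_Re (Cpderiv e w (K ^~ y) x)) (HC x y).
Qed.

Let bIm w : exists C, forall x y,
  `|pderiv e w (fun z => Im (K z y)) x| <= C * g y.
Proof.
have [C HC] := bK w; exists C => x y.
exact: le_trans (ler_norm_Im (Cpderiv e w (K ^~ y) x)) (HC x y).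
Qed.

Lemma Csmooth_on_Cintegral :
  Csmooth_on e setT (fun x => Cintegral mu setT (K x)).
Proof.
split.
  exact: (smooth_on_Rintegral (K := fun x y => Re (K x y)) sRe mRe g0 ig bRe).
exact: (smooth_on_Rintegral (K := fun x y => Im (K x y)) sIm mIm g0 ig bIm).
Qed.

Lemma Cintegrable_Cpderiv w x :
  Cintegrable mu setT (fun y => Cpderiv e w (K ^~ y) x).
Proof.
split.
  exact: (integrable_pderiv (K := fun x y => Re (K x y)) sRe mRe g0 ig bRe).
exact: (integrable_pderiv (K := fun x y => Im (K x y)) sIm mIm g0 ig bIm).
Qed.

Lemma Cpderiv_Cintegral w x :
  Cpderiv e w (fun x => Cintegral mu setT (K x)) x =
  Cintegral mu setT (fun y => Cpderiv e w (K ^~ y) x).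
Proof.
rewrite /Cpderiv /Cintegral /=.
rewrite (pderiv_Rintegral (K := fun x y => Re (K x y)) sRe mRe g0 ig bRe).
by rewrite (pderiv_Rintegral (K := fun x y => Im (K x y)) sIm mIm g0 ig bIm).
Qed.

End complex_parametric_integral.

(** * Factorials of multi-indices and the pointwise estimate *)

Section factorials.

Lemma leq_bin_exp2 n m : ('C(n, m) <= 2 ^ n)%N.
Proof.
elim: n m => [|n IH] [|m]; rewrite ?bin0 ?bin0n ?expn_gt0//.
by rewrite binS expnS mul2n -addnn leq_add.
Qed.

Lemma leq_fact_add m j : ((m + j)`! <= 2 ^ (m + j) * (m`! * j`!))%N.
Proof.
have /= <- := @bin_fact (m + j) m (leq_addr j m).
by rewrite addKn leq_mul2r leq_bin_exp2 orbT.
Qed.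

Context {n : nat}.
Local Notation midx := {ffun 'I_n -> nat}.
Implicit Types b c : midx.

Lemma mfact_gt0 b : (0 < mfact b)%N.
Proof. by apply: prodn_gt0 => i; exact: fact_gt0. Qed.

Definition madd b c : midx := [ffun i => b i + c i]%N.

Lemma mabsD b c : mabs (madd b c) = (mabs b + mabs c)%N.
Proof. by rewrite /mabs -big_split; apply: eq_bigr => i _; rewrite ffunE. Qed.

Lemma leq_mfactD b c :
  (mfact (madd b c) <= 2 ^ (mabs b + mabs c) * (mfact b * mfact c))%N.
Proof.
rewrite /mfact -big_split /= /mabs -big_split /= expn_sum -big_split /=.
by apply: leq_prod => i _; rewrite ffunE; exact: leq_fact_add.
Qed.

Lemma leq_fact_mabs b : ((mabs b)`! <= (2 ^ n) ^ (mabs b) * mfact b)%N.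
Proof.
suff H (s : seq 'I_n) : ((\sum_(i <- s) b i)`! <=
    (2 ^ size s) ^ (\sum_(i <- s) b i) * \prod_(i <- s) (b i)`!)%N.
  by have := H (enum 'I_n); rewrite !big_enum size_enum_ord.
elim: s => [|i s IH]; first by rewrite !big_nil.
rewrite !big_cons /=; set S := (\sum_(j <- s) b j)%N in IH *.
set P := (\prod_(j <- s) _)%N in IH *.
apply: leq_trans (leq_fact_add _ _) _.
rewrite (expnS 2 (size s)) expnMn -mulnA leq_mul2l; apply/orP; right.
rewrite mulnCA leq_mul2l; apply/orP; right.
apply: leq_trans IH _; rewrite leq_mul2r; apply/orP; right.
by rewrite leq_pexp2l ?expn_gt0 ?leq_addl.
Qed.

End factorials.

Section pointwise.
Context {R : realType} {n : nat}.
Local Notation midx := {ffun 'I_n -> nat}.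

(** Raising to a real power keeps bounds of the form c q^m v, which is how all
    comparisons of factorials below are stated: geometric factors are absorbed in
    the parameter h of the seminorms. *)
Lemma le_powR_geom (e c q : R) (m : nat) (u v : R) : 0 <= e -> 0 <= c -> 0 <= q ->
  0 <= u -> 0 <= v -> u <= c * q ^+ m * v ->
  u `^ e <= c `^ e * (q `^ e) ^+ m * v `^ e.
Proof.
move=> e0 c0 q0 u0 v0 uv.
apply: (le_trans (ge0_ler_powR e0 _ _ uv)); rewrite ?nnegrE ?mulr_ge0 ?exprn_ge0//.
have E : (q ^+ m) `^ e = (q `^ e) ^+ m.
  by rewrite -powR_mulrn// -powRrM mulrC powRrM powR_mulrn ?powR_ge0.
by rewrite (powRM _ _ v0) ?mulr_ge0 ?exprn_ge0// (powRM _ c0) ?exprn_ge0// E.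
Qed.

Lemma powR_nat_ge1 (k : nat) (e : R) : (0 < k)%N -> 0 <= e -> 1 <= k%:R `^ e.
Proof.
move=> k0 e0; rewrite -[leLHS](powRr0 k%:R); apply: ler_powR => //.
by rewrite ler1n.
Qed.

Lemma fact_mabs_shift (e : R) (j : nat) : 0 <= e -> exists C B : R,
  [/\ 1 <= C, 1 <= B & forall b : midx,
    ((mabs b + j)`!)%:R `^ e <= C * B ^+ mabs b * (mfact b)%:R `^ e].
Proof.
move=> e0; exists ((2 ^ j * j`!)%N%:R `^ e), ((2 * 2 ^ n)%N%:R `^ e); split.
- by rewrite powR_nat_ge1// muln_gt0 expn_gt0 fact_gt0.
- by rewrite powR_nat_ge1// muln_gt0 expn_gt0.
move=> b; apply: le_powR_geom => //.
rewrite -natrX -!natrM ler_nat.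
apply: leq_trans (leq_fact_add _ _) _.
rewrite expnD expnMn.
have := leq_fact_mabs b; set F := (mabs b)`!; set E := ((2 ^ n) ^ mabs b)%N => FE.
set G := (2 ^ mabs b)%N; set J := j`!; set H := (2 ^ j)%N; set M := mfact b in FE *.
have -> : (G * H * (F * J) = (H * J * G) * F)%N by lia.
have -> : (H * J * (G * E) * M = (H * J * G) * (E * M))%N by lia.
by rewrite leq_mul2l FE orbT.
Qed.

Lemma mfactD_shift (e : R) (j : nat) : 0 <= e -> exists C B : R,
  [/\ 1 <= C, 1 <= B & forall b c : midx, (mabs c <= j)%N -> (mfact c <= j)%N ->
    (mfact (madd b c))%:R `^ e <= C * B ^+ mabs b * (mfact b)%:R `^ e].
Proof.
move=> e0; exists ((2 ^ j * j.+1)%N%:R `^ e), (2%:R `^ e); split.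
- by rewrite powR_nat_ge1// muln_gt0 expn_gt0.
- by rewrite powR_nat_ge1.
move=> b c cj mcj; apply: le_powR_geom => //.
rewrite -natrX -!natrM ler_nat.
apply: leq_trans (leq_mfactD _ _) _.
rewrite expnD; set F := mfact b; set E := (2 ^ mabs b)%N.
have h1 : (2 ^ mabs c <= 2 ^ j)%N by rewrite leq_pexp2l.
have h2 : (mfact c <= j.+1)%N by exact: leq_trans mcj _.
have -> : (E * 2 ^ mabs c * (F * mfact c) = E * F * (2 ^ mabs c * mfact c))%N by lia.
have -> : (2 ^ j * j.+1 * E * F = E * F * (2 ^ j * j.+1))%N by lia.
by rewrite leq_mul2l leq_mul ?orbT.
Qed.

Definition mrestrict (S : pred 'I_n) (b : midx) : midx := [ffun i => if S i then b i else 0%N].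

Lemma mrestrict_abs S b : mabs b = (mabs (mrestrict S b) + mabs (mrestrict (predC S) b))%N.
Proof.
rewrite /mabs -big_split; apply: eq_bigr => i _; rewrite !ffunE /=.
by case: (S i); rewrite ?addn0.
Qed.

Lemma mrestrict_fact S b : mfact b = (mfact (mrestrict S b) * mfact (mrestrict (predC S) b))%N.
Proof.
rewrite /mfact -big_split; apply: eq_bigr => i _; rewrite !ffunE /=.
by case: (S i); rewrite ?muln1 ?mul1n.
Qed.

Lemma mpowD (x : 'rV[R]_n) b c : mpow x (madd b c) = mpow x b * mpow x c.
Proof.
by rewrite /mpow -big_split; apply: eq_bigr => i _; rewrite ffunE exprD.
Qed.

Lemma norm_mpow (x : 'rV[R]_n) b : `|mpow x b| = \prod_i `|x 0 i| ^+ b i.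
Proof. by rewrite /mpow normr_prod; apply: eq_bigr => i _; rewrite normrX. Qed.

(** In each coordinate |b_i + a y_i| is at most twice the larger of |b_i| and
    a |y_i|. Choosing the larger one, rather than expanding the power, avoids all
    sums and keeps the factorials of the two parts multiplying to that of al. *)
Lemma le_mpow_split (x b y : 'rV[R]_n) (a : R) (al : midx) : 0 <= a ->
  x = b + a *: y -> exists S : pred 'I_n,
  `|mpow x al| <= 2 ^+ mabs al *
    (`|mpow b (mrestrict (predC S) al)| * (a ^+ mabs (mrestrict S al) * `|mpow y (mrestrict S al)|)).
Proof.
move=> a0 ->; exists (fun i => `|b 0 i| < a * `|y 0 i|).
rewrite !norm_mpow /mabs !expr_sum -!big_split /=.
apply: ler_prod => i _; rewrite exprn_ge0//= !ffunE !mxE /=.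
have := ler_normD (b 0 i) (a * y 0 i); rewrite normrM (ger0_norm a0) => h.
case: ltrP => h2 /=; rewrite ?expr0 ?mul1r ?mulr1.
  rewrite -!exprMn; apply: lerXn2r; rewrite ?nnegrE ?mulr_ge0//.
  by apply: (le_trans h); lra.
rewrite -exprMn; apply: lerXn2r; rewrite ?nnegrE ?mulr_ge0//.
by apply: (le_trans h); lra.
Qed.

Lemma japanese_ge1 (b : 'rV[R]_n) : 1 <= japanese b.
Proof.
rewrite /japanese -[leLHS]sqrtr1 ler_wsqrtr// lerDl sumr_ge0// => i _.
exact: sqr_ge0.
Qed.

Lemma le_mpow_japanese (b : 'rV[R]_n) (d : midx) : `|mpow b d| <= japanese b ^+ mabs d.
Proof.
rewrite norm_mpow /mabs expr_sum; apply: ler_prod => i _; rewrite exprn_ge0//=.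
apply: lerXn2r; rewrite ?nnegrE ?sqrtr_ge0//.
rewrite -sqrtr_sqr /japanese ler_wsqrtr// (bigD1 i)//=.
have : 0 <= \sum_(j < n | j != i) b 0 j ^+ 2 by apply: sumr_ge0 => j _; exact: sqr_ge0.
by lra.
Qed.

Lemma decay_japanese (b : 'rV[R]_n) : 1 <= decay b * japanese b ^+ (2 * n).
Proof.
rewrite /decay prodfV -ler_pdivrMl ?invr_gt0; last first.
  by apply: prodr_gt0 => i _; rewrite (lt_le_trans ltr01)// oneDsqr_ge1.
rewrite invrK mulr1 exprM sqr_sqrtr; last first.
  by rewrite addr_ge0// sumr_ge0// => i _; exact: sqr_ge0.
rewrite -[X in _ ^+ X]card_ord -prodr_const; apply: ler_prod => i _.
rewrite (le_trans ler01 (oneDsqr_ge1 _))/= /oneDsqr lerD2l (bigD1 i)//=.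
by rewrite lerDl sumr_ge0// => j _; exact: sqr_ge0.
Qed.

(** The factor decay y is bought by a monomial of bounded degree: 1 + y_i^2 is at
    most 2 y_i^2 where |y_i| >= 1 and at most 2 elsewhere. *)
Lemma decay_mpow (y : 'rV[R]_n) : exists2 e : midx,
  (mabs e <= 2 * n)%N /\ (mfact e <= 2 ^ n)%N &
  1 <= decay y * (2 ^+ n * `|mpow y e|).
Proof.
exists [ffun i => if 1 <= `|y 0 i| then 2%N else 0%N]; first split.
- rewrite /mabs mulnC -[X in (X * 2)%N]card_ord -sum_nat_const; apply: leq_sum => i _.
  by rewrite ffunE; case: ifP.
- rewrite /mfact -[X in (2 ^ X)%N]card_ord -prod_nat_const; apply: leq_prod => i _.
  by rewrite ffunE; case: ifP.
rewrite norm_mpow -[X in _ ^+ X]card_ord -prodr_const /decay -!big_split /=.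
rewrite [leLHS](_ : 1 = \prod_(i < n) (1 : R)); last by rewrite big1_eq.
apply: ler_prod => i _; rewrite ler01 /= ffunE.
rewrite mulrC ler_pdivlMr ?(lt_le_trans ltr01)// ?oneDsqr_ge1// mul1r /oneDsqr.
case: ifPn => [h|]; last first.
  rewrite -ltNge expr0 mulr1 -(real_normK (num_real (y 0 i))) => h.
  have := exprn_ile1 2%N (normr_ge0 (y 0 i)) (ltW h); lra.
rewrite -(real_normK (num_real (y 0 i))).
have : 1 <= `|y 0 i| ^+ 2 by rewrite exprn_ege1.
by lra.
Qed.

(** The spare factor a^2 pays for 1 / (1 + a^2) when a >= 1; when a <= 1 the left
    hand side is at most a^-p. *)
Lemma le_scale_weight (a : R) (q p : nat) : 0 < a ->
  a ^+ q / a ^+ p <= 2 * (oneDsqr a)^-1 * (a ^+ (q + 2) + 1 / a ^+ p).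
Proof.
move=> a0; have ap : 0 < a ^+ p by rewrite exprn_gt0.
have aq : 0 < a ^+ q by rewrite exprn_gt0.
have o0 : 0 < oneDsqr a by rewrite (lt_le_trans ltr01)// oneDsqr_ge1.
suff H : a ^+ q * oneDsqr a <= 2 * (a ^+ (q + 2) * a ^+ p + 1).
  rewrite ler_pdivrMr// (_ : _ * a ^+ p =
    (oneDsqr a)^-1 * (2 * (a ^+ (q + 2) * a ^+ p + 1))); last first.
    by field; rewrite !lt0r_neq0.
  by rewrite mulrC ler_pdivlMr.
rewrite exprD /oneDsqr mulrDr mulr1.
have [a1|/ltW a1] := lerP 1 a.
  have h1 : 1 <= a ^+ p by rewrite exprn_ege1.
  have h2 : 1 <= a ^+ 2 by rewrite exprn_ege1.
  have h3 : a ^+ q * a ^+ 2 * 1 <= a ^+ q * a ^+ 2 * a ^+ p.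
    by rewrite ler_wpM2l// mulr_ge0 ?exprn_ge0 ?ltW.
  have h4 : a ^+ q * 1 <= a ^+ q * a ^+ 2 by rewrite ler_wpM2l// ltW.
  by lra.
have h1 : a ^+ q <= 1 by rewrite exprn_ile1// ltW.
have h2 : a ^+ q * a ^+ 2 <= 1.
  by rewrite -exprD exprn_ile1// ltW.
have h3 : 0 <= a ^+ q * a ^+ 2 * a ^+ p by rewrite !mulr_ge0 ?exprn_ge0 ?ltW.
by lra.
Qed.


(** Here f stands for the modulus of a derivative of Phi at (b, a), and g for that of
    a derivative of phi at y; P and Q absorb what depends on the derivatives. The
    right hand side carries decay in both b and y so that the same estimate serves
    to integrate in the variables (b, a) and in the variables (y, a). *)
Lemma pointwise_estimate (A t rho2 tau2 : R) : 1 <= A -> 0 <= rho2 -> rho2 <= t ->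
  0 <= tau2 -> exists C B : R, [/\ 0 <= C, 1 <= B &
  forall (a : R) (x b y : 'rV[R]_n) (al : midx) (p : nat) (P Q f g : R),
    0 < a -> x = b + a *: y -> 0 <= f -> 0 <= g -> 0 <= P -> 0 <= Q ->
    (forall c : midx, `|mpow y c| * g <= P * A ^+ mabs c * (mfact c)%:R `^ rho2) ->
    (forall k l1 l2, f * (a ^+ l1 + 1 / a ^+ l2) * japanese b ^+ k <=
       Q * A ^+ (k + l1 + l2) *
       (k`!%:R `^ t * l1`!%:R `^ (t - rho2) * l2`!%:R `^ tau2)) ->
    `|mpow x al| * (f * g / a ^+ p) <=
      C * B ^+ (mabs al + p) * (P * Q) * ((mfact al)%:R `^ t * p`!%:R `^ tau2) *
      ((oneDsqr a)^-1 * decay b * decay y)].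
Proof.
move=> A1 rho0 rhot tau0.
have t0 : 0 <= t by exact: le_trans rhot.
have tr0 : 0 <= t - rho2 by rewrite subr_ge0.
have A0 : 0 <= A by exact: le_trans A1.
have [C1 [B1 [C11 B11 H1]]] := @fact_mabs_shift t (2 * n) t0.
have [C2 [B2 [C21 B21 H2]]] := @fact_mabs_shift (t - rho2) 2 tr0.
have [C3 [B3 [C31 B31 H3]]] := @mfactD_shift rho2 (2 * n + 2 ^ n) rho0.
have [C10 C20 C30] : [/\ 0 <= C1, 0 <= C2 & 0 <= C3] by split; exact: le_trans ler01 _.
have [B10 B20 B30] : [/\ 0 <= B1, 0 <= B2 & 0 <= B3] by split; exact: le_trans ler01 _.
exists (2 ^+ n.+1 * A ^+ (4 * n + 2) * (C1 * C2 * C3)), (2 * A ^+ 2 * (B1 * B2 * B3)).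
split.
- by rewrite !mulr_ge0 ?exprn_ge0.
- by rewrite !mulr_ege1// ?exprn_ege1// ler1n.
move=> a x b y al p P Q f g a0 xE f0 g0 P0 Q0 Hphi HPhi.
have [S HS] := le_mpow_split al (ltW a0) xE.
set gam := mrestrict S al in HS; set del := mrestrict (predC S) al in HS.
have [eps [eabs efact] Heps] := decay_mpow y.
pose W := a ^+ (mabs gam + 2) + 1 / a ^+ p.
pose k := (mabs del + 2 * n)%N.
set D := (oneDsqr a)^-1 * decay b * decay y.
have o0 : 0 <= (oneDsqr a)^-1 by rewrite invr_ge0 (le_trans ler01)// oneDsqr_ge1.
have db0 := ltW (decay_gt0 b); have dy0 := ltW (decay_gt0 y).
have j0 : 0 <= japanese b by exact: le_trans ler01 (japanese_ge1 b).
have D0 : 0 <= D by rewrite !mulr_ge0.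
have W0 : 0 <= W by rewrite addr_ge0 ?divr_ge0 ?exprn_ge0 ?ltW.
(* The factors 1 <= decay b <b>^2n and 1 <= 2^n decay y |y^eps| introduce the
   weights; they raise the exponents of <b> and of y to k and gam + eps. *)
have step1 : `|mpow x al| * (f * g / a ^+ p) <=
  2 ^+ mabs al * 2 ^+ n.+1 * D * ((f * W * japanese b ^+ k) *
    (`|mpow y (madd gam eps)| * g)).
  have MW : a ^+ mabs gam / a ^+ p <= 2 * (oneDsqr a)^-1 * W by exact: le_scale_weight.
  have pb := le_mpow_japanese b del.
  move: HS Heps MW pb; rewrite mpowD normrM /k exprD exprS /D.
  set X := `|mpow x al|; set pb := `|mpow b del|; set pg := `|mpow y gam|.
  set pe := `|mpow y eps|; set M := a ^+ mabs gam; set J1 := _ ^+ mabs del.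
  set J2 := _ ^+ (2 * n); set T := 2 ^+ mabs al; set N := 2 ^+ n.
  set o := (oneDsqr a)^-1; set ip := a ^+ p.
  move=> HX He MW Hpb.
  have M0 : 0 <= M by rewrite exprn_ge0// ltW.
  have ip0 : 0 < ip by rewrite exprn_gt0.
  have T0 : 0 <= T by rewrite exprn_ge0.
  have J10 : 0 <= J1 by rewrite exprn_ge0.
  have J20 : 1 <= decay b * J2 by exact: decay_japanese.
  have pg0 : 0 <= pg by exact: normr_ge0.
  have fgp0 : 0 <= f * g / ip by rewrite !mulr_ge0// invr_ge0 ltW.
  have e1 : X * (f * g / ip) <= T * (J1 * (M * pg)) * (f * g / ip).
    rewrite ler_wpM2r//; apply: (le_trans HX); rewrite ler_wpM2l// ler_wpM2r//.
    by rewrite mulr_ge0.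
  apply: (le_trans e1).
  have Z0 : 0 <= T * J1 * pg * (f * g) by rewrite !mulr_ge0.
  have -> : T * (J1 * (M * pg)) * (f * g / ip) = T * J1 * pg * (f * g) * (M / ip) by ring.
  apply: (le_trans (ler_wpM2l Z0 MW)).
  have Z1 : 0 <= T * J1 * pg * (f * g) * (2 * o * W).
    by rewrite mulr_ge0// mulr_ge0// mulr_ge0.
  apply: (le_trans (ler_peMr Z1 (mulr_ege1 J20 He))).
  rewrite le_eqVlt; apply/orP; left; apply/eqP; ring.
apply: (le_trans step1).
have h1 := HPhi k (mabs gam + 2)%N p; rewrite -/W in h1.
have h2 := Hphi (madd gam eps).
have k1 : k`!%:R `^ t <= C1 * B1 ^+ mabs del * (mfact del)%:R `^ t by exact: H1.
have k2 := H2 gam.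
have k3 : (mfact (madd gam eps))%:R `^ rho2 <= C3 * B3 ^+ mabs gam * (mfact gam)%:R `^ rho2.
  apply: H3; first exact: leq_trans eabs (leq_addr _ _).
  exact: leq_trans efact (leq_addl _ _).
have alE : (mfact al)%:R `^ t = (mfact del)%:R `^ t *
    ((mfact gam)%:R `^ (t - rho2) * (mfact gam)%:R `^ rho2).
  rewrite (mrestrict_fact S al) -/gam -/del natrM powRM// mulrC -powRD ?subrK//.
  by apply/implyP => _; rewrite pnatr_eq0 -lt0n mfact_gt0.
have dg : mabs al = (mabs gam + mabs del)%N by exact: mrestrict_abs.
have h1' : f * W * japanese b ^+ k <= Q * A ^+ (k + (mabs gam + 2) + p) *
  (C1 * B1 ^+ mabs del * (mfact del)%:R `^ t *
   (C2 * B2 ^+ mabs gam * (mfact gam)%:R `^ (t - rho2)) * p`!%:R `^ tau2).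
  apply: (le_trans h1); rewrite ler_wpM2l ?mulr_ge0 ?exprn_ge0//.
  rewrite ler_wpM2r ?powR_ge0//.
  by apply: ler_pM => //; exact: powR_ge0.
have h2' : `|mpow y (madd gam eps)| * g <= P * A ^+ (mabs gam + mabs eps) *
  (C3 * B3 ^+ mabs gam * (mfact gam)%:R `^ rho2).
  apply: (le_trans h2); rewrite mabsD.
  by rewrite ler_wpM2l ?mulr_ge0 ?exprn_ge0.
have T0 : 0 <= 2 ^+ mabs al * 2 ^+ n.+1 * D by rewrite !mulr_ge0 ?exprn_ge0.
apply: (le_trans (ler_wpM2l T0 (ler_pM _ _ h1' h2'))).
- by rewrite !mulr_ge0 ?exprn_ge0.
- by rewrite mulr_ge0.
rewrite alE.
pose N := (mabs al + p)%N.
(* All geometric factors are collected in the base of the power of |al| + p. *)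
have E : 2 ^+ mabs al * (A ^+ (k + (mabs gam + 2) + p) * A ^+ (mabs gam + mabs eps)) *
   (B1 ^+ mabs del * B2 ^+ mabs gam * B3 ^+ mabs gam) <=
   A ^+ (4 * n + 2) * (2 * A ^+ 2 * (B1 * B2 * B3)) ^+ N.
  have -> : A ^+ (4 * n + 2) * (2 * A ^+ 2 * (B1 * B2 * B3)) ^+ N =
      2 ^+ N * A ^+ (4 * n + 2 + 2 * N) * (B1 ^+ N * B2 ^+ N * B3 ^+ N).
    rewrite (exprD A (4 * n + 2) (2 * N)) (exprM A 2 N) !exprMn.
    by ring.
  rewrite -exprD.
  have two1 : 1 <= 2 :> R by rewrite ler1n.
  have n1 : (mabs al <= N)%N by rewrite leq_addr.
  have n2 : (mabs del <= N)%N by rewrite (leq_trans _ n1)// dg leq_addl.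
  have n3 : (mabs gam <= N)%N by rewrite (leq_trans _ n1)// dg leq_addr.
  have n4 : (k + (mabs gam + 2) + p + (mabs gam + mabs eps) <= 4 * n + 2 + 2 * N)%N.
    rewrite /N /k dg; move: (mabs gam) (mabs del) (mabs eps) eabs => u v w.
    by clear; lia.
  have X (q : R) u v : 1 <= q -> (u <= v)%N -> q ^+ u <= q ^+ v.
    by move=> q1 uv; apply: ler_weXn2l.
  apply: ler_pM; [by rewrite mulr_ge0// exprn_ge0|by rewrite !mulr_ge0// exprn_ge0| |].
    by apply: ler_pM; [exact: exprn_ge0|exact: exprn_ge0|exact: X|exact: X].
  apply: ler_pM; [by rewrite mulr_ge0// exprn_ge0|exact: exprn_ge0| |exact: X].
  by apply: ler_pM; [exact: exprn_ge0|exact: exprn_ge0|exact: X|exact: X].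
have R0 : 0 <= 2 ^+ n.+1 * D * (C1 * C2 * C3) * (P * Q) * p`!%:R `^ tau2 *
    ((mfact del)%:R `^ t * ((mfact gam)%:R `^ (t - rho2) * (mfact gam)%:R `^ rho2)).
  by rewrite !mulr_ge0 ?powR_ge0 ?exprn_ge0.
set q1 := (mfact del)%:R `^ t in R0 *; set q2 := (mfact gam)%:R `^ (t - rho2) in R0 *.
set q3 := (mfact gam)%:R `^ rho2 in R0 *; set q4 := p`!%:R `^ tau2 in R0 *.
apply: le_trans (le_trans (ler_wpM2l R0 E) _);
  rewrite le_eqVlt; apply/orP; left; apply/eqP; rewrite -/N; ring.
Qed.

End pointwise.

(** * Chain rules, and Fubini and measurability for complex functions *)

Section chain_rules.
Context {R : realType} {n : nat}.
Local Notation e := (@coord_dir R n).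

Lemma pderiv_affine (f : 'rV[R]_n -> R) (r : R) (c : 'rV[R]_n) w :
  smooth_on e setT f ->
  pderiv e w (fun z => f (r *: (z - c))) =
  (fun z => r ^+ size w * pderiv e w f (r *: (z - c))).
Proof.
move=> sf; elim: w => [|i w IH].
  by apply/funext => x /=; rewrite mul1r.
apply/funext => x; rewrite [LHS]/= IH [size _]/=.
have [_ /(_ i) /derivableP df] := sf w (r *: (x - c)) I.
have := is_deriveZ (r ^+ size w) (is_derive_affine df).
move=> [_ E]; rewrite -[LHS]/('D_(e i) (r ^+ size w \*:
  (fun z => pderiv e w f (r *: (z - c)))) x) E exprSr.
by rewrite -[LHS]/(r ^+ size w * (r * _)) mulrA.
Qed.

Lemma smooth_on_affine (f : 'rV[R]_n -> R) (r : R) (c : 'rV[R]_n) :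
  smooth_on e setT f -> smooth_on e setT (fun z => f (r *: (z - c))).
Proof.
move=> sf w x _; rewrite pderiv_affine//; split.
  have [cw _] := sf w (r *: (x - c)) I.
  have ca : (fun z => r *: (z - c)) @ x --> r *: (x - c).
    apply: (@cvgZl_tmp _ _ _ (nbhs x) _ r (fun z => z - c) (x - c)).
    by apply: (@cvgB _ _ _ (nbhs x) _ id (cst c)); [exact: cvg_id|exact: cvg_cst].
  exact: (@cvgMl_tmp R _ (nbhs x) _ (fun z => pderiv e w f (r *: (z - c)))
    (r ^+ size w) (pderiv e w f (r *: (x - c))) (cvg_comp _ _ ca cw)).
move=> i; have [_ /(_ i) /derivableP df] := sf w (r *: (x - c)) I.
by have [] := is_deriveZ (r ^+ size w) (is_derive_affine df).
Qed.

(** Along e_i the slice z |-> f (z - c, a) runs through the line of direction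
    (e_i, 0). *)
Lemma is_derive_slice (f : 'rV[R]_n * R -> R) (c x : 'rV[R]_n) (a d : R) i :
  is_derive (x - c, a) (half_dir R (Some i)) f d ->
  is_derive x (e i) (fun z => f (z - c, a)) d.
Proof.
move=> fd.
have -> : x = 0 *: e i + x by rewrite scale0r add0r.
apply/(is_derive_line (fun z => f (z - c, a)) x (e i) 0).
have -> : (fun h : R => f (h *: e i + x - c, a)) =
    (fun h : R => f (h *: half_dir R (Some i) + (x - c, a))).
  by apply/funext => h; congr f; congr pair; rewrite /= ?addrA ?scaler0 ?add0r.
apply/(is_derive_line f (x - c, a) (half_dir R (Some i)) 0).
by rewrite scale0r add0r.
Qed.

Lemma pderiv_slice (f : 'rV[R]_n * R -> R) (c : 'rV[R]_n) (a : R) w :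
  smooth_on (@half_dir R n) (@half_space R n) f -> 0 < a ->
  pderiv e w (fun z => f (z - c, a)) =
  (fun z => pderiv (@half_dir R n) (map Some w) f (z - c, a)).
Proof.
move=> sf a0; elim: w => [//|i w IH].
apply/funext => x; rewrite [LHS]/= IH.
have [_ /(_ (Some i)) /derivableP df] := sf (map Some w) (x - c, a) a0.
by have [_ ->] := is_derive_slice df.
Qed.

Lemma smooth_on_slice (f : 'rV[R]_n * R -> R) (c : 'rV[R]_n) (a : R) :
  smooth_on (@half_dir R n) (@half_space R n) f -> 0 < a ->
  smooth_on e setT (fun z => f (z - c, a)).
Proof.
move=> sf a0 w x _; rewrite pderiv_slice//; split; last first.
  move=> i; have [_ /(_ (Some i)) /derivableP df] := sf (map Some w) (x - c, a) a0.
  by have [] := is_derive_slice df.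
have [cw _] := sf (map Some w) (x - c, a) a0.
have ca : (fun z => z - c) @ x --> x - c.
  by apply: (@cvgB _ _ _ (nbhs x) _ id (cst c)); [exact: cvg_id|exact: cvg_cst].
exact: (cvg_comp _ _ (cvg_pair ca (cvg_cst a)) cw).
Qed.

Lemma Cpderiv_affine (f : 'rV[R]_n -> R[i]) (r : R) (c : 'rV[R]_n) w x :
  Csmooth_on e setT f ->
  Cpderiv e w (fun z => f (r *: (z - c))) x =
  (r ^+ size w)%:C%C * Cpderiv e w f (r *: (x - c)).
Proof.
move=> [sf1 sf2]; rewrite /Cpderiv.
rewrite (pderiv_affine r c w sf1) (pderiv_affine r c w sf2).
by rewrite /GRing.mul /= !mul0r subr0 addr0.
Qed.

Lemma Csmooth_on_cst_mul (c : R[i]) (f : 'rV[R]_n -> R[i]) :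
  Csmooth_on e setT f -> Csmooth_on e setT (fun z => c * f z).
Proof.
move=> sf; have -> : (fun z => c * f z) = c *: f + 0.
  by apply/funext => z; rewrite addr0.
exact: (Csmooth_on_lin openT c sf (Csmooth_on0 _ _)).
Qed.

Lemma Cpderiv_cst_mul (c : R[i]) (f : 'rV[R]_n -> R[i]) w x :
  Csmooth_on e setT f -> Cpderiv e w (fun z => c * f z) x = c * Cpderiv e w f x.
Proof.
move=> sf; have -> : (fun z => c * f z) = c *: f + 0.
  by apply/funext => z; rewrite addr0.
rewrite (Cpderiv_lin openT c w sf (Csmooth_on0 _ _) I).
by rewrite Cpderiv0 addr0.
Qed.

Lemma Cpderiv_perm (V : normedModType R) (I : eqType) (d : I -> V) (D : set V)
    (f : V -> R[i]) w w' x : open D -> Csmooth_on d D f -> perm_eq w w' -> D x ->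
  Cpderiv d w f x = Cpderiv d w' f x.
Proof.
move=> oD [s1 s2] ww' Dx; rewrite /Cpderiv.
by rewrite (perm_pderiv oD s1 ww' Dx) (perm_pderiv oD s2 ww' Dx).
Qed.

End chain_rules.

Section complex_fubini.
Context d1 d2 (T1 : measurableType d1) (T2 : measurableType d2) (R : realType).
Variables (m1 : {sigma_finite_measure set T1 -> \bar R}).
Variables (m2 : {sigma_finite_measure set T2 -> \bar R}).
Local Notation Re := complex.Re.
Local Notation Im := complex.Im.
Local Notation m12 := (m1 \x m2)%E.

Let fubini_real1 (f : T1 * T2 -> R) : m12.-integrable setT (EFin \o f) ->
  (forall x, m2.-integrable setT (EFin \o (fun y => f (x, y)))) ->
  m1.-integrable setT (EFin \o (fun x => \int[m2]_y f (x, y))) /\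
  \int[m1]_x \int[m2]_y f (x, y) = \int[m12]_z f z.
Proof.
move=> f12 f2.
have E x : (\int[m2]_y f (x, y))%:E = fubini_F m2 (EFin \o f) x.
  by rewrite /Rintegral fineK//; exact: integrable_fin_num (f2 x).
split.
  have := integrable_fubini_F f12; apply: eq_integrable => // x _.
  by rewrite /= E.
rewrite [RHS]/Rintegral -(integral12_prod_meas1 f12) /Rintegral; congr fine.
by apply: eq_integral => x _; exact: E.
Qed.

Let fubini_real2 (f : T1 * T2 -> R) : m12.-integrable setT (EFin \o f) ->
  (forall y, m1.-integrable setT (EFin \o (fun x => f (x, y)))) ->
  \int[m2]_y \int[m1]_x f (x, y) = \int[m12]_z f z.
Proof.
move=> f12 f1.
have E y : (\int[m1]_x f (x, y))%:E = fubini_G m1 (EFin \o f) y.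
  by rewrite /Rintegral fineK//; exact: integrable_fin_num (f1 y).
rewrite [RHS]/Rintegral -(integral21_prod_meas1 f12) /Rintegral; congr fine.
by apply: eq_integral => x _; exact: E.
Qed.

Lemma Cfubini1 (f : T1 * T2 -> R[i]) : Cintegrable m12 setT f ->
  (forall x, Cintegrable m2 setT (fun y => f (x, y))) ->
  Cintegrable m1 setT (fun x => Cintegral m2 setT (fun y => f (x, y))) /\
  Cintegral m1 setT (fun x => Cintegral m2 setT (fun y => f (x, y))) =
  Cintegral m12 setT f.
Proof.
move=> [f1 f2] fx.
have [i1 e1] := @fubini_real1 (fun z => Re (f z)) f1 (fun x => (fx x).1).
have [i2 e2] := @fubini_real1 (fun z => Im (f z)) f2 (fun x => (fx x).2).
by split; [split|rewrite /Cintegral /= e1 e2].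
Qed.

Lemma Cfubini2 (f : T1 * T2 -> R[i]) : Cintegrable m12 setT f ->
  (forall y, Cintegrable m1 setT (fun x => f (x, y))) ->
  Cintegral m2 setT (fun y => Cintegral m1 setT (fun x => f (x, y))) =
  Cintegral m12 setT f.
Proof.
move=> [f1 f2] fy.
rewrite /Cintegral /=.
rewrite (@fubini_real2 (fun z => Re (f z)) f1 (fun x => (fy x).1)).
by rewrite (@fubini_real2 (fun z => Im (f z)) f2 (fun x => (fy x).2)).
Qed.

End complex_fubini.

Section complex_measurable.
Context d (T : measurableType d) (R : realType).
Implicit Types (D : set T) (f g : T -> R[i]).

Definition Cmeasurable D f : Prop :=
  measurable_fun D (fun x => complex.Re (f x)) /\
  measurable_fun D (fun x => complex.Im (f x)).

Lemma CmeasurableM D f g :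
  Cmeasurable D f -> Cmeasurable D g -> Cmeasurable D (fun x => f x * g x).
Proof.
move=> [f1 f2] [g1 g2]; split.
  have -> : (fun x => complex.Re (f x * g x)) =
     (fun x => complex.Re (f x) * complex.Re (g x) - complex.Im (f x) * complex.Im (g x)).
    by apply/funext => x; case: (f x) (g x) => ? ? [].
  by apply: measurable_funB; apply: measurable_funM.
have -> : (fun x => complex.Im (f x * g x)) =
   (fun x => complex.Re (f x) * complex.Im (g x) + complex.Im (f x) * complex.Re (g x)).
  by apply/funext => x; case: (f x) (g x) => ? ? [].
by apply: measurable_funD; apply: measurable_funM.
Qed.

Lemma Cmeasurable_real D (f : T -> R) :
  measurable_fun D f -> Cmeasurable D (fun x => (f x)%:C%C).
Proof. by move=> mf; split => //=; exact: measurable_cst. Qed.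

Lemma Cmeasurable_extend D f : measurable D -> (forall x, ~ D x -> f x = 0) ->
  Cmeasurable D f -> Cmeasurable setT f.
Proof.
move=> mD f0 [f1 f2]; split.
  have -> : (fun x => complex.Re (f x)) = (fun x => complex.Re (f x)) \_ D.
    apply/funext => x; rewrite patchE; case: ifPn => // /negP xD.
    by rewrite f0//= => Dx; apply: xD; exact: mem_set.
  exact/(measurable_restrictT _ mD).
have -> : (fun x => complex.Im (f x)) = (fun x => complex.Im (f x)) \_ D.
  apply/funext => x; rewrite patchE; case: ifPn => // /negP xD.
  by rewrite f0//= => Dx; apply: xD; exact: mem_set.
exact/(measurable_restrictT _ mD).
Qed.

End complex_measurable.

(** * The two kernels of the transform *)

Section kernels.
Context {R : realType} {n : nat}.
Local Notation mR := (measurableTypeR R).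
Local Notation midx := {ffun 'I_n -> nat}.
Local Notation e := (@coord_dir R n).
Local Notation Y := (mR * n.-tuple mR)%type.
Local Notation rV := (@rV_of_tuple R n).

(** The bound p_h(phi) <= P with A in place of 1 / h, and likewise below: an upper
    bound A >= 1 can be shared by phi and Phi and keeps all powers monotone. *)
Definition GS_bound (rho1 rho2 A P : R) (phi : 'rV[R]_n -> R[i]) : Prop :=
  Csmooth_on e setT phi /\ forall (y : 'rV[R]_n) (c b : midx),
    normc ((mpow y c)%:C%C * Cpderiv e (mword b) phi y) <=
    P * A ^+ (mabs c + mabs b) * ((mfact c)%:R `^ rho2 * (mfact b)%:R `^ rho1).

Definition HS_bound (s t t1 t2 A Q : R) (Phi : 'rV[R]_n * R -> R[i]) : Prop :=
  [/\ Csmooth_on (@half_dir R n) (@half_space R n) Phi,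
    forall z, ~ half_space z -> Phi z = 0 &
    forall z (b : midx) k l1 l2, half_space z ->
    normc (Cpderiv (@half_dir R n) (map Some (mword b)) Phi z) *
      (z.2 ^+ l1 + 1 / z.2 ^+ l2) * japanese z.1 ^+ k <=
    Q * A ^+ (mabs b + k + l1 + l2) *
     ((mfact b)%:R `^ s * k`!%:R `^ t * l1`!%:R `^ t1 * l2`!%:R `^ t2)].

Definition half_decay (z : Y) : R := (oneDsqr z.1)^-1 * decay (rV z.2).

Lemma half_decay_ge0 z : 0 <= half_decay z.
Proof.
by rewrite mulr_ge0 ?(ltW (decay_gt0 _))// invr_ge0 (le_trans ler01)// oneDsqr_ge1.
Qed.

Lemma measurable_half_decay : measurable_fun setT half_decay.
Proof.
apply: measurable_funM.
  apply: (measurableT_comp (f := fun x : mR => (oneDsqr x)^-1)) => //.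
  by apply: continuous_measurable_fun; exact: continuous_oneDsqrV.
exact: (measurableT_comp (@measurable_half_decayay R n)).
Qed.

Lemma integrable_half_decay :
  (@lebesgue_measure R \x lebesgue_tuple n)%E.-integrable setT (EFin \o half_decay).
Proof.
have mdec : measurable_fun setT (EFin \o half_decay).
  by apply/measurable_EFinP; exact: measurable_half_decay.
apply/integrable12ltyP; first exact: mdec.
have /integrableP[m1] := @integrable_decay R n.+1.
rewrite ge0_integral_tuple_cons; last 2 first.
  exact: (measurableT_comp (@abse_measurable _ setT) m1).
  by move=> u; exact: abse_ge0.
apply: le_lt_trans; rewrite le_eqVlt; apply/orP; left; apply/eqP.
apply: eq_integral => a _; apply: eq_integral => u _; congr (`|_%:E|)%E.
rewrite /half_decay /decay big_ord_recl; congr (_ * _); first by rewrite mxE tnth0.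
by apply: eq_bigr => i _; rewrite !mxE tnthS.
Qed.

Variables (phi : 'rV[R]_n -> R[i]) (Phi : 'rV[R]_n * R -> R[i]).

(** The integrand in the variables (a, b), in which x-derivatives fall on phi. As Phi
    vanishes outside of the half-space, a can range over all of R. *)
Definition wavelet_kernel (x : 'rV[R]_n) (z : Y) : R[i] :=
  synthesis_kernel phi Phi x z.1 (rV z.2) * (z.1^-1)%:C%C.

(** The integrand in the variables (a, y) with b = x - a y, in which x-derivatives
    fall on Phi. *)
Definition data_kernel (x : 'rV[R]_n) (z : Y) : R[i] :=
  Phi (x - z.1 *: rV z.2, z.1) * (z.1^-1)%:C%C * phi (rV z.2).

Section smooth.
Hypothesis sphi : Csmooth_on e setT phi.
Hypothesis sPhi : Csmooth_on (@half_dir R n) (@half_space R n) Phi.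
Hypothesis Phi0 : forall z, ~ half_space z -> Phi z = 0.

Lemma wavelet_kernel_le0 x z : z.1 <= 0 -> wavelet_kernel x z = 0.
Proof.
move=> a0; rewrite /wavelet_kernel /synthesis_kernel Phi0 ?mul0r//.
by rewrite /half_space /= => /lt_le_trans /(_ a0); rewrite ltxx.
Qed.

Lemma data_kernel_le0 x z : z.1 <= 0 -> data_kernel x z = 0.
Proof.
move=> a0; rewrite /data_kernel Phi0 ?mul0r//.
by rewrite /half_space /= => /lt_le_trans /(_ a0); rewrite ltxx.
Qed.

Let wavelet_kernelE z : wavelet_kernel ^~ z = fun x => (Phi (rV z.2, z.1) * (1 / z.1 ^+ n)%:C%C *
   (z.1^-1)%:C%C) * phi (z.1^-1 *: (x - rV z.2)).
Proof.
apply/funext => x; rewrite /wavelet_kernel /synthesis_kernel.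
by rewrite -!mulrA (mulrC (phi _)).
Qed.

Let data_kernelE z : data_kernel ^~ z = fun x => ((z.1^-1)%:C%C * phi (rV z.2)) *
  Phi (x - z.1 *: rV z.2, z.1).
Proof. by apply/funext => x; rewrite /data_kernel -!mulrA mulrC -!mulrA. Qed.

Lemma Csmooth_on_slice c a : 0 < a -> Csmooth_on e setT (fun x => Phi (x - c, a)).
Proof.
move=> a0; have [s1 s2] := sPhi.
by split; [exact: (smooth_on_slice _ s1)|exact: (smooth_on_slice _ s2)].
Qed.

Let Csmooth_on_zero (K : 'rV[R]_n -> R[i]) : (forall x, K x = 0) ->
  Csmooth_on e setT K.
Proof. by move=> /funext ->; exact: Csmooth_on0. Qed.

Lemma wavelet_kernel_smooth z : Csmooth_on e setT (wavelet_kernel ^~ z).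
Proof.
have [a0|a0] := lerP z.1 0.
  by apply: Csmooth_on_zero => x; exact: wavelet_kernel_le0.
rewrite wavelet_kernelE; apply: Csmooth_on_cst_mul; have [s1 s2] := sphi.
by split; [exact: (smooth_on_affine _ _ s1)|exact: (smooth_on_affine _ _ s2)].
Qed.

Lemma data_kernel_smooth z : Csmooth_on e setT (data_kernel ^~ z).
Proof.
have [a0|a0] := lerP z.1 0.
  by apply: Csmooth_on_zero => x; exact: data_kernel_le0.
by rewrite data_kernelE; apply: Csmooth_on_cst_mul; exact: Csmooth_on_slice.
Qed.

Lemma normc_Cpderiv_wavelet_kernel w x z : 0 < z.1 ->
  normc (Cpderiv e w (wavelet_kernel ^~ z) x) =
  normc (Phi (rV z.2, z.1)) * normc (Cpderiv e w phi (z.1^-1 *: (x - rV z.2))) /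
  z.1 ^+ (n + 1 + size w).
Proof.
move=> a0; rewrite wavelet_kernelE.
have [s1 s2] := sphi.
rewrite Cpderiv_cst_mul; last first.
  by split; [exact: (smooth_on_affine _ _ s1)|exact: (smooth_on_affine _ _ s2)].
rewrite Cpderiv_affine// !normcM !normc_real.
rewrite !ger0_norm ?divr_ge0 ?invr_ge0 ?exprn_ge0 ?invr_ge0 ?(ltW a0)//.
set u := normc _; set v := normc _.
rewrite !exprD expr1 exprVn; field.
by rewrite ?expf_neq0 lt0r_neq0.
Qed.

Lemma normc_Cpderiv_data_kernel w x z : 0 < z.1 ->
  normc (Cpderiv e w (data_kernel ^~ z) x) =
  normc (Cpderiv (@half_dir R n) (map Some w) Phi (x - z.1 *: rV z.2, z.1)) *
  normc (phi (rV z.2)) / z.1 ^+ 1.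
Proof.
move=> a0; rewrite data_kernelE Cpderiv_cst_mul; last exact: Csmooth_on_slice.
have [s1 s2] := sPhi.
rewrite [X in normc (_ * X)](_ : _ =
  Cpderiv (@half_dir R n) (map Some w) Phi (x - z.1 *: rV z.2, z.1)); last first.
  by rewrite /Cpderiv (pderiv_slice _ w s1 a0) (pderiv_slice _ w s2 a0).
rewrite !normcM normc_real ger0_norm ?invr_ge0 ?(ltW a0)// expr1.
by rewrite mulrC mulrA mulrAC.
Qed.

End smooth.

End kernels.

Section kernel_bounds.
Context {R : realType} {n : nat}.
Local Notation mR := (measurableTypeR R).
Local Notation midx := {ffun 'I_n -> nat}.
Local Notation e := (@coord_dir R n).
Local Notation rV := (@rV_of_tuple R n).

Lemma mabs_word_mindex (w : seq 'I_n) : mabs (word_mindex w) = size w.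
Proof. by rewrite -size_mword (perm_size (perm_mword w)). Qed.

Let Cpderiv_mword (phi : 'rV[R]_n -> R[i]) w x : Csmooth_on e setT phi ->
  Cpderiv e w phi x = Cpderiv e (mword (word_mindex w)) phi x.
Proof. by move=> sphi; apply: (Cpderiv_perm openT sphi (perm_mword w)). Qed.

(** The pointwise estimate with p = n + 1 + |w|: the factor a^-n of the transform,
    the density 1 / a and the factor a^-1 of each derivative of the dilated
    phi. The factorial of p differs from |w|! by a geometric factor. *)
Lemma wavelet_kernel_bound (rho1 rho2 s t tau A : R) : 1 <= A -> 0 <= rho2 ->
  rho2 <= t -> 0 <= tau -> exists C B : R, [/\ 0 <= C, 1 <= B &
  forall phi Phi P Q, 0 <= P -> 0 <= Q -> GS_bound (n := n) rho1 rho2 A P phi ->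
  HS_bound s t (t - rho2) tau A Q Phi -> forall al w x z,
  normc ((mpow x al)%:C%C * Cpderiv e w (wavelet_kernel phi Phi ^~ z) x) <=
  C * B ^+ (mabs al + size w) * (P * Q) *
  ((mfact al)%:R `^ t * ((mfact (word_mindex w))%:R `^ rho1 *
    (mfact (word_mindex w))%:R `^ tau)) * half_decay z].
Proof.
move=> A1 r0 rt tau0.
have [C [B [C0 B1 H]]] := @pointwise_estimate R n A t rho2 tau A1 r0 rt tau0.
have [C' [B' [C'1 B'1 H']]] := @fact_mabs_shift R n tau (n + 1) tau0.
have A0 : 0 <= A by exact: le_trans A1.
have B0 : 0 <= B by exact: le_trans B1.
have C'0 : 0 <= C' by exact: le_trans C'1.
have B'0 : 0 <= B' by exact: le_trans B'1.
exists (C * B ^+ (n + 1) * C'), (B * (A * B')); split.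
- by rewrite !mulr_ge0// exprn_ge0.
- by rewrite !mulr_ege1.
move=> phi Phi P Q P0 Q0 [sphi bphi] [sPhi Phi0 bPhi] al w x z.
set b := word_mindex w.
have R0 : 0 <= C * B ^+ (n + 1) * C' * (B * (A * B')) ^+ (mabs al + size w) * (P * Q) *
  ((mfact al)%:R `^ t * ((mfact b)%:R `^ rho1 * (mfact b)%:R `^ tau)) * half_decay z.
  have := half_decay_ge0 z; move: (half_decay z) => dz dz0.
  by rewrite !mulr_ge0 ?exprn_ge0 ?powR_ge0 ?mulr_ge0.
have [a0|a0] := lerP z.1 0.
  rewrite [X in Cpderiv _ _ X](_ : _ = 0 :> ('rV[R]_n -> R[i])); last first.
    by apply/funext => y; exact: wavelet_kernel_le0.
  by rewrite Cpderiv0 mulr0 normc0.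
rewrite normcM normc_real normc_Cpderiv_wavelet_kernel//.
set y := z.1^-1 *: (x - rV z.2).
have xE : x = rV z.2 + z.1 *: y.
  by rewrite /y scalerA mulfV ?lt0r_neq0// scale1r addrC subrK.
have PA0 : 0 <= P * A ^+ size w * (mfact b)%:R `^ rho1.
  by rewrite !mulr_ge0 ?exprn_ge0 ?powR_ge0.
have E1 := H z.1 x (rV z.2) y al (n + 1 + size w)%N
  (P * A ^+ size w * (mfact b)%:R `^ rho1) Q
  (normc (Phi (rV z.2, z.1))) (normc (Cpderiv e w phi y)) a0 xE
  (normc_ge0 _) (normc_ge0 _) PA0 Q0.
apply: le_trans (E1 _ _) _ => {E1}.
- move=> c; have := bphi y c b; rewrite normcM normc_real -Cpderiv_mword//.
  move=> h; apply: (le_trans h); rewrite -(mabs_word_mindex w) -/b exprD.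
  rewrite le_eqVlt; apply/orP; left; apply/eqP; ring.
- move=> k l1 l2; have := bPhi (rV z.2, z.1) [ffun=> 0%N] k l1 l2 a0.
  have -> : mword ([ffun=> 0%N] : midx) = [::].
    by apply/nilP; rewrite /nilp size_mword /mabs big1// => i _; rewrite ffunE.
  have -> : mabs ([ffun=> 0%N] : midx) = 0%N.
    by rewrite /mabs big1// => i _; rewrite ffunE.
  have -> : mfact ([ffun=> 0%N] : midx) = 1%N.
    by rewrite /mfact big1// => i _; rewrite ffunE.
  rewrite powR1 !mul1r add0n /Cpderiv /=.
  by case: (Phi _).
have h2 := H' b; rewrite mabs_word_mindex in h2.
set F1 := (mfact al)%:R `^ t; set F2 := (mfact b)%:R `^ rho1.
set F3 := (mfact b)%:R `^ tau in h2 *.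
rewrite (addnC _ (size w)).
set F4 := (size w + (n + 1))`!%:R `^ tau in h2 *.
have F10 : 0 <= F1 by exact: powR_ge0.
have F20 : 0 <= F2 by exact: powR_ge0.
have F30 : 0 <= F3 by exact: powR_ge0.
have d1 : (oneDsqr z.1)^-1 * decay (rV z.2) * decay y <= half_decay z.
  rewrite -[leRHS]mulr1 ler_wpM2l ?decay_le1// ?half_decay_ge0//.
have d0 : 0 <= (oneDsqr z.1)^-1 * decay (rV z.2) * decay y.
  by rewrite mulr_ge0// ?(ltW (decay_gt0 _))// -/(half_decay z) half_decay_ge0.
have G0 : 0 <= C * B ^+ (mabs al + (size w + (n + 1))) *
    (P * A ^+ size w * F2 * Q) * F1.
  by rewrite !mulr_ge0 ?exprn_ge0.
rewrite (mulrA _ F1 F4).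
apply: (@le_trans _ _ (C * B ^+ (mabs al + (size w + (n + 1))) *
    (P * A ^+ size w * F2 * Q) * F1 * (C' * B' ^+ size w * F3) * half_decay z)).
  apply: ler_pM => //; first by rewrite mulr_ge0// powR_ge0.
  by rewrite ler_wpM2l.
rewrite addnA (exprD B _ (n + 1)) !exprMn !(exprD A) !(exprD B').
have Aal : 1 <= A ^+ mabs al by rewrite exprn_ege1.
have Bal : 1 <= B' ^+ mabs al by rewrite exprn_ege1.
have Z0 : 0 <= C * B ^+ (n + 1) * B ^+ (mabs al + size w) *
    (P * Q) * A ^+ size w * C' * B' ^+ size w * (F1 * (F2 * F3)) * half_decay z.
  have := half_decay_ge0 z; move: (half_decay z) => dz dz0.
  by rewrite !mulr_ge0 ?exprn_ge0.
apply: le_trans (le_trans (ler_peMr Z0 (mulr_ege1 Aal Bal)) _);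
  rewrite le_eqVlt; apply/orP; left; apply/eqP; ring.
Qed.

(** The pointwise estimate with p = 1, from the density 1 / a alone. *)
Lemma data_kernel_bound (rho1 rho2 s t tau A : R) : 1 <= A -> 0 <= rho2 ->
  rho2 <= t -> 0 <= tau -> exists C B : R, [/\ 0 <= C, 1 <= B &
  forall phi Phi P Q, 0 <= P -> 0 <= Q -> GS_bound (n := n) rho1 rho2 A P phi ->
  HS_bound s t (t - rho2) tau A Q Phi -> forall al w x z,
  normc ((mpow x al)%:C%C * Cpderiv e w (data_kernel phi Phi ^~ z) x) <=
  C * B ^+ (mabs al + size w) * (P * Q) *
  ((mfact al)%:R `^ t * (mfact (word_mindex w))%:R `^ s) * half_decay z].
Proof.
move=> A1 r0 rt tau0.
have [C [B [C0 B1 H]]] := @pointwise_estimate R n A t rho2 tau A1 r0 rt tau0.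
have A0 : 0 <= A by exact: le_trans A1.
have B0 : 0 <= B by exact: le_trans B1.
exists (C * B), (B * A); split.
- by rewrite !mulr_ge0.
- by rewrite !mulr_ege1.
move=> phi Phi P Q P0 Q0 [sphi bphi] [sPhi Phi0 bPhi] al w x z.
set b := word_mindex w.
have R0 : 0 <= C * B * (B * A) ^+ (mabs al + size w) * (P * Q) *
  ((mfact al)%:R `^ t * (mfact b)%:R `^ s) * half_decay z.
  have := half_decay_ge0 z; move: (half_decay z) => dz dz0.
  by rewrite !mulr_ge0 ?exprn_ge0 ?powR_ge0 ?mulr_ge0.
have [a0|a0] := lerP z.1 0.
  rewrite [X in Cpderiv _ _ X](_ : _ = 0 :> ('rV[R]_n -> R[i])); last first.
    by apply/funext => y; exact: data_kernel_le0.
  by rewrite Cpderiv0 mulr0 normc0.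
rewrite normcM normc_real normc_Cpderiv_data_kernel//.
set bb := x - z.1 *: rV z.2.
have xE : x = bb + z.1 *: rV z.2 by rewrite /bb subrK.
have QA0 : 0 <= Q * A ^+ size w * (mfact b)%:R `^ s.
  by rewrite !mulr_ge0 ?exprn_ge0 ?powR_ge0.
have E1 := H z.1 x bb (rV z.2) al 1%N P (Q * A ^+ size w * (mfact b)%:R `^ s)
  (normc (Cpderiv (@half_dir R n) (map Some w) Phi (bb, z.1))) (normc (phi (rV z.2)))
  a0 xE (normc_ge0 _) (normc_ge0 _) P0 QA0.
apply: le_trans (E1 _ _) _ => {E1}.
- move=> c; have := bphi (rV z.2) c [ffun=> 0%N]; rewrite normcM normc_real.
  have -> : mword ([ffun=> 0%N] : midx) = [::].
    by apply/nilP; rewrite /nilp size_mword /mabs big1// => i _; rewrite ffunE.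
  have -> : mabs ([ffun=> 0%N] : midx) = 0%N.
    by rewrite /mabs big1// => i _; rewrite ffunE.
  have -> : mfact ([ffun=> 0%N] : midx) = 1%N.
    by rewrite /mfact big1// => i _; rewrite ffunE.
  rewrite powR1 mulr1 addn0 /Cpderiv /=.
  by case: (phi _).
- move=> k l1 l2; have := bPhi (bb, z.1) b k l1 l2 a0.
  have pe : perm_eq (map Some w) (map Some (mword b)).
    by apply: perm_map; exact: perm_mword.
  rewrite -(Cpderiv_perm (@open_half_space R n) sPhi pe) => [h|]; last exact: a0.
  apply: (le_trans h); rewrite -(mabs_word_mindex w) -/b -!addnA exprD.
  rewrite le_eqVlt; apply/orP; left; apply/eqP; ring.
rewrite (_ : 1`! = 1%N)// powR1 mulr1.
set F1 := (mfact al)%:R `^ t; set F2 := (mfact b)%:R `^ s.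
have F10 : 0 <= F1 by exact: powR_ge0.
have F20 : 0 <= F2 by exact: powR_ge0.
have d1 : (oneDsqr z.1)^-1 * decay bb * decay (rV z.2) <= half_decay z.
  rewrite /half_decay -mulrA ler_wpM2l ?invr_ge0 ?(le_trans ler01) ?oneDsqr_ge1//.
  by rewrite ler_piMl ?decay_le1 ?(ltW (decay_gt0 _)).
have G0 : 0 <= C * B ^+ (mabs al + 1) * (P * (Q * A ^+ size w * F2)) * F1.
  by rewrite !mulr_ge0 ?exprn_ge0.
apply: (le_trans (ler_wpM2l G0 d1)).
rewrite !exprMn !(exprD A) !(exprD B) expr1.
have Aal : 1 <= A ^+ mabs al by rewrite exprn_ege1.
have Bw : 1 <= B ^+ size w by rewrite exprn_ege1.
have Z0 : 0 <= C * (B ^+ mabs al * B) * (P * (Q * A ^+ size w * F2)) * F1 * half_decay z.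
  have := half_decay_ge0 z; move: (half_decay z) => dz dz0.
  by rewrite !mulr_ge0 ?exprn_ge0.
apply: le_trans (le_trans (ler_peMr Z0 (mulr_ege1 Aal Bw)) _);
  rewrite le_eqVlt; apply/orP; left; apply/eqP; ring.
Qed.

End kernel_bounds.

Section kernel_measurability.
Context {R : realType} {n : nat}.
Local Notation mR := (measurableTypeR R).
Local Notation e := (@coord_dir R n).
Local Notation rV := (@rV_of_tuple R n).
Context d (T : measurableType d).
Variables (X U : T -> 'rV[R]_n) (a : T -> R).
Hypothesis mX : forall i, measurable_fun setT (fun q => X q 0 i).
Hypothesis mU : forall i, measurable_fun setT (fun q => U q 0 i).
Hypothesis ma : measurable_fun setT a.
Variables (phi : 'rV[R]_n -> R[i]) (Phi : 'rV[R]_n * R -> R[i]).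
Hypothesis sphi : Csmooth_on e setT phi.
Hypothesis sPhi : Csmooth_on (@half_dir R n) (@half_space R n) Phi.

Let D : set T := [set q | 0 < a q].

Let mD : measurable D.
Proof.
have -> : D = setT `&` a @^-1` `]0, +oo[%classic.
  by apply/seteqP; split=> q /=; rewrite in_itv/= andbT // => -[].
exact: ma.
Qed.

Let maD : measurable_fun D a.
Proof. exact: measurable_funTS. Qed.

Lemma Cmeasurable_phi (V : T -> 'rV[R]_n) :
  (forall i, measurable_fun D (fun q => V q 0 i)) -> Cmeasurable D (fun q => phi (V q)).
Proof.
move=> mV; have [s1 s2] := sphi.
have H (f : 'rV[R]_n -> R) : smooth_on e setT f -> measurable_fun D (fun q => f (V q)).
  move=> sf.
  apply: (@measurable_comp_continuous _ T R n D V a mD mV maD (fun z => f z.1)) => q _.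
  have [cf _] := sf [::] (V q) I.
  exact: (cvg_comp fst f (@cvg_fst _ _ (nbhs (V q)) (nbhs (a q)) _) cf).
by split; [exact: (H _ s1)|exact: (H _ s2)].
Qed.

Lemma Cmeasurable_Phi (V : T -> 'rV[R]_n) :
  (forall i, measurable_fun D (fun q => V q 0 i)) -> Cmeasurable D (fun q => Phi (V q, a q)).
Proof.
move=> mV; have [s1 s2] := sPhi.
have H (f : 'rV[R]_n * R -> R) : smooth_on (@half_dir R n) (@half_space R n) f ->
    measurable_fun D (fun q => f (V q, a q)).
  move=> sf.
  apply: (@measurable_comp_continuous _ T R n D V a mD mV maD f) => q Dq.
  by have [cf _] := sf [::] (V q, a q) Dq.
by split; [exact: (H _ s1)|exact: (H _ s2)].
Qed.

Let mVinv : measurable_fun D (fun q => (a q)^-1).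
Proof.
apply: (@measurable_comp_continuous _ T R n D (fun=> 0) a mD _ maD
  (fun z => z.2^-1)) => [i|q Dq].
  by rewrite mxE; exact: measurable_cst.
have cV : {for a q, continuous (fun x : R => x^-1)}.
  by apply: cvgV; [rewrite lt0r_neq0|exact: cvg_id].
exact: (cvg_comp snd _ (@cvg_snd _ _ (nbhs (0 : 'rV[R]_n)) (nbhs (a q)) _) cV).
Qed.

Lemma Cmeasurable_wavelet_kernel : (forall z, ~ half_space z -> Phi z = 0) ->
  Cmeasurable setT (fun q => Phi (U q, a q) * (1 / a q ^+ n)%:C%C *
     phi ((a q)^-1 *: (X q - U q)) * ((a q)^-1)%:C%C).
Proof.
move=> Phi0; apply: (Cmeasurable_extend mD).
  by move=> q Dq; rewrite Phi0 ?mul0r.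
have mUD i : measurable_fun D (fun q => U q 0 i) by exact: measurable_funTS.
have mXD i : measurable_fun D (fun q => X q 0 i) by exact: measurable_funTS.
apply: CmeasurableM; last exact: Cmeasurable_real.
apply: CmeasurableM; [apply: CmeasurableM|].
- exact: Cmeasurable_Phi.
- apply: Cmeasurable_real.
  under eq_fun do rewrite div1r -exprVn.
  exact: measurable_funX.
apply: Cmeasurable_phi => i; under eq_fun do rewrite !mxE.
by apply: measurable_funM => //; apply: measurable_funB.
Qed.

Lemma Cmeasurable_data_kernel : (forall z, ~ half_space z -> Phi z = 0) ->
  Cmeasurable setT (fun q => Phi (X q - a q *: U q, a q) * ((a q)^-1)%:C%C *
     phi (U q)).
Proof.
move=> Phi0; apply: (Cmeasurable_extend mD).
  by move=> q Dq; rewrite Phi0 ?mul0r.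
have mUD i : measurable_fun D (fun q => U q 0 i) by exact: measurable_funTS.
have mXD i : measurable_fun D (fun q => X q 0 i) by exact: measurable_funTS.
apply: CmeasurableM; last exact: Cmeasurable_phi.
apply: CmeasurableM; last exact: Cmeasurable_real.
apply: Cmeasurable_Phi => i; under eq_fun do rewrite !mxE.
by apply: measurable_funB => //; apply: measurable_funM.
Qed.

End kernel_measurability.

(** * The synthesis integral *)

Section product_sigma_finite.
Context d1 d2 (T1 : measurableType d1) (T2 : measurableType d2) (R : realType).
Variables (m1 : {sigma_finite_measure set T1 -> \bar R}).
Variables (m2 : {sigma_finite_measure set T2 -> \bar R}).

Lemma sigma_finite_product : sigma_finite setT (m1 \x m2)%E.
Proof.
have /sigma_finiteP[F [TF ndF Foo]] := sigma_finiteT m1.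
have /sigma_finiteP[G [TG ndG Goo]] := sigma_finiteT m2.
exists (fun k => F k `*` G k) => [|k].
  apply/esym; rewrite -subTset => -[x y] _.
  have [i _ Fi] : (\bigcup_k F k) x by rewrite -TF.
  have [j _ Gj] : (\bigcup_k G k) y by rewrite -TG.
  exists (maxn i j) => //; split.
    by move: Fi; apply/subsetPset/ndF/leq_maxl.
  by move: Gj; apply/subsetPset/ndG/leq_maxr.
have [[mF Fk] [mG Gk]] := (Foo k, Goo k); split; first exact: measurableX.
by rewrite product_measure1E// lte_mul_pinfty// ge0_fin_numE.
Qed.

(** Packaged by hand so that a product measure can itself be a factor of a
    product. *)
Definition sigma_finite_prod : {sigma_finite_measure set (T1 * T2)%type -> \bar R} :=
  HB.pack (m1 \x m2)%E (Measure_isSigmaFinite.Build _ _ _ (m1 \x m2)%E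
    sigma_finite_product).

End product_sigma_finite.

Section integral_tools.
Context {R : realType}.

Lemma integrable_prod_mul d1 d2 (T1 : measurableType d1) (T2 : measurableType d2)
  (m1 : {sigma_finite_measure set T1 -> \bar R})
  (m2 : {sigma_finite_measure set T2 -> \bar R}) (f : T1 -> R) (g : T2 -> R) :
  m1.-integrable setT (EFin \o f) -> m2.-integrable setT (EFin \o g) ->
  (m1 \x m2)%E.-integrable setT (EFin \o (fun z => f z.1 * g z.2)).
Proof.
move=> fi gi.
have /integrableP[/measurable_EFinP mf foo] := fi.
have /integrableP[/measurable_EFinP mg goo] := gi.
have mfg : measurable_fun setT (EFin \o (fun z : T1 * T2 => f z.1 * g z.2)).
  apply/measurable_EFinP; apply: measurable_funM.
    exact: (measurableT_comp mf measurable_fst).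
  exact: (measurableT_comp mg measurable_snd).
apply/integrable12ltyP; first exact: mfg.
set J := (\int[m2]_y `|(g y)%:E|)%E in goo.
have J0 : (0 <= J)%E by exact: integral_ge0.
have Jfin : J \is a fin_num by rewrite ge0_fin_numE.
rewrite (eq_integral (fun x => J * `|(f x)%:E|)%E); last first.
  move=> x _; rewrite muleC -ge0_integralZl//; last first.
    by apply: measurableT_comp => //; exact/measurable_EFinP.
  by apply: eq_integral => y _; rewrite /= normrM EFinM.
rewrite ge0_integralZl//; last first.
  by apply: measurableT_comp => //; exact/measurable_EFinP.
by rewrite -(fineK Jfin) lte_mul_pinfty// lee_fin fine_ge0.
Qed.

Context d (T : measurableType d) (mu : {measure set T -> \bar R}).
Implicit Types (f : T -> R[i]) (c : R[i]).

Lemma Cintegrable_scale c f :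
  Cintegrable mu setT f -> Cintegrable mu setT (fun x => c * f x).
Proof.
move=> fi; have := Cintegrable_lin measurableT c fi (Cintegrable0 mu setT).
by under eq_fun do rewrite addr0.
Qed.

Lemma Cintegral_scale c f : Cintegrable mu setT f ->
  Cintegral mu setT (fun x => c * f x) = c * Cintegral mu setT f.
Proof.
move=> fi; have := Cintegral_lin measurableT c fi (Cintegrable0 mu setT).
by rewrite Cintegral0 addr0 => <-; congr Cintegral; apply/funext => x; rewrite addr0.
Qed.

(** Moves between integrals over a > 0 and over all a. *)
Lemma Cintegrable_restrict (D : set T) f : measurable D ->
  (forall x, ~ D x -> f x = 0) -> Cintegrable mu setT f ->
  Cintegrable mu D f /\ Cintegral mu D f = Cintegral mu setT f.
Proof.
move=> mD f0 [f1 f2]; split.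
  by split; [exact: (integrableS measurableT mD _ f1)|
             exact: (integrableS measurableT mD _ f2)].
rewrite /Cintegral; congr Complex; rewrite Rintegral_mkcond;
  apply: eq_Rintegral => x _; rewrite patchE; case: ifPn => // /negP xD;
  by rewrite f0// => Dx; apply: xD; exact: mem_set.
Qed.

End integral_tools.

Section moments.
Context {R : realType} {n : nat}.
Local Notation midx := {ffun 'I_n -> nat}.
Implicit Types f : 'rV[R]_n -> R[i].

Let zm_lin (c : R[i]) f g : zero_moments f -> zero_moments g ->
  zero_moments (fun y => c * f y + g y).
Proof. exact: (@zero_moments_lin R n c f g). Qed.

Let zm_coord f i : zero_moments f -> zero_moments (fun y => (y 0 i)%:C%C * f y).
Proof.
move=> zf al; have := zf (madd al [ffun j => (j == i) : nat]).
have -> : (fun x : 'rV[R]_n => (mpow x (madd al [ffun j => (j == i) : nat]))%:C%C * f x) =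
  (fun x => (mpow x al)%:C%C * ((x 0 i)%:C%C * f x)).
  apply/funext => x; rewrite mpowD rmorphM -mulrA; congr (_ * (_ * _)).
  congr (_%:C)%C; rewrite /mpow (bigD1 i)//= ffunE eqxx expr1 big1 ?mulr1// => j ji.
  by rewrite ffunE (negbTE ji).
by [].
Qed.

(** Vanishing moments are stable under linear combinations and multiplication by a
    coordinate, hence under multiplication by any polynomial; factors are
    multiplied in one at a time. *)
Lemma zero_moments_affine_mpow f (b : 'rV[R]_n) (a : R) (al : midx) :
  zero_moments f -> zero_moments (fun y => (mpow (b + a *: y) al)%:C%C * f y).
Proof.
have step g i : zero_moments g ->
    zero_moments (fun y => ((b + a *: y) 0 i)%:C%C * g y).
  move=> zg; have z0 : zero_moments (0 : 'rV[R]_n -> R[i]) by exact: zero_moments0.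
  have := zm_lin a%:C%C (zm_coord i zg) (zm_lin (b 0 i)%:C%C zg z0).
  congr zero_moments; apply/funext => y.
  by rewrite addr0 !mxE rmorphD rmorphM mulrDl mulrA addrC.
have steps g i k : zero_moments g ->
    zero_moments (fun y => ((b + a *: y) 0 i ^+ k)%:C%C * g y).
  move=> zg; elim: k => [|k IH].
    by move: zg; congr zero_moments; apply/funext => y; rewrite expr0 mul1r.
  have := step _ i IH; congr zero_moments; apply/funext => y.
  by rewrite exprS rmorphM mulrA.
move=> zf; rewrite /mpow.
suff H (s : seq 'I_n) :
    zero_moments (fun y => (\prod_(i <- s) (b + a *: y) 0 i ^+ al i)%:C%C * f y).
  by have := H (index_enum _).
elim: s => [|i s IH].
  by move: zf; congr zero_moments; apply/funext => y; rewrite big_nil mul1r.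
have := steps _ i (al i) IH; congr zero_moments; apply/funext => y.
by rewrite big_cons rmorphM mulrA.
Qed.

Lemma zero_moments_integral f : zero_moments f ->
  Rn_integrable f /\ Rn_integral f = 0.
Proof.
move=> /(_ [ffun=> 0%N]).
have -> : (fun x : 'rV[R]_n => (mpow x [ffun=> 0%N])%:C%C * f x) = f.
  apply/funext => x; rewrite /mpow big1 ?mul1r// => i _.
  by rewrite ffunE expr0.
by [].
Qed.

End moments.

Section synthesis_theory.
Context {R : realType} {n : nat}.
Local Notation mR := (measurableTypeR R).
Local Notation midx := {ffun 'I_n -> nat}.
Local Notation e := (@coord_dir R n).
Local Notation rV := (@rV_of_tuple R n).
Local Notation Y := (mR * n.-tuple mR)%type.
Local Notation leb := (@lebesgue_measure R).
Local Notation lebn := (@lebesgue_tuple R n).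
Local Notation mu := (leb \x lebn)%E.
Variables (rho1 rho2 s t tau A : R).
Hypotheses (A1 : 1 <= A) (rho2_ge0 : 0 <= rho2) (rho2_t : rho2 <= t) (tau_ge0 : 0 <= tau).

Lemma measurable_rV (i : 'I_n) : measurable_fun setT (fun u => rV u 0 i).
Proof. by under eq_fun do rewrite mxE; exact: measurable_tnth. Qed.

Section fixed_pair.
Variables (phi : 'rV[R]_n -> R[i]) (Phi : 'rV[R]_n * R -> R[i]) (P Q : R).
Hypotheses (P0 : 0 <= P) (Q0 : 0 <= Q).
Hypothesis bphi : GS_bound rho1 rho2 A P phi.
Hypothesis bPhi : HS_bound s t (t - rho2) tau A Q Phi.

Let sphi : Csmooth_on e setT phi. Proof. by case: bphi. Qed.
Let sPhi : Csmooth_on (@half_dir R n) (@half_space R n) Phi.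
Proof. by case: bPhi. Qed.
Let Phi0 z : ~ half_space z -> Phi z = 0.
Proof. by case: bPhi => _ /(_ z). Qed.

Lemma wavelet_kernel_dominated al w : exists C, forall x z,
  normc ((mpow x al)%:C%C * Cpderiv e w (wavelet_kernel phi Phi ^~ z) x) <= C * half_decay z.
Proof.
have [C [B [C0 B1 H]]] := @wavelet_kernel_bound R n rho1 rho2 s t tau A A1 rho2_ge0 rho2_t tau_ge0.
by eexists => x z; exact: (H phi Phi P Q P0 Q0 bphi bPhi al w x z).
Qed.

Lemma data_kernel_dominated al w : exists C, forall x z,
  normc ((mpow x al)%:C%C * Cpderiv e w (data_kernel phi Phi ^~ z) x) <= C * half_decay z.
Proof.
have [C [B [C0 B1 H]]] := @data_kernel_bound R n rho1 rho2 s t tau A A1 rho2_ge0 rho2_t tau_ge0.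
by eexists => x z; exact: (H phi Phi P Q P0 Q0 bphi bPhi al w x z).
Qed.

Let mpow0 (x : 'rV[R]_n) : mpow x [ffun=> 0%N] = 1.
Proof. by rewrite /mpow big1// => i _; rewrite ffunE expr0. Qed.

Let Cpderiv_nil (K : 'rV[R]_n -> R[i]) x : Cpderiv e [::] K x = K x.
Proof. by rewrite /Cpderiv /=; case: (K x). Qed.

Lemma wavelet_kernel_le w : exists C, forall x z,
  normc (Cpderiv e w (wavelet_kernel phi Phi ^~ z) x) <= C * half_decay z.
Proof.
have [C H] := wavelet_kernel_dominated [ffun=> 0%N] w; exists C => x z.
by have := H x z; rewrite mpow0 mul1r.
Qed.

Lemma data_kernel_le w : exists C, forall x z,
  normc (Cpderiv e w (data_kernel phi Phi ^~ z) x) <= C * half_decay z.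
Proof.
have [C H] := data_kernel_dominated [ffun=> 0%N] w; exists C => x z.
by have := H x z; rewrite mpow0 mul1r.
Qed.

Let mcoord2 (i : 'I_n) : measurable_fun setT (fun z : Y => rV z.2 0 i).
Proof. exact: (measurableT_comp (measurable_rV i) measurable_snd). Qed.

Lemma Cmeasurable_wavelet_kernel_fix x : Cmeasurable setT (wavelet_kernel phi Phi x).
Proof.
exact: (@Cmeasurable_wavelet_kernel R n _ _ (fun=> x) (fun z => rV z.2) fst).
Qed.

Lemma Cmeasurable_data_kernel_fix x : Cmeasurable setT (data_kernel phi Phi x).
Proof.
exact: (@Cmeasurable_data_kernel R n _ _ (fun=> x) (fun z => rV z.2) fst).
Qed.

Let integrable_half_decay_row (C a : R) :
  lebn.-integrable setT (EFin \o (fun u => C * half_decay (a, u))).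
Proof.
have := integrableZl measurableT (C * (oneDsqr a)^-1) (@integrable_decay R n).
by apply: eq_integrable => // u _; rewrite /= /half_decay -EFinM mulrA.
Qed.

Let integrable_Chalf_decay (C : R) : mu.-integrable setT (EFin \o (fun z => C * half_decay z)).
Proof. by have := integrableZl measurableT C (@integrable_half_decay R n); apply: eq_integrable. Qed.

Let kernel_integrable (K : Y -> R[i]) C : Cmeasurable setT K ->
  (forall z, normc (K z) <= C * half_decay z) ->
  Cintegrable mu setT K /\ forall a, Cintegrable lebn setT (fun u => K (a, u)).
Proof.
move=> [m1 m2] bK; split; first exact: (le_Cintegrable m1 m2 (integrable_Chalf_decay C) bK).
move=> a; apply: (@le_Cintegrable _ _ _ lebn _ (fun u => C * half_decay (a, u))).
- exact: (measurableT_comp m1 (measurable_pair1 a)).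
- exact: (measurableT_comp m2 (measurable_pair1 a)).
- exact: integrable_half_decay_row.
- by move=> u; exact: bK.
Qed.

Lemma wavelet_kernel_integrable x : Cintegrable mu setT (wavelet_kernel phi Phi x) /\
  forall a, Cintegrable lebn setT (fun u => wavelet_kernel phi Phi x (a, u)).
Proof.
have [C H] := wavelet_kernel_le [::]; apply: (kernel_integrable (C := C)).
  exact: Cmeasurable_wavelet_kernel_fix.
by move=> z; have := H x z; rewrite Cpderiv_nil.
Qed.

Lemma data_kernel_integrable x : Cintegrable mu setT (data_kernel phi Phi x) /\
  forall a, Cintegrable lebn setT (fun u => data_kernel phi Phi x (a, u)).
Proof.
have [C H] := data_kernel_le [::]; apply: (kernel_integrable (C := C)).
  exact: Cmeasurable_data_kernel_fix.
by move=> z; have := H x z; rewrite Cpderiv_nil.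
Qed.

Let synthesis_kernel_integrable x a : Rn_integrable (synthesis_kernel phi Phi x a).
Proof.
have [a0|a0] := lerP a 0.
  have -> : synthesis_kernel phi Phi x a = (fun=> 0).
    apply/funext => b; rewrite /synthesis_kernel Phi0 ?mul0r//.
    by rewrite /half_space /= => /lt_le_trans /(_ a0); rewrite ltxx.
  exact: Cintegrable0.
have [_ /(_ a) ki] := wavelet_kernel_integrable x.
have := Cintegrable_scale a%:C%C ki; rewrite /Rn_integrable.
congr Cintegrable; apply/funext => u; rewrite /wavelet_kernel /=.
by rewrite mulrC -mulrA -rmorphM mulVf ?lt0r_neq0// mulr1.
Qed.

Let synthesis_scaleE x a : synthesis_scale phi Phi x a =
  Cintegral lebn setT (fun u => wavelet_kernel phi Phi x (a, u)).
Proof.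
rewrite /synthesis_scale /Rn_integral mulrC -Cintegral_scale; last first.
  exact: synthesis_kernel_integrable.
by congr Cintegral; apply/funext => u; rewrite mulrC.
Qed.

(** Fubini's theorem for the first kernel. Each inner integral converges, and not
    only almost every one, because the bound by half_decay holds pointwise. *)
Lemma synthesis_convergesP x : synthesis_converges phi Phi x /\
  synthesis phi Phi x = Cintegral mu setT (wavelet_kernel phi Phi x).
Proof.
have [k1 k2] := wavelet_kernel_integrable x.
have [i12 E] := Cfubini1 k1 k2.
have mD : measurable (`]0, +oo[%classic : set mR) by exact: measurable_itv.
have f0 a : ~ `]0, +oo[%classic a ->
    Cintegral lebn setT (fun u => wavelet_kernel phi Phi x (a, u)) = 0.
  rewrite /= in_itv/= andbT => /negP; rewrite -leNgt => a0.
  rewrite [X in Cintegral _ _ X](_ : _ = (fun=> 0)) ?Cintegral0//.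
  by apply/funext => u; rewrite wavelet_kernel_le0.
have [c1 c2] := Cintegrable_restrict mD f0 i12.
have E2 : synthesis_scale phi Phi x =
    (fun a => Cintegral lebn setT (fun u => wavelet_kernel phi Phi x (a, u))).
  by apply/funext => a; exact: synthesis_scaleE.
split; last by rewrite /synthesis E2 c2 E.
split; last by rewrite E2.
by move=> a _; exact: synthesis_kernel_integrable.
Qed.

(** The substitution b = x - a y in the inner integral, for each a > 0. *)
Lemma Cintegral_wavelet_data_kernel x :
  Cintegral mu setT (wavelet_kernel phi Phi x) = Cintegral mu setT (data_kernel phi Phi x).
Proof.
have [k1 k2] := wavelet_kernel_integrable x.
have [j1 j2] := data_kernel_integrable x.
have [_ <-] := Cfubini1 k1 k2.
have [_ <-] := Cfubini1 j1 j2.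
congr Cintegral; apply/funext => a.
have [a0|a0] := lerP a 0.
  by congr Cintegral; apply/funext => u; rewrite wavelet_kernel_le0// data_kernel_le0.
pose G b := synthesis_kernel phi Phi x a b * (a^-1)%:C%C.
have iG : Rn_integrable G by exact: k2 a.
have na0 : - a != 0 by rewrite oppr_eq0 lt0r_neq0.
have := Rn_integral_affine x na0 iG.
have -> : (fun y => G (x + - a *: y)) = (fun y => (a ^- n)%:C%C *
    (Phi (x - a *: y, a) * (a^-1)%:C%C * phi y)).
  apply/funext => y; rewrite /G /synthesis_kernel scaleNr.
  have -> : a^-1 *: (x - (x - a *: y)) = y.
    by rewrite opprB addrC subrK scalerA mulVf ?scale1r// lt0r_neq0.
  rewrite div1r; ring.
have -> : Rn_integral (fun y => (a ^- n)%:C%C *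
    (Phi (x - a *: y, a) * (a^-1)%:C%C * phi y)) =
    (a ^- n)%:C%C * Cintegral lebn setT (fun u => data_kernel phi Phi x (a, u)).
  by rewrite -Cintegral_scale.
rewrite normrN (gtr0_norm a0) => /mulfI E.
apply/esym; apply: E.
by rewrite eq_complex /= eqxx andbT invr_eq0 expf_neq0// lt0r_neq0.
Qed.

Let mRe1 x : measurable_fun setT (fun z => complex.Re (wavelet_kernel phi Phi x z)).
Proof. by have [] := Cmeasurable_wavelet_kernel_fix x. Qed.
Let mIm1 x : measurable_fun setT (fun z => complex.Im (wavelet_kernel phi Phi x z)).
Proof. by have [] := Cmeasurable_wavelet_kernel_fix x. Qed.
Let mRe2 x : measurable_fun setT (fun z => complex.Re (data_kernel phi Phi x z)).
Proof. by have [] := Cmeasurable_data_kernel_fix x. Qed.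
Let mIm2 x : measurable_fun setT (fun z => complex.Im (data_kernel phi Phi x z)).
Proof. by have [] := Cmeasurable_data_kernel_fix x. Qed.

Let synthesisE1 : synthesis phi Phi = fun x => Cintegral mu setT (wavelet_kernel phi Phi x).
Proof. by apply/funext => x; have [] := synthesis_convergesP x. Qed.

Let synthesisE2 : synthesis phi Phi = fun x => Cintegral mu setT (data_kernel phi Phi x).
Proof. by rewrite synthesisE1; apply/funext => x; exact: Cintegral_wavelet_data_kernel. Qed.

Lemma synthesis_smooth : Csmooth_on e setT (synthesis phi Phi).
Proof.
rewrite synthesisE1.
exact: (Csmooth_on_Cintegral (wavelet_kernel_smooth sphi Phi0) mRe1 mIm1 (@half_decay_ge0 R n)
  (@integrable_half_decay R n) wavelet_kernel_le).
Qed.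

Lemma synthesis_bound_wavelet al w x C :
  (forall z, normc ((mpow x al)%:C%C * Cpderiv e w (wavelet_kernel phi Phi ^~ z) x) <= C * half_decay z) ->
  normc ((mpow x al)%:C%C * Cpderiv e w (synthesis phi Phi) x) <=
  2 * (C * \int[mu]_z half_decay z).
Proof.
move=> H; rewrite synthesisE1.
rewrite (Cpderiv_Cintegral (wavelet_kernel_smooth sphi Phi0) mRe1 mIm1 (@half_decay_ge0 R n)
  (@integrable_half_decay R n) wavelet_kernel_le).
have ci := Cintegrable_Cpderiv (wavelet_kernel_smooth sphi Phi0) mRe1 mIm1 (@half_decay_ge0 R n)
  (@integrable_half_decay R n) wavelet_kernel_le w x.
rewrite -(Cintegral_scale (mpow x al)%:C%C ci) -(RintegralZl C measurableT (@integrable_half_decay R n)).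
apply: normc_Cintegral_le => //.
exact: Cintegrable_scale.
Qed.

Lemma synthesis_bound_data al w x C :
  (forall z, normc ((mpow x al)%:C%C * Cpderiv e w (data_kernel phi Phi ^~ z) x) <= C * half_decay z) ->
  normc ((mpow x al)%:C%C * Cpderiv e w (synthesis phi Phi) x) <=
  2 * (C * \int[mu]_z half_decay z).
Proof.
move=> H; rewrite synthesisE2.
rewrite (Cpderiv_Cintegral (data_kernel_smooth phi sPhi Phi0) mRe2 mIm2 (@half_decay_ge0 R n)
  (@integrable_half_decay R n) data_kernel_le).
have ci := Cintegrable_Cpderiv (data_kernel_smooth phi sPhi Phi0) mRe2 mIm2 (@half_decay_ge0 R n)
  (@integrable_half_decay R n) data_kernel_le w x.
rewrite -(Cintegral_scale (mpow x al)%:C%C ci) -(RintegralZl C measurableT (@integrable_half_decay R n)).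
apply: normc_Cintegral_le => //.
exact: Cintegrable_scale.
Qed.

(** Two more powers of each coordinate of x, which the bounds allow, buy the factor
    decay x that makes the integrand integrable in (x, a, b). *)
Let wavelet_kernel_decay al : exists C, forall x z,
  normc ((mpow x al)%:C%C * wavelet_kernel phi Phi x z) <= C * (decay x * half_decay z).
Proof.
have [C [B [C0 B1 H]]] := @wavelet_kernel_bound R n rho1 rho2 s t tau A A1 rho2_ge0 rho2_t tau_ge0.
have t0 : 0 <= t by exact: le_trans rho2_t.
have [C3 [B3 [C31 B31 H3]]] := @mfactD_shift R n t (2 * n + 2 ^ n) t0.
have B0 : 0 <= B by exact: le_trans B1.
have C30 : 0 <= C3 by exact: le_trans C31.
have B30 : 0 <= B3 by exact: le_trans B31.
pose b0 : midx := word_mindex [::].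
pose F := (mfact b0)%:R `^ rho1 * (mfact b0)%:R `^ tau.
have F0 : 0 <= F by rewrite mulr_ge0 ?powR_ge0.
exists (2 ^+ n * (C * B ^+ (mabs al + 2 * n) * (P * Q) *
  (C3 * B3 ^+ mabs al * (mfact al)%:R `^ t * F))) => x z.
have [eps [eabs efact] He] := decay_mpow x.
have := H phi Phi P Q P0 Q0 bphi bPhi (madd al eps) [::] x z.
rewrite Cpderiv_nil mpowD -/b0 -/F addn0 mabsD.
move: (wavelet_kernel phi Phi x z) => K1 h; move: h.
rewrite normcM normc_real normrM => h; rewrite normcM normc_real.
set k := normc _ in h *; set pa := `|mpow x al| in h *; set pe := `|mpow x eps| in h He.
have k0 : 0 <= k by exact: normc_ge0.
have pa0 : 0 <= pa by exact: normr_ge0.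
have d0 : 0 <= half_decay z by exact: half_decay_ge0.
have dx0 := ltW (decay_gt0 x).
have e1 : pa * k <= decay x * 2 ^+ n * (pa * pe * k).
  have := ler_peMr (mulr_ge0 pa0 k0) He; move=> e1; apply: (le_trans e1).
  rewrite le_eqVlt; apply/orP; left; apply/eqP; ring.
apply: (le_trans e1).
have e2 : C * B ^+ (mabs al + mabs eps) * (P * Q) * ((mfact (madd al eps))%:R `^ t * F) * half_decay z
  <= C * B ^+ (mabs al + 2 * n) * (P * Q) *
  (C3 * B3 ^+ mabs al * (mfact al)%:R `^ t * F) * half_decay z.
  rewrite ler_wpM2r//; apply: ler_pM.
  - by rewrite !mulr_ge0 ?exprn_ge0.
  - by rewrite mulr_ge0 ?powR_ge0.
  - rewrite ler_wpM2r ?mulr_ge0// ler_wpM2l//.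
    by apply: ler_weXn2l => //; rewrite leq_add2l.
  - rewrite ler_wpM2r//; apply: H3.
      exact: leq_trans eabs (leq_addr _ _).
    exact: leq_trans efact (leq_addl _ _).
have N0 : 0 <= decay x * 2 ^+ n by rewrite mulr_ge0 ?exprn_ge0.
apply: le_trans (le_trans (ler_wpM2l N0 (le_trans h e2)) _) => //.
rewrite le_eqVlt; apply/orP; left; apply/eqP; ring.
Qed.

(** Fubini's theorem on (x, (a, b)), integrating over x first. *)
Lemma synthesis_zero_moments : zero_moments phi -> zero_moments (synthesis phi Phi).
Proof.
move=> zphi al; rewrite synthesisE1.
pose f (q : n.-tuple mR * Y) : R[i] :=
  (mpow (rV q.1) al)%:C%C * wavelet_kernel phi Phi (rV q.1) q.2.
have [C HC] := wavelet_kernel_decay al.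
have mf : Cmeasurable setT f.
  apply: CmeasurableM.
    apply: Cmeasurable_real.
    apply: measurable_prod => i _; apply: measurable_funX.
    exact: (measurableT_comp (measurable_rV i) measurable_fst).
  apply: (@Cmeasurable_wavelet_kernel R n _ _ (fun q => rV q.1) (fun q => rV q.2.2)
    (fun q => q.2.1)) => //.
  - by move=> i; exact: (measurableT_comp (measurable_rV i) measurable_fst).
  - by move=> i; exact: (measurableT_comp (mcoord2 i) measurable_snd).
  - exact: (measurableT_comp measurable_fst measurable_snd).
pose mu' := sigma_finite_prod leb lebn.
have fi : Cintegrable (lebn \x mu')%E setT f.
  have [m1 m2] := mf.
  apply: (le_Cintegrable (g := fun q => C * (decay (rV q.1) * half_decay q.2)) m1 m2); last first.
    by move=> q; exact: HC.
  have := integrableZl measurableT C (@integrable_prod_mul R _ _ _ _ lebn mu' _ _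
    (@integrable_decay R n) (@integrable_half_decay R n)).
  by apply: eq_integrable.
have f2 v : Cintegrable mu setT (fun z => f (v, z)).
  exact: (Cintegrable_scale (mpow (rV v) al)%:C%C (wavelet_kernel_integrable (rV v)).1).
have f1 z : Cintegrable lebn setT (fun v => f (v, z)) /\
    Cintegral lebn setT (fun v => f (v, z)) = 0.
  have [a0|a0] := lerP z.1 0.
    have -> : (fun v => f (v, z)) = (fun=> 0).
      by apply/funext => v; rewrite /f /= wavelet_kernel_le0// mulr0.
    by split; [exact: Cintegrable0|exact: Cintegral0].
  pose c := Phi (rV z.2, z.1) * (1 / z.1 ^+ n)%:C%C * (z.1^-1)%:C%C.
  pose H y := (mpow (rV z.2 + z.1 *: y) al)%:C%C * phi y.
  have [iH H0] := zero_moments_integral (zero_moments_affine_mpow (rV z.2) z.1 al zphi).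
  have r0 : z.1^-1 != 0 by rewrite invr_eq0 lt0r_neq0.
  have iA := Rn_integrable_affine (- (z.1^-1 *: rV z.2)) r0 iH.
  have eA := Rn_integral_affine (- (z.1^-1 *: rV z.2)) r0 iH.
  rewrite H0 mulr0 in eA.
  have E : (fun v => f (v, z)) = (fun v => c * ((fun x => H (- (z.1^-1 *: rV z.2) + z.1^-1 *: x)) \o rV) v).
    apply/funext => v; rewrite /f /wavelet_kernel /synthesis_kernel /H /c /=.
    have -> : - (z.1^-1 *: rV z.2) + z.1^-1 *: rV v = z.1^-1 *: (rV v - rV z.2).
      by rewrite addrC -scalerBr.
    have -> : rV z.2 + z.1 *: (z.1^-1 *: (rV v - rV z.2)) = rV v.
      by rewrite scalerA mulfV ?lt0r_neq0// scale1r addrC subrK.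
    ring.
  rewrite E; split; first exact: Cintegrable_scale.
  by rewrite Cintegral_scale//; rewrite /Rn_integral in eA; rewrite eA mulr0.
have [i1 E1] := Cfubini1 fi f2.
have E2 := Cfubini2 fi (fun z => (f1 z).1).
have FE : (fun x => (mpow x al)%:C%C * Cintegral mu setT (wavelet_kernel phi Phi x)) \o rV =
    (fun v => Cintegral mu setT (fun z => f (v, z))).
  apply/funext => v; rewrite /= -Cintegral_scale//.
  by have [] := wavelet_kernel_integrable (rV v).
rewrite /Rn_integrable /Rn_integral FE; split=> //.
rewrite E1 -E2.
rewrite [X in Cintegral _ _ X](_ : _ = (fun=> 0)) ?Cintegral0//.
by apply/funext => z; have [] := f1 z.
Qed.

End fixed_pair.

End synthesis_theory.

(** * Bilinear maps on inductive limits *)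

Section bilinear_inductive.
Context {R : realType} {E1 E2 E3 : lmodType R[i]}.
Variables (p : R -> E1 -> \bar R) (q : R -> E2 -> \bar R) (r : R -> E3 -> \bar R).
Variable T : E1 -> E2 -> E3.

(** The union of the steps of the spectrum h |-> g h. *)
Definition ind_space (E : lmodType R[i]) (g : R -> E -> \bar R) : set E :=
  [set x | exists2 h, 0 < h & (g h x < +oo)%E].

(** Homogeneity is stated for upper bounds, which avoids products of extended
    reals. *)
Definition seminorm_family (E : lmodType R[i]) (g : R -> E -> \bar R) :=
  (forall h x (c : R[i]) (B : R), 0 < h -> 0 <= B -> (g h x <= B%:E)%E ->
     (g h (c *: x) <= (normc c * B)%:E)%E) /\
  (forall h h' x, 0 < h -> h <= h' -> (g h x <= g h' x)%E).

Hypothesis pS : seminorm_family p.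
Hypothesis qS : seminorm_family q.
Hypothesis rS : seminorm_family r.
Hypothesis Tl : forall x x' y a b, ind_space p x -> ind_space p x' -> ind_space q y ->
  T (a *: x + b *: x') y = a *: T x y + b *: T x' y.
Hypothesis Tr : forall x y y' a b, ind_space p x -> ind_space q y -> ind_space q y' ->
  T x (a *: y + b *: y') = a *: T x y + b *: T x y'.
Hypothesis pconv : forall x x' a b, ind_space p x -> ind_space p x' ->
  ind_space p (a *: x + b *: x').
Hypothesis qconv : forall x x' a b, ind_space q x -> ind_space q x' ->
  ind_space q (a *: x + b *: x').
Hypothesis Tb : forall h k, 0 < h -> 0 < k -> exists h' C, [/\ 0 < h', 0 <= C &
  forall x y, (p h x <= 1)%E -> (q k y <= 1)%E -> (r h' (T x y) <= C%:E)%E].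

Let TZl x y a : ind_space p x -> ind_space q y -> T (a *: x) y = a *: T x y.
Proof.
move=> px qy; have := Tl a 0 px px qy.
by rewrite !scale0r !addr0.
Qed.

Let TZr x y a : ind_space p x -> ind_space q y -> T x (a *: y) = a *: T x y.
Proof.
move=> px qy; have := Tr a 0 px qy qy.
by rewrite !scale0r !addr0.
Qed.

Let normcC (a : R) : 0 <= a -> normc a%:C%C = a.
Proof. by move=> a0; rewrite /= expr0n /= addr0 sqrtr_sqr ger0_norm. Qed.

Let small (E : lmodType R[i]) (g : R -> E -> \bar R) h x (e : R) :
  seminorm_family g -> 0 < h -> 0 < e -> (g h x <= (e^-1)%:E)%E ->
  (g h (e%:C%C *: x) <= 1)%E.
Proof.
move=> [gZ _] h0 e0 gx.
have e'0 : 0 <= e^-1 by rewrite invr_ge0 ltW.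
have := gZ h x e%:C%C e^-1 h0 e'0 gx.
by rewrite normcC ?(ltW e0)// mulfV ?lt0r_neq0.
Qed.

Let step_lt (h : R) : 0 < h -> exists n : nat, n.+1%:R^-1 <= h.
Proof.
move=> h0; exists (Num.truncn h^-1).
rewrite -[leRHS]invrK lef_pV2 ?posrE ?invr_gt0 ?ltr0n// ltW//.
exact: truncnS_gt.
Qed.

Let hn_gt0 (n : nat) : 0 < n.+1%:R^-1 :> R. Proof. by rewrite invr_gt0 ltr0n. Qed.

(** The steps h = 1 / (n + 1) are cofinal. If c n m bounds T on the unit balls of the
    steps n and m, measured by U, and cN dominates c on squares, then
    c n m <= cN n * cN m, so that radii 1 / cN n and 1 / cN m are small enough for
    all pairs at once. W and V are defined as polars, which are absolutely convex
    for free: W by testing against the balls of the first spectrum, V by testing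
    against W. *)
Lemma bilinear_inductive_nbhs0 U : ind_nbhs0 r U -> exists V W,
  [/\ ind_nbhs0 p V, ind_nbhs0 q W, V `<=` ind_space p, W `<=` ind_space q &
    forall x y, V x -> W y -> U (T x y)].
Proof.
move=> [U0 [U0U cU0 U0b]].
have Hc n m : exists c : R, 1 <= c /\ forall x y (l : R), 0 <= l -> l * c <= 1 ->
    (p n.+1%:R^-1 x <= 1)%E -> (q m.+1%:R^-1 y <= 1)%E -> U0 (l%:C%C *: T x y).
  have [h' [C [h'0 C0 H]]] := Tb (hn_gt0 n) (hn_gt0 m).
  have [d d0 Hd] := U0b h' h'0.
  exists (1 + C / d); split; first by rewrite lerDl divr_ge0// ltW.
  move=> x y l l0 lc px qy; apply: Hd => /=.
  have [rZ _] := rS.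
  apply: (le_trans (rZ _ _ _ _ h'0 C0 (H x y px qy))).
  rewrite lee_fin normcC//.
  have : l * (C / d) <= 1 by apply: le_trans lc; rewrite ler_wpM2l// lerDr.
  by rewrite mulrA ler_pdivrMr// mul1r.
pose c n m := sval (cid (Hc n m)).
have c1 n m : 1 <= c n m by rewrite /c; case: cid => ? [].
have cT n m := (svalP (cid (Hc n m))).2.
pose cN N := \sum_(n < N.+1) \sum_(m < N.+1) c n m.
have cN_ge N n m : (n <= N)%N -> (m <= N)%N -> c n m <= cN N.
  move=> nN mN; rewrite /cN (bigD1 (Ordinal (n := N.+1) nN))//=.
  rewrite (bigD1 (Ordinal (n := N.+1) mN))//= -addrA lerDl addr_ge0//.
    by apply: sumr_ge0 => i _; exact: le_trans ler01 (c1 _ _).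
  by apply: sumr_ge0 => i _; apply: sumr_ge0 => j _; exact: le_trans ler01 (c1 _ _).
have cN1 N : 1 <= cN N by apply: le_trans (c1 N N) _; exact: cN_ge.
have cN0 N : 0 < cN N by exact: lt_le_trans ltr01 _.
have cNM n m : c n m <= cN n * cN m.
  have [nm|/ltnW mn] := leqP n m.
    apply: (le_trans (cN_ge m n m nm (leqnn m))).
    by rewrite ler_peMl// ltW.
  apply: (le_trans (cN_ge n n m (leqnn n) mn)).
  by rewrite ler_peMr// ltW.
have iV (a : R) : 0 < a -> 0 < a^-1 by rewrite invr_gt0.
have psp n x : (p n.+1%:R^-1 x <= 1)%E -> ind_space p x.
  by move=> px; exists n.+1%:R^-1 => //; apply: (le_lt_trans px); exact: ltry.
have qsp n x : (q n.+1%:R^-1 x <= 1)%E -> ind_space q x.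
  by move=> px; exists n.+1%:R^-1 => //; apply: (le_lt_trans px); exact: ltry.
have cV (a : R) : a != 0 -> a%:C%C * (a^-1)%:C%C = 1 :> R[i].
  by move=> a0; rewrite -rmorphM mulfV.
pose W : set E2 := [set y | ind_space q y /\ forall n x, (p n.+1%:R^-1 x <= 1)%E ->
  U0 (((cN n)^-1)%:C%C *: T x y)].
pose V : set E1 := [set x | ind_space p x /\ forall y, W y -> U0 (T x y)].
exists V, W; split.
- exists V; split=> // [x x' a b [px Vx] [px' Vx'] ab|h h0].
    split; first exact: pconv.
    move=> y Wy; rewrite Tl//; last by case: Wy.
    by apply: cU0 => //; [exact: Vx|exact: Vx'].
  have [n nh] := step_lt h0.
  exists (cN n)^-1; first exact: iV.
  move=> x /= px.
  have px1 : (p n.+1%:R^-1 ((cN n)%:C%C *: x) <= 1)%E.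
    apply: small => //; apply: le_trans px.
    by case: pS => _; apply.
  have spx : ind_space p x.
    by exists h => //; apply: (le_lt_trans px); exact: ltry.
  split=> // y [qy Wy].
  have := Wy n _ px1; rewrite TZl// scalerA mulrC cV ?scale1r//.
  by rewrite lt0r_neq0.
- exists W; split=> // [y y' a b [qy Wy] [qy' Wy'] ab|k k0].
    split; first exact: qconv.
    move=> n x px; have spx := psp n x px.
    rewrite Tr// scalerDr !scalerA mulrC (mulrC _ b) -!scalerA.
    by apply: cU0 => //; [exact: Wy|exact: Wy'].
  have [m mk] := step_lt k0.
  exists (cN m)^-1; first exact: iV.
  move=> y /= qy.
  have qy1 : (q m.+1%:R^-1 ((cN m)%:C%C *: y) <= 1)%E.
    apply: small => //; apply: le_trans qy.
    by case: qS => _; apply.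
  have sqy : ind_space q y.
    by exists k => //; apply: (le_lt_trans qy); exact: ltry.
  split=> // n x px; have spx := psp n x px.
  have -> : ((cN n)^-1)%:C%C *: T x y =
      ((cN n)^-1 * (cN m)^-1)%:C%C *: T x ((cN m)%:C%C *: y).
    rewrite TZr// scalerA; congr (_ *: _); rewrite -rmorphM; congr (_%:C)%C.
    by rewrite -mulrA mulVf ?mulr1// lt0r_neq0.
  apply: (cT n m) => //; first by rewrite mulr_ge0// ltW// iV.
  have cc0 : 0 < cN n * cN m by rewrite mulr_gt0.
  by rewrite -invfM (ler_pdivrMl _ _ cc0) mulr1; exact: cNM.
- by move=> x [].
- by move=> y [].
- by move=> x y [_ Vx] Wy; apply: U0U; exact: Vx.
Qed.

Lemma ind_nbhs0_scale (E : lmodType R[i]) (g : R -> E -> \bar R) U (c : R[i]) :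
  seminorm_family g -> ind_nbhs0 g U -> ind_nbhs0 g [set x | U (c *: x)].
Proof.
move=> [gZ _] [V [VU cV Vb]]; exists [set x | V (c *: x)]; split.
- by move=> x /= /VU.
- move=> x y a b Vx Vy ab; rewrite /= scalerDr !scalerA (mulrC c a) (mulrC c b) -!scalerA.
  exact: cV.
- move=> h h0; have [d d0 Hd] := Vb h h0.
  have n0 : 0 <= normc c by case: (c) => ? ?; exact: sqrtr_ge0.
  have n1 : 0 < 1 + normc c by rewrite ltr_pwDl.
  exists (d / (1 + normc c)); first by rewrite divr_gt0.
  move=> x /= gx; apply: Hd => /=.
  have d1 : 0 <= d / (1 + normc c) by rewrite ltW// divr_gt0.
  apply: (le_trans (gZ _ _ _ _ h0 d1 gx)).
  rewrite lee_fin mulrC -mulrA -[leRHS]mulr1 ler_wpM2l ?(ltW d0)//.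
  by rewrite ler_pdivrMl// mulr1 lerDr.
Qed.

Lemma ind_nbhs0_half (E : lmodType R[i]) (g : R -> E -> \bar R) U :
  seminorm_family g -> ind_nbhs0 g U ->
  exists2 U', ind_nbhs0 g U' & forall x y, U' x -> U' y -> U (x + y).
Proof.
move=> gS [V [VU cV Vb]].
have BV : ind_nbhs0 g V by exists V; split.
exists [set x | V ((2 : R)%:C%C *: x)]; first exact: ind_nbhs0_scale.
move=> x y /= Vx Vy; apply: VU.
have := cV _ _ (2^-1 : R)%:C%C (2^-1 : R)%:C%C Vx Vy.
rewrite !scalerA -!rmorphM mulVf ?pnatr_eq0// !scale1r; apply.
have -> : `|(2^-1 : R)%:C%C| = (2^-1 : R)%:C%C by rewrite normc_def /= expr0n /= addr0 sqrtr_sqr ger0_norm ?invr_ge0.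
by rewrite -rmorphD (_ : 2^-1 + 2^-1 = 1 :> R) ?rmorph1//; lra.
Qed.

(** Every point of the union of the steps has a multiple in a given
    neighbourhood. *)
Lemma ind_nbhs0_absorb (E : lmodType R[i]) (g : R -> E -> \bar R) U x :
  seminorm_family g -> (forall h x, 0 < h -> (0 <= g h x)%E) -> ind_nbhs0 g U -> ind_space g x ->
  exists2 l : R, 0 < l & U (l%:C%C *: x).
Proof.
move=> [gZ _] g0 [V [VU cV Vb]] [h h0 gx].
have [d d0 Hd] := Vb h h0.
have gfin : (g h x \is a fin_num) by rewrite ge0_fin_numE// g0.
pose B := fine (g h x).
have B0 : 0 <= B by rewrite fine_ge0// g0.
have gB : (g h x <= B%:E)%E by rewrite fineK.
exists (d / (1 + B)); first by rewrite divr_gt0// ltr_pwDl.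
apply: VU; apply: Hd => /=.
apply: (le_trans (gZ _ _ _ _ h0 B0 gB)).
rewrite lee_fin normcC; last by rewrite divr_ge0 ?(ltW d0)// addr_ge0.
rewrite -mulrA -[leRHS]mulr1 ler_wpM2l ?(ltW d0)//.
by rewrite ler_pdivrMl ?ltr_pwDl// mulr1 lerDr.
Qed.

End bilinear_inductive.

Section translation_nbhs.
Context {R : realType} {E F : lmodType R[i]} (v : F -> E).
Variable B : set_system E.
Hypothesis vD : forall x y, v (x + y) = v x + v y.
Hypothesis B0 : forall U, B U -> U 0.
Hypothesis Bhalf : forall U, B U ->
  exists2 U', B U' & forall x y, U' x -> U' y -> U (x + y).

(** The set of points with a whole translated neighbourhood inside the given one is
    open, since neighbourhoods can be halved. *)
Lemma translation_open_nbhs (x : F) (U : set E) : B U ->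
  exists O, [/\ translation_open v B O, O x & O `<=` [set y | U (v y - v x)]].
Proof.
move=> BU.
have v0 : v 0 = 0 by apply: (addrI (v 0)); rewrite -vD !addr0.
exists [set y | exists2 U', B U' & forall z, U' (v z) -> U (v (y + z) - v x)]; split.
- move=> y [U' BU' H]; have [U'' BU'' HU''] := Bhalf BU'.
  exists U'' => // z Uz; exists U'' => // z' Uz'.
  by rewrite -addrA; apply: H; rewrite vD; exact: HU''.
- by exists U => // z Uz; rewrite vD addrC addKr.
- move=> y [U' BU' H] /=; have := H 0; rewrite addr0; apply.
  by rewrite v0; exact: B0.
Qed.

End translation_nbhs.

(** * Seminorms and neighbourhoods of the function spaces *)

Section seminorms.
Context {R : realType} {n : nat}.
Local Notation midx := {ffun 'I_n -> nat}.
Local Notation e := (@coord_dir R n).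

Lemma ereal_sup_leP (S : set R) (B : R) :
  (ereal_sup (EFin @` S) <= B%:E)%E <-> forall x, S x -> x <= B.
Proof.
split=> [H x Sx|H].
  by rewrite -lee_fin; apply: le_trans H; apply: ereal_sup_ubound; exists x.
by apply: ge_ereal_sup => _ [x Sx <-]; rewrite lee_fin; exact: H.
Qed.

Section GS.
Variables (rho1 rho2 : R).
Local Notation p := (@GS_seminorm R n rho1 rho2).

Lemma GS_seminorm_family : seminorm_family p.
Proof.
split=> [h f c B h0 B0|h h' f h0 hh'].
  move=> /ereal_sup_leP H; apply/ereal_sup_leP => _ [x [a [b ->]]].
  have [sf _] := set_valP f.
  have -> : val (c *: f) = c *: val f :> ('rV[R]_n -> R[i]) by [].
  have -> : Cpderiv e (mword b) (c *: val f) x = c * Cpderiv e (mword b) (val f) x.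
    exact: Cpderiv_cst_mul.
  rewrite mulrCA normcM mulrCA ler_wpM2l ?normc_ge0//.
  by apply: H; exists x, a, b.
apply: ge_ereal_sup => _ [_ [x [a [b ->]]] <-].
apply: (@le_trans _ _ (GS_weight rho1 rho2 h' a b *
  normc ((mpow x a)%:C%C * Cpderiv e (mword b) (val f) x))%:E).
  by rewrite lee_fin ler_wpM2r ?normc_ge0// le_GS_weight// ltW.
by apply: ereal_sup_ubound; eexists; [exists x, a, b|].
Qed.

Lemma GS_seminorm_ge0 h f : 0 < h -> (0 <= p h f)%E.
Proof.
move=> h0; pose z : midx := [ffun=> 0%N].
apply: (@le_trans _ _ (GS_weight rho1 rho2 h z z *
  normc ((mpow 0 z)%:C%C * Cpderiv e (mword z) (val f) 0))%:E).
  by rewrite lee_fin mulr_ge0 ?normc_ge0// GS_weight_ge0// ltW.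
by apply: ereal_sup_ubound; eexists; [exists 0, z, z|].
Qed.

(** From the supremum to pointwise bounds; [GS_bound_seminorm] goes back. *)
Lemma GS_seminorm_bound h A P f : 0 < h -> h^-1 <= A -> 0 <= P ->
  (p h f <= P%:E)%E -> GS_bound rho1 rho2 A P (val f).
Proof.
move=> h0 hA P0 /ereal_sup_leP H; split; first by have [] := set_valP f.
move=> y c b; have := H _ (ex_intro _ y (ex_intro _ c (ex_intro _ b erefl))).
set N := normc _; rewrite /GS_weight.
set W := (mfact c)%:R `^ rho2 * (mfact b)%:R `^ rho1.
have W0 : 0 < W by rewrite mulr_gt0// powR_gt0// ltr0n mfact_gt0.
set k := (mabs c + mabs b)%N.
rewrite mulrAC ler_pdivrMr// -ler_pdivlMl ?exprn_gt0// => /le_trans; apply.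
rewrite mulrA ler_wpM2r ?(ltW W0)//.
by rewrite mulrC ler_wpM2l// -exprVn lerXn2r// ?nnegrE ?invr_ge0 ?(ltW h0)// (le_trans _ hA)// invr_ge0 ltW.
Qed.

Lemma GS_bound_seminorm h A P f : 0 < h -> h * A <= 1 -> 0 <= A -> 0 <= P ->
  GS_bound rho1 rho2 A P (val f) -> (p h f <= P%:E)%E.
Proof.
move=> h0 hA A0 P0 [_ H]; apply/ereal_sup_leP => _ [x [a [b ->]]].
have := H x a b; set N := normc _; rewrite /GS_weight.
set W := (mfact a)%:R `^ rho2 * (mfact b)%:R `^ rho1.
have W0 : 0 < W by rewrite mulr_gt0// powR_gt0// ltr0n mfact_gt0.
set k := (mabs a + mabs b)%N => HN.
rewrite mulrAC ler_pdivrMr//.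
apply: (@le_trans _ _ (h ^+ k * (P * A ^+ k * W))).
  by rewrite ler_wpM2l ?exprn_ge0 ?(ltW h0).
have -> : h ^+ k * (P * A ^+ k * W) = (h * A) ^+ k * (P * W) by rewrite exprMn; ring.
rewrite ler_piMl ?mulr_ge0 ?(ltW W0)//.
by rewrite exprn_ile1// mulr_ge0// ltW.
Qed.

End GS.

Section HS.
Variables (s t t1 t2 : R).
Local Notation q := (@HS_seminorm R n s t t1 t2).
Local Notation hd := (@half_dir R n).
Local Notation H := (@half_space R n).

Lemma HS_seminorm_family a : seminorm_family (q a).
Proof.
split=> [h f c B h0 B0|h h' f h0 hh'].
  move=> /ereal_sup_leP K; apply/ereal_sup_leP => _ [z [b [k [l1 [l2 [zH ->]]]]]].
  have [sf _] := set_valP f.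
  have -> : val (c *: f) = c *: val f + 0 :> ('rV[R]_n * R -> R[i]).
    by rewrite addr0.
  rewrite (Cpderiv_lin (@open_half_space R n) c _ sf (Csmooth_on0 _ _) zH).
  rewrite Cpderiv0 addr0 normcM mulrCA ler_wpM2l ?normc_ge0//.
  by apply: K; exists z, b, k, l1, l2.
apply: ge_ereal_sup => _ [_ [z [b [k [l1 [l2 [zH ->]]]]]] <-].
apply: (@le_trans _ _ (HS_weight s t t1 t2 h' z b k l1 l2 *
  normc (Cpderiv hd (half_word a b) (val f) z))%:E).
  by rewrite lee_fin ler_wpM2r ?normc_ge0// le_HS_weight// ltW.
by apply: ereal_sup_ubound; eexists; [exists z, b, k, l1, l2; split; [exact: zH|reflexivity]|].
Qed.

Lemma HS_seminorm_ge0 a h f : 0 < h -> (0 <= q a h f)%E.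
Proof.
move=> h0; pose b : midx := [ffun=> 0%N]; pose z : 'rV[R]_n * R := (0, 1).
have zH : H z by rewrite /half_space /= ltr01.
apply: (@le_trans _ _ (HS_weight s t t1 t2 h z b 0 0 0 *
  normc (Cpderiv hd (half_word a b) (val f) z))%:E).
  by rewrite lee_fin mulr_ge0 ?normc_ge0// HS_weight_ge0// ltW.
by apply: ereal_sup_ubound; eexists; [exists z, b, 0%N, 0%N, 0%N; split; [exact: zH|reflexivity]|].
Qed.

Lemma HS_seminorm_bound h A Q f : 0 < h -> h^-1 <= A -> 0 <= Q ->
  (q 0 h f <= Q%:E)%E -> HS_bound s t t1 t2 A Q (val f).
Proof.
move=> h0 hA Q0 /ereal_sup_leP K; have [sf f0] := set_valP f; split => //.
  by move=> z zH; apply: f0; apply/negP => /set_mem.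
move=> z b k l1 l2 zH.
have := K _ (ex_intro _ z (ex_intro _ b (ex_intro _ k (ex_intro _ l1
  (ex_intro _ l2 (conj zH erefl)))))).
rewrite /HS_weight [half_word 0 b]/=.
set N := normc _; set X := z.2 ^+ l1 + _; set J := japanese _ ^+ k.
set W := (mfact b)%:R `^ s * k`!%:R `^ t * l1`!%:R `^ t1 * l2`!%:R `^ t2.
have W0 : 0 < W by rewrite !mulr_gt0// powR_gt0// ltr0n ?mfact_gt0 ?fact_gt0.
set m := (mabs b + k + l1 + l2)%N.
have -> : h ^+ m / W * X * J * N = h ^+ m * (N * X * J) / W by ring.
rewrite ler_pdivrMr// -ler_pdivlMl ?exprn_gt0// => /le_trans; apply.
rewrite mulrA ler_wpM2r ?(ltW W0)//.
by rewrite mulrC ler_wpM2l// -exprVn lerXn2r// ?nnegrE ?invr_ge0 ?(ltW h0)// (le_trans _ hA)// invr_ge0 ltW.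
Qed.

End HS.

Lemma ind_space_bounded (E : lmodType R[i]) (g : R -> E -> \bar R) x :
  (forall h x, 0 < h -> (0 <= g h x)%E) -> ind_space g x ->
  exists h P, [/\ 0 < h, 0 <= P & (g h x <= P%:E)%E].
Proof.
move=> g0 [h h0 gx]; exists h, (fine (g h x)).
by split=> //; [rewrite fine_ge0// g0|rewrite fineK// ge0_fin_numE// g0].
Qed.

Lemma ind_space_lin (E : lmodType R[i]) (g : R -> E -> \bar R) x y a b :
  GRing.subsemimod_closed (mem (ind_space g)) ->
  ind_space g x -> ind_space g y -> ind_space g (a *: x + b *: y).
Proof.
move=> [[_ cD] cZ] gx gy; apply/set_mem.
by apply: cD; apply: cZ; exact: mem_set.
Qed.

End seminorms.

Section HS_level.
Context {R : realType} {n : nat} (s t t1 t2 : R).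
Local Notation q := (@HS_seminorm R n s t t1 t2).

(** Closure of a single level of the projective limit under sums. The space S itself
    is the intersection of all levels. *)
Lemma HS_seminormD a h f g P Q : 0 < h -> (q a h f <= P%:E)%E -> (q a h g <= Q%:E)%E ->
  (q a h (f + g)%R <= (P + Q)%:E)%E.
Proof.
move=> h0 /ereal_sup_leP Hf /ereal_sup_leP Hg; apply/ereal_sup_leP.
move=> _ [z [b [k [l1 [l2 [zH ->]]]]]].
have [sf _] := set_valP f; have [sg _] := set_valP g.
have -> : val (f + g) = 1 *: val f + val g :> ('rV[R]_n * R -> R[i]).
  by rewrite scale1r.
rewrite (Cpderiv_lin (@open_half_space R n) 1 _ sf sg zH) mul1r.
apply: (@le_trans _ _ (HS_weight s t t1 t2 h z b k l1 l2 *
  (normc (Cpderiv (@half_dir R n) (half_word a b) (val f) z) +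
   normc (Cpderiv (@half_dir R n) (half_word a b) (val g) z)))).
  by rewrite ler_wpM2l ?HS_weight_ge0 ?(ltW h0)// le_normcD.
rewrite mulrDr lerD//; first by apply: Hf; exists z, b, k, l1, l2.
by apply: Hg; exists z, b, k, l1, l2.
Qed.

Lemma HS_ind_space_lin m f g a b : ind_space (q m) f -> ind_space (q m) g ->
  ind_space (q m) (a *: f + b *: g)%R.
Proof.
have q0 := @HS_seminorm_ge0 R n s t t1 t2 m; have [qZ qh] := @HS_seminorm_family R n s t t1 t2 m.
move=> /(ind_space_bounded q0)[h [P [h0 P0 fP]]] /(ind_space_bounded q0)[h' [Q [h'0 Q0 gQ]]].
have m0 : 0 < Num.min h h' by rewrite lt_min h0.
have fP' : (q m (Num.min h h') f <= P%:E)%E.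
  by apply: le_trans fP; apply: qh => //; rewrite ge_min lexx.
have gQ' : (q m (Num.min h h') g <= Q%:E)%E.
  by apply: le_trans gQ; apply: qh => //; rewrite ge_min lexx orbT.
exists (Num.min h h') => //.
apply: le_lt_trans (HS_seminormD m0 (qZ _ _ a _ m0 P0 fP') (qZ _ _ b _ m0 Q0 gQ')) _.
exact: ltry.
Qed.

End HS_level.

Section nbhs_spaces.
Context {R : realType} {n : nat}.

Lemma ind_nbhs0_0 (E : lmodType R[i]) (g : R -> E -> \bar R) U :
  seminorm_family g -> (forall h x, 0 < h -> (0 <= g h x)%E) ->
  ind_space g 0 -> ind_nbhs0 g U -> U 0.
Proof.
move=> gS g0 s0 BU; have [l _] := ind_nbhs0_absorb gS g0 BU s0.
by rewrite scaler0.
Qed.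

Lemma GS0_nbhs (rho1 rho2 : R) (x : GS0 n rho1 rho2) U :
  ind_nbhs0 (@GS_seminorm R n rho1 rho2) U ->
  nbhs x [set y | U (val (val y) - val (val x))].
Proof.
move=> BU.
have s0 : ind_space (@GS_seminorm R n rho1 rho2) 0.
  by have [[H _] _] := @GS_closed R n rho1 rho2; exact: set_mem H.
have vD (y z : GS n rho1 rho2) : val (y + z) = val y + val z by [].
have [Z [oZ Zx ZU]] := translation_open_nbhs vD
  (fun V => ind_nbhs0_0 (GS_seminorm_family rho1 rho2) (GS_seminorm_ge0 rho1 rho2) s0)
  (fun V => ind_nbhs0_half (GS_seminorm_family rho1 rho2)) (val x) BU.
have N : nbhs (val x : GS n rho1 rho2) [set y | U (val y - val (val x))] by exists Z.
exact: (@initial_continuous _ _ (@set_val _ (@GS0_set R n rho1 rho2)) x _ N).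
Qed.

(** A neighbourhood for the level 0 of the projective limit is one for the limit. *)
Lemma HS_nbhs (s t t1 t2 : R) (x : HS n s t t1 t2) U :
  ind_nbhs0 (@HS_seminorm R n s t t1 t2 0) U ->
  nbhs x [set y | U (val y - val x)].
Proof.
move=> BU.
have gS a := @HS_seminorm_family R n s t t1 t2 a.
have g0 a := @HS_seminorm_ge0 R n s t t1 t2 a.
have s0 a : ind_space (@HS_seminorm R n s t t1 t2 a) 0.
  by have [[H _] _] := @HS_closed R n s t t1 t2; exact: set_mem H a.
have B0 V : proj_nbhs0 (fun a => ind_nbhs0 (@HS_seminorm R n s t t1 t2 a)) V -> V 0.
  move=> [N [W [BW WV]]]; apply: WV => k _.
  exact: (ind_nbhs0_0 (gS k) (g0 k) (s0 k) (BW k)).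
have Bh V : proj_nbhs0 (fun a => ind_nbhs0 (@HS_seminorm R n s t t1 t2 a)) V ->
    exists2 V', proj_nbhs0 (fun a => ind_nbhs0 (@HS_seminorm R n s t t1 t2 a)) V' &
    forall y z, V' y -> V' z -> V (y + z).
  move=> [N [W [BW WV]]].
  have W' k : {W' : set (half_smooth R n) | ind_nbhs0 (@HS_seminorm R n s t t1 t2 k) W' /\
      forall y z, W' y -> W' z -> W k (y + z)}.
    by apply: cid; have [W' ? ?] := ind_nbhs0_half (gS k) (BW k); exists W'.
  exists (\bigcap_(k in `I_N) sval (W' k)).
    by exists N, (fun k => sval (W' k)); split=> // k; have [] := svalP (W' k).
  move=> y z Wy Wz; apply: WV => k kN.
  by have [_] := svalP (W' k); apply; [exact: Wy|exact: Wz].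
have vD (y z : HS n s t t1 t2) : val (y + z) = val y + val z by [].
have BU' : proj_nbhs0 (fun a => ind_nbhs0 (@HS_seminorm R n s t t1 t2 a)) U.
  exists 1%N, (fun k => if k is 0%N then U else setT); split.
    by case=> // k; exact: ind_nbhs0T.
  by move=> y /(_ 0%N); apply.
have [Z [oZ Zx ZU]] := translation_open_nbhs vD B0 Bh x BU'.
by exists Z.
Qed.

End nbhs_spaces.

Section linear_inclusions.
Context {R : realType} {n : nat} {rho1 rho2 : R}.

Lemma val_GS_lin c (u v : GS n rho1 rho2) : val (c *: u + v) = c *: val u + val v.
Proof. by []. Qed.

Lemma val_GS_sub (u v : GS n rho1 rho2) : val (u - v) = val u - val v.
Proof. by []. Qed.

Lemma val_GS0_lin c (u v : GS0 n rho1 rho2) : val (c *: u + v) = c *: val u + val v.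
Proof. by []. Qed.

End linear_inclusions.

(** * Continuity of the synthesis transform *)

Section synthesis_map.
Context {R : realType} {n : nat}.
Local Notation e := (@coord_dir R n).
Variables (rho1 rho2 s t tau s' : R).
Hypotheses (rho2_ge0 : 0 <= rho2) (rho2_t : rho2 <= t) (tau_ge0 : 0 <= tau).

(** What the two parts of the theorem have to supply: the bound of all derivatives of
    the transform by s' and t, with constants that depend on A alone. *)
Definition synthesis_estimate := forall A : R, 1 <= A -> exists C B : R,
  [/\ 0 <= C, 1 <= B & forall phi Phi P Q, 0 <= P -> 0 <= Q ->
   GS_bound (n := n) rho1 rho2 A P phi -> HS_bound s t (t - rho2) tau A Q Phi ->
   forall al b x,
   normc ((mpow x al)%:C%C * Cpderiv e (mword b) (synthesis phi Phi) x) <=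
   C * (P * Q) * B ^+ (mabs al + mabs b) * ((mfact al)%:R `^ t * (mfact b)%:R `^ s')].

Hypothesis est : synthesis_estimate.

Local Notation p := (@GS_seminorm R n rho1 rho2).
Local Notation q := (@HS_seminorm R n s t (t - rho2) tau 0).
Local Notation r := (@GS_seminorm R n s' t).

Let pS := @GS_seminorm_family R n rho1 rho2.
Let qS := @HS_seminorm_family R n s t (t - rho2) tau 0.
Let rS := @GS_seminorm_family R n s' t.
Let p0 := @GS_seminorm_ge0 R n rho1 rho2.
Let q0 := @HS_seminorm_ge0 R n s t (t - rho2) tau 0.

Let bounds (phi : schwartz R n) (Phi : half_smooth R n) :
  ind_space p phi -> ind_space q Phi -> exists A P Q, [/\ 1 <= A, 0 <= P, 0 <= Q &
  GS_bound rho1 rho2 A P (val phi) /\ HS_bound s t (t - rho2) tau A Q (val Phi)].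
Proof.
move=> /(ind_space_bounded p0)[h [P [h0 P0 fP]]] /(ind_space_bounded q0)[k [Q [k0 Q0 gQ]]].
exists (1 + h^-1 + k^-1), P, Q.
have hi : 0 < h^-1 by rewrite invr_gt0.
have ki : 0 < k^-1 by rewrite invr_gt0.
split=> //; first by lra.
by split; [apply: GS_seminorm_bound h0 _ P0 fP|apply: HS_seminorm_bound k0 _ Q0 gQ]; lra.
Qed.

Let synth_schwartz (phi : schwartz R n) (Phi : half_smooth R n) :
  ind_space p phi -> ind_space q Phi ->
  schwartz_set (synthesis (val phi) (val Phi)).
Proof.
move=> pphi qPhi; have [A [P [Q [A1 P0 Q0 [bphi bPhi]]]]] := bounds pphi qPhi.
split; first exact: (synthesis_smooth A1 rho2_ge0 rho2_t tau_ge0 P0 Q0 bphi bPhi).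
move=> a b; have [C [B [C0 B1 H]]] := est A1.
by eexists => x; exact: (H _ _ P Q P0 Q0 bphi bPhi a b x).
Qed.

(** The transform on pairs with finite seminorms, as a total function between the
    ambient spaces, where the neighbourhoods live. *)
Let T_spec : {T : schwartz R n -> half_smooth R n -> schwartz R n |
  forall phi Phi, ind_space p phi -> ind_space q Phi ->
  val (T phi Phi) = synthesis (val phi) (val Phi)}.
Proof.
exists (fun phi Phi => xget 0 [set g | val g = synthesis (val phi) (val Phi)]).
move=> phi Phi pphi qPhi.
by case: xgetP => // /(_ (SigSub (mem_set (synth_schwartz pphi qPhi)))) /=.
Qed.

Let T := sval T_spec.

Let TE phi Phi : ind_space p phi -> ind_space q Phi ->
  val (T phi Phi) = synthesis (val phi) (val Phi).
Proof. exact: svalP T_spec phi Phi. Qed.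

Local Notation mu := (@lebesgue_measure R \x lebesgue_tuple n)%E.

Let synthE (phi : schwartz R n) (Phi : half_smooth R n) x :
  ind_space p phi -> ind_space q Phi ->
  [/\ synthesis_converges (val phi) (val Phi) x,
    synthesis (val phi) (val Phi) x = Cintegral mu setT (wavelet_kernel (val phi) (val Phi) x) &
    Cintegrable mu setT (wavelet_kernel (val phi) (val Phi) x)].
Proof.
move=> pphi qPhi; have [A [P [Q [A1 P0 Q0 [bphi bPhi]]]]] := bounds pphi qPhi.
have [c1 c2] := synthesis_convergesP A1 rho2_ge0 rho2_t tau_ge0 P0 Q0 bphi bPhi x.
by have [] := wavelet_kernel_integrable A1 rho2_ge0 rho2_t tau_ge0 P0 Q0 bphi bPhi x.
Qed.

Let Cint_lin (f g : measurableTypeR R * n.-tuple (measurableTypeR R) -> R[i]) (a b : R[i]) :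
  Cintegrable mu setT f -> Cintegrable mu setT g ->
  Cintegral mu setT (fun z => a * f z + b * g z) =
  a * Cintegral mu setT f + b * Cintegral mu setT g.
Proof.
move=> fi gi.
by rewrite (Cintegral_lin measurableT a fi (Cintegrable_scale b gi)) Cintegral_scale.
Qed.

Let pconv (x x' : schwartz R n) (a b : R[i]) : ind_space p x -> ind_space p x' ->
  ind_space p (a *: x + b *: x').
Proof. by apply: ind_space_lin; exact: GS_closed. Qed.

Let qconv (y y' : half_smooth R n) (a b : R[i]) : ind_space q y -> ind_space q y' ->
  ind_space q (a *: y + b *: y').
Proof. exact: HS_ind_space_lin. Qed.

Let Tl (x x' : schwartz R n) (y : half_smooth R n) (a b : R[i]) :
  ind_space p x -> ind_space p x' -> ind_space q y ->
  T (a *: x + b *: x') y = a *: T x y + b *: T x' y.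
Proof.
move=> px px' qy; apply: val_inj.
apply: etrans (TE (pconv a b px px') qy) _.
apply: etrans _ (esym (f_equal2 (fun u v : 'rV[R]_n -> R[i] => a *: u + b *: v)
  (TE px qy) (TE px' qy))).
apply/funext => z.
have [_ -> _] := synthE z (pconv a b px px') qy.
have -> : (a *: synthesis (val x) (val y) + b *: synthesis (val x') (val y)) z =
  a * synthesis (val x) (val y) z + b * synthesis (val x') (val y) z by [].
have [_ -> i1] := synthE z px qy.
have [_ -> i2] := synthE z px' qy.
rewrite -Cint_lin//; congr Cintegral; apply/funext => w.
rewrite /wavelet_kernel /synthesis_kernel.
have -> : val (a *: x + b *: x') (w.1^-1 *: (z - rV_of_tuple w.2)) =
  a * val x (w.1^-1 *: (z - rV_of_tuple w.2)) + b * val x' (w.1^-1 *: (z - rV_of_tuple w.2)) by [].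
ring.
Qed.

Let Tr (x : schwartz R n) (y y' : half_smooth R n) (a b : R[i]) :
  ind_space p x -> ind_space q y -> ind_space q y' ->
  T x (a *: y + b *: y') = a *: T x y + b *: T x y'.
Proof.
move=> px qy qy'; apply: val_inj.
apply: etrans (TE px (qconv a b qy qy')) _.
apply: etrans _ (esym (f_equal2 (fun u v : 'rV[R]_n -> R[i] => a *: u + b *: v)
  (TE px qy) (TE px qy'))).
apply/funext => z.
have [_ -> _] := synthE z px (qconv a b qy qy').
have -> : (a *: synthesis (val x) (val y) + b *: synthesis (val x) (val y')) z =
  a * synthesis (val x) (val y) z + b * synthesis (val x) (val y') z by [].
have [_ -> i1] := synthE z px qy.
have [_ -> i2] := synthE z px qy'.
rewrite -Cint_lin//; congr Cintegral; apply/funext => w.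
rewrite /wavelet_kernel /synthesis_kernel.
have -> : val (a *: y + b *: y') (rV_of_tuple w.2, w.1) =
  a * val y (rV_of_tuple w.2, w.1) + b * val y' (rV_of_tuple w.2, w.1) by [].
ring.
Qed.

Let TZl0 x y a : ind_space p x -> ind_space q y -> T (a *: x) y = a *: T x y.
Proof. by move=> px qy; have := Tl a 0 px px qy; rewrite !scale0r !addr0. Qed.

Let TZr0 x y a : ind_space p x -> ind_space q y -> T x (a *: y) = a *: T x y.
Proof. by move=> px qy; have := Tr a 0 px qy qy; rewrite !scale0r !addr0. Qed.

Let TDl x x' y : ind_space p x -> ind_space p x' -> ind_space q y ->
  T (x + x') y = T x y + T x' y.
Proof. by move=> px px' qy; have := Tl 1 1 px px' qy; rewrite (scale1r x) (scale1r x') !(scale1r (T _ _)). Qed.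

Let TDr x y y' : ind_space p x -> ind_space q y -> ind_space q y' ->
  T x (y + y') = T x y + T x y'.
Proof. by move=> px qy qy'; have := Tr 1 1 px qy qy'; rewrite (scale1r y) (scale1r y') !(scale1r (T _ _)). Qed.

Let Tbound A : 1 <= A -> exists h' C, [/\ 0 < h', 0 <= C &
  forall x y P Q, 0 <= P -> 0 <= Q -> ind_space p x -> ind_space q y ->
    GS_bound rho1 rho2 A P (val x) -> HS_bound s t (t - rho2) tau A Q (val y) ->
    (r h' (T x y) <= (C * (P * Q))%:E)%E].
Proof.
move=> A1; have [C [B [C0 B1 H]]] := est A1.
have B0 : 0 < B by exact: lt_le_trans B1.
exists B^-1, C; split=> //; first by rewrite invr_gt0.
move=> x y P Q P0 Q0 px qy bx qy'.
apply: (@GS_bound_seminorm R n s' t B^-1 B (C * (P * Q))) => //.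
- by rewrite invr_gt0.
- by rewrite mulVf ?lt0r_neq0.
- exact: ltW.
- by rewrite !mulr_ge0.
rewrite (TE px qy); split.
  exact: (synthesis_smooth A1 rho2_ge0 rho2_t tau_ge0 P0 Q0 bx qy').
by move=> z c b; exact: (H _ _ P Q P0 Q0 bx qy' c b z).
Qed.

Let Tb h k : 0 < h -> 0 < k -> exists h' C, [/\ 0 < h', 0 <= C &
  forall x y, (p h x <= 1)%E -> (q k y <= 1)%E -> (r h' (T x y) <= C%:E)%E].
Proof.
move=> h0 k0.
have hi : 0 < h^-1 by rewrite invr_gt0.
have ki : 0 < k^-1 by rewrite invr_gt0.
have A1 : 1 <= 1 + h^-1 + k^-1 by lra.
have [h' [C [h'0 C0 H]]] := Tbound A1.
exists h', C; split=> // x y px qy.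
have := H x y 1 1 ler01 ler01; rewrite !mulr1; apply.
- by exists h => //; apply: le_lt_trans px _; exact: ltry.
- by exists k => //; apply: le_lt_trans qy _; exact: ltry.
- by apply: GS_seminorm_bound h0 _ ler01 px; lra.
- by apply: HS_seminorm_bound k0 _ ler01 qy; lra.
Qed.

Let T_GS x y : ind_space p x -> ind_space q y -> GS_set s' t (T x y).
Proof.
move=> px qy; have [A [P [Q [A1 P0 Q0 [bx bq]]]]] := bounds px qy.
have [h' [C [h'0 C0 H]]] := Tbound A1.
exists h' => //; apply: le_lt_trans (H x y P Q P0 Q0 px qy bx bq) _.
exact: ltry.
Qed.

Local Notation X1 := (GS0 n rho1 rho2).
Local Notation X2 := (HS n s t (t - rho2) tau).
Local Notation X3 := (GS0 n s' t).

Let pX (phi : X1) : ind_space p (val (val phi)).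
Proof. exact: set_valP (val phi). Qed.

Let qX (Phi : X2) : ind_space q (val Phi).
Proof. exact: (set_valP Phi 0%N). Qed.

Let T_zero_moments (phi : X1) (Phi : X2) :
  zero_moments (val (T (val (val phi)) (val Phi))).
Proof.
rewrite (TE (pX phi) (qX Phi)).
have [A [P [Q [A1 P0 Q0 [bx bq]]]]] := bounds (pX phi) (qX Phi).
apply: (synthesis_zero_moments A1 rho2_ge0 rho2_t tau_ge0 P0 Q0 bx bq).
exact: (set_valP phi).
Qed.

Let M_spec (phi : X1) (Phi : X2) : {m : X3 | val (val m) = T (val (val phi)) (val Phi)}.
Proof.
pose m0 : GS n s' t := SigSub (mem_set (T_GS (pX phi) (qX Phi))).
by exists (SigSub (mem_set (T_zero_moments phi Phi : GS0_set m0))).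
Qed.

Let M (phi : X1) (Phi : X2) : X3 := sval (M_spec phi Phi).

Let ME phi Phi : val (val (M phi Phi)) = T (val (val phi)) (val Phi).
Proof. exact: svalP (M_spec phi Phi). Qed.

Let valX1 (c : R[i]) (u v : X1) : val (val (c *: u + v)) = c *: val (val u) + val (val v).
Proof. exact: etrans (congr1 val (val_GS0_lin c u v)) (val_GS_lin c _ _). Qed.
Let valX2 (c : R[i]) (u v : X2) : val (c *: u + v) = c *: val u + val v.
Proof. by []. Qed.
Let valX3 (c : R[i]) (u v : X3) : val (val (c *: u + v)) = c *: val (val u) + val (val v).
Proof. exact: etrans (congr1 val (val_GS0_lin c u v)) (val_GS_lin c _ _). Qed.

Let M_linl Phi c (phi phi' : X1) : M (c *: phi + phi') Phi = c *: M phi Phi + M phi' Phi.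
Proof.
apply: val_inj; apply: val_inj.
apply: etrans (ME _ _) _; apply: etrans _ (esym (valX3 _ _ _)).
apply: etrans _ (esym (f_equal2 (fun u v => c *: u + v) (ME phi Phi) (ME phi' Phi))).
apply: etrans (congr1 (T^~ (val Phi)) (valX1 _ _ _)) _.
have := Tl c 1 (pX phi) (pX phi') (qX Phi).
by rewrite !scale1r.
Qed.

Let M_linr phi c (Phi Phi' : X2) : M phi (c *: Phi + Phi') = c *: M phi Phi + M phi Phi'.
Proof.
apply: val_inj; apply: val_inj.
apply: etrans (ME _ _) _; apply: etrans _ (esym (valX3 _ _ _)).
apply: etrans _ (esym (f_equal2 (fun u v => c *: u + v) (ME phi Phi) (ME phi Phi'))).
apply: etrans (congr1 (T (val (val phi))) (valX2 _ _ _)) _.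
have := Tr c 1 (pX phi) (qX Phi) (qX Phi').
by rewrite !scale1r.
Qed.

Let Mb : {bilinear X1 -> X2 -> X3} := HB.pack M
  (bilinear_isBilinear.Build R[i] X1 X2 X3 *:%R *:%R M
   (pair (fun Phi c phi phi' => M_linl Phi c phi phi')
     (fun phi c Phi Phi' => M_linr phi c Phi Phi'))).

(** Serves to split the increment of a bilinear map into its three terms. *)
Let ind_nbhs0_third U : ind_nbhs0 r U -> exists2 U', ind_nbhs0 r U' &
  forall x y z, U' x -> U' y -> U' z -> U (x + y + z).
Proof.
move=> BU; have [U1 BU1 H1] := ind_nbhs0_half rS BU.
have [U2 BU2 H2] := ind_nbhs0_half rS BU1.
exists (U2 `&` U1); first exact: ind_nbhs0I.
by move=> x y z [Ux _] [Uy _] [_ Uz]; apply: H1 => //; exact: H2.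
Qed.

Let M_continuous : continuous (fun z : X1 * X2 => M z.1 z.2).
Proof.
apply: continuous_comp_initial => -[phi0 Phi0] N.
move=> [Z [oZ Zx ZN]].
have [U BU HU] := oZ _ Zx.
have [U1 BU1 HU1] := ind_nbhs0_third BU.
have [V [W [BV BW Vp Wq VW]]] := bilinear_inductive_nbhs0 pS qS rS Tl Tr pconv qconv Tb BU1.
set x0 := val (val phi0); set y0 := val Phi0.
have [l l0 Vl] := ind_nbhs0_absorb pS p0 BV (pX phi0).
have [m m0 Wm] := ind_nbhs0_absorb qS q0 BW (qX Phi0).
have N1 := GS0_nbhs phi0 (ind_nbhs0I BV (ind_nbhs0_scale (m^-1)%:C%C pS BV)).
have N2 := HS_nbhs Phi0 (ind_nbhs0I BW (ind_nbhs0_scale (l^-1)%:C%C qS BW)).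
pose A1 := [set y : X1 | (V `&` [set x | V ((m^-1)%:C%C *: x)]) (val (val y) - x0)].
pose A2 := [set y : X2 | (W `&` [set x | W ((l^-1)%:C%C *: x)]) (val y - y0)].
exists (A1, A2); first by split; [exact: N1|exact: N2].
move=> [phi Phi] [/= [V1 V2] [W1 W2]].
apply: ZN => /=.
set x := val (val phi) in V1 V2; set y := val Phi in W1 W2.
have px : ind_space p x := pX phi.
have px0 : ind_space p x0 := pX phi0.
have qy : ind_space q y := qX Phi.
have qy0 : ind_space q y0 := qX Phi0.
have pdx := Vp _ V1; have qdy := Wq _ W1.
have cK (k : R) : 0 < k -> k%:C%C * (k^-1)%:C%C = 1 :> R[i].
  by move=> k0; rewrite -rmorphM mulfV ?lt0r_neq0.
have t1 : U1 (T (x - x0) (y - y0)) by exact: VW.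
(* x0 has a multiple in V and y0 one in W; bilinearity moves the factors l and m
   across to the increments, which lie in dilates of W and V. *)
have t2 : U1 (T x0 (y - y0)).
  have E : T (l%:C%C *: x0) ((l^-1)%:C%C *: (y - y0)) = T x0 (y - y0).
    by rewrite (TZl0 _ px0 (Wq _ W2)) (TZr0 _ px0 qdy) scalerA cK// scale1r.
  by rewrite -E; exact: VW.
have t3 : U1 (T (x - x0) y0).
  have E : T ((m^-1)%:C%C *: (x - x0)) (m%:C%C *: y0) = T (x - x0) y0.
    by rewrite (TZl0 _ pdx (Wq _ Wm)) (TZr0 _ pdx qy0) scalerA mulrC cK// scale1r.
  by rewrite -E; exact: VW.
have TD : T x y - T x0 y0 = T (x - x0) (y - y0) + T x0 (y - y0) + T (x - x0) y0.
  have -> : T x y = T x0 y0 + T x0 (y - y0) + (T (x - x0) y0 + T (x - x0) (y - y0)).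
    rewrite -(TDr px0 qy0 qdy) -(TDr pdx qy0 qdy) (addrC y0) subrK.
    by rewrite -(TDl px0 pdx qy) (addrC x0) subrK.
  move: (T x0 y0) (T x0 _) (T _ y0) (T _ _) => a b c d.
  by rewrite addrC addrA addKr (addrC c) addrA (addrC b).
have := HU1 _ _ _ t1 t2 t3; rewrite -TD => UT.
have HM := HU (val (M phi Phi) - val (M phi0 Phi0)).
have EM : val (val (M phi Phi) - val (M phi0 Phi0)) = T x y - T x0 y0.
  by apply: etrans (val_GS_sub _ _) _; 
  exact: (f_equal2 (fun u v : schwartz R n => u - v) (ME phi Phi) (ME phi0 Phi0)).
rewrite EM in HM; have := HM UT.
by rewrite addrC subrK.
Qed.

Lemma synthesis_continuous : synthesis_continuous_bilinear n rho1 rho2 s t (t - rho2) tau s' t.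
Proof.
exists Mb; split; last exact: M_continuous.
move=> phi Phi x.
have [c1 _ _] := synthE x (pX phi) (qX Phi).
split; first exact: c1.
have : val (val (val (M phi Phi))) = synthesis (val (val (val phi))) (val (val Phi)).
  exact: etrans (congr1 val (ME phi Phi)) (TE (pX phi) (qX Phi)).
by move=> /(congr1 (fun f => f x)).
Qed.

End synthesis_map.

Section estimates.
Context {R : realType} {n : nat}.
Variables (rho1 rho2 s t tau : R).
Hypotheses (rho2_ge0 : 0 <= rho2) (rho2_t : rho2 <= t).

Lemma word_mindexK (b : {ffun 'I_n -> nat}) : word_mindex (mword b) = b.
Proof. by apply/ffunP => i; rewrite ffunE count_mem_mword. Qed.

Local Notation mass := (\int[(@lebesgue_measure R \x lebesgue_tuple n)%E]_z @half_decay R n z).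

Let mass_ge0 : 0 <= mass.
Proof. by apply: Rintegral_ge0 => z _; exact: half_decay_ge0. Qed.

(** Here b!^rho1 comes from phi and b!^(s - rho1) from the decay of Phi for small
    a. *)
Lemma synthesis_estimate_wavelet : rho1 <= s ->
  synthesis_estimate (n := n) rho1 rho2 tau t (s - rho1) s.
Proof.
move=> rs A A1; have sr0 : 0 <= s - rho1 by rewrite subr_ge0.
have [C [B [C0 B1 H]]] := @wavelet_kernel_bound R n rho1 rho2 tau t (s - rho1) A A1 rho2_ge0 rho2_t sr0.
exists (2 * (C * mass)), B; split=> //; first by rewrite !mulr_ge0.
move=> phi Phi P Q P0 Q0 bphi bPhi al b x.
have := synthesis_bound_wavelet A1 rho2_ge0 rho2_t sr0 P0 Q0 bphi bPhi
  (H phi Phi P Q P0 Q0 bphi bPhi al (mword b) x).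
move=> /le_trans; apply; rewrite word_mindexK size_mword.
rewrite -(powRD (x := (mfact b)%:R)); last first.
  by apply/implyP => _; rewrite pnatr_eq0 -lt0n mfact_gt0.
rewrite (addrC rho1) subrK le_eqVlt; apply/orP; left; apply/eqP; ring.
Qed.

Lemma synthesis_estimate_data : 0 <= tau ->
  synthesis_estimate (n := n) rho1 rho2 s t tau s.
Proof.
move=> tau0 A A1.
have [C [B [C0 B1 H]]] := @data_kernel_bound R n rho1 rho2 s t tau A A1 rho2_ge0 rho2_t tau0.
exists (2 * (C * mass)), B; split=> //; first by rewrite !mulr_ge0.
move=> phi Phi P Q P0 Q0 bphi bPhi al b x.
have := synthesis_bound_data A1 rho2_ge0 rho2_t tau0 P0 Q0 bphi bPhi
  (H phi Phi P Q P0 Q0 bphi bPhi al (mword b) x).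
move=> /le_trans; apply; rewrite word_mindexK size_mword.
rewrite le_eqVlt; apply/orP; left; apply/eqP; ring.
Qed.

End estimates.

Theorem theorem2 (R : realType) (n : nat) (rho1 rho2 s t tau : R)
    (n_gt0 : (0 < n)%N) (rho1_gt0 : 0 < rho1) (rho2_gt1 : 1 < rho2)
    (s_gt0 : 0 < s) (t_gt : rho2 < t) (tau_gt0 : 0 < tau) :
  (rho1 < s ->
    synthesis_continuous_bilinear n rho1 rho2 tau t (t - rho2) (s - rho1) s t) /\
  synthesis_continuous_bilinear n rho1 rho2 s t (t - rho2) tau s t.
Proof.
have rho2_ge0 : 0 <= rho2 by lra.
have rho2_t : rho2 <= t by exact: ltW.
split=> [rho1_s|].
  apply: synthesis_continuous => //; first by rewrite subr_ge0 ltW.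
  by apply: synthesis_estimate_wavelet => //; exact: ltW.
apply: synthesis_continuous => //; first exact: ltW.
by apply: synthesis_estimate_data => //; exact: ltW.
Qed.
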